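(* Let $P$ and $Q$ be two parallel circles in $\mathbb{R}^3$ centered about a common axis, let $R$ be the maximum of the radii of $P$ and $Q$, and let $D_R$ be a disc in $\mathbb{R}^2$ of radius $R$. Let $\Sigma$ be a surface in $\mathcal{S}$, where $\mathcal{S}$ is the set of all compact smoothly immersed surfaces of revolution in $\mathbb{R}^3$ with two boundary components, given by $P$ and $Q$. Assume that $\Sigma$ has a connected component which is diffeomorphic to a disc. Then \[ \lambda_1(\Sigma) \le \lambda_1(D_R). \]
   Context: The circles $P$ and $Q$ are distinct, lie in parallel (possibly equal) planes, and are centered on a common axis orthogonal to these planes; surfaces in $\mathcal{S}$ are surfaces of revolution about this axis and are not required to be connected. $\lambda_1(\Sigma)$ denotes the first Dirichlet eigenvalue of $-\Delta_\Sigma$, where $\Delta_\Sigma$ is the Laplace-Beltrami operator on $\Sigma$ (metric induced from $\mathbb{R}^3$), and $\lambda_1(D_R)$ is the first Dirichlet eigenvalue of $-\Delta$ on the flat disc $D_R$. *)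

(* Defs.v *)
From Stdlib Require Import Reals ZArith List Permutation.
From Coquelicot Require Import Coquelicot.
Import ListNotations.
Open Scope R_scope.

(* [ex_diff_n f n x y] amounts to "of class C^n" only when it is required at
   all points of an open set, as is always the case below. *)
Definition C2_at (f : R -> R -> R) (x y : R) : Prop := ex_diff_n f 2 x y.

Definition smooth_at (f : R -> R -> R) (x y : R) : Prop :=
  forall n : nat, ex_diff_n f n x y.

Definition R3 : Type := (R * R * R)%type.

Definition pr1 (v : R3) : R := fst (fst v).
Definition pr2 (v : R3) : R := snd (fst v).
Definition pr3 (v : R3) : R := snd v.

Definition dot (v w : R3) : R := pr1 v * pr1 w + pr2 v * pr2 w + pr3 v * pr3 w.

(* The axis is the line through [origin] directed by [axis_dir]. *)
Record frame : Type := Frame {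
  origin : R3;
  dir1 : R3;
  dir2 : R3;
  axis_dir : R3
}.

Definition orthonormal (A : frame) : Prop :=
  dot (dir1 A) (dir1 A) = 1 /\ dot (dir2 A) (dir2 A) = 1 /\
  dot (axis_dir A) (axis_dir A) = 1 /\ dot (dir1 A) (dir2 A) = 0 /\
  dot (dir1 A) (axis_dir A) = 0 /\ dot (dir2 A) (axis_dir A) = 0.

Definition cylindrical (A : frame) (r theta h : R) : R3 :=
  let coord (p : R3 -> R) :=
    p (origin A) + r * cos theta * p (dir1 A) + r * sin theta * p (dir2 A)
    + h * p (axis_dir A) in
  (coord pr1, coord pr2, coord pr3).

(* The circle [{cylindrical A radius theta height | theta}], which is centered
   on the axis of [A] and lies in a plane orthogonal to it. *)
Record circle : Type := Circle { radius : R; height : R }.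

(* A connected compact surface of revolution is swept out by a profile curve
   [t |-> (rad t, hgt t)] in a half-plane bounded by the axis.  The curve is
   either an arc parametrized by [0, 1], each end of which lies on the axis
   ([Pole]) or sweeps out a boundary circle ([Boundary]), or a closed curve of
   period 1 that avoids the axis. *)
Inductive end_kind : Type := Pole | Boundary.

Inductive profile_kind : Type :=
  | Arc (at0 at1 : end_kind)
  | Loop.

Record component : Type := Component {
  kind : profile_kind;
  rad : R -> R;
  hgt : R -> R
}.

Definition ends (c : component) : list (R * end_kind) :=
  match kind c with
  | Arc e0 e1 => [(0, e0); (1, e1)]
  | Loop => []
  end.

Definition is_pole (c : component) (t : R) : Prop := In (t, Pole) (ends c).

Definition is_boundary (c : component) (t : R) : Prop :=
  In (t, Boundary) (ends c).

Definition dom (c : component) (t : R) : Prop :=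
  match kind c with Arc _ _ => 0 <= t <= 1 | Loop => True end.

Definition inner (c : component) (t : R) : Prop :=
  match kind c with Arc _ _ => 0 < t < 1 | Loop => True end.

(* The condition at a pole says that [rad] and [hgt] extend across it as an odd
   and an even smooth function, respectively; equivalently, the immersion is
   smooth in the coordinates [(s cos theta, s sin theta)], where [s] is the
   parameter distance to the pole.  Every surface of revolution that is smooth
   at the pole has such a parametrization, e.g. by a multiple of arc length.
   Asking for smoothness of [rad] and [hgt] on the whole line is no loss of
   generality, as smooth functions on [0, 1] extend. *)
Record valid_component (c : component) : Prop := {
  profile_smooth : forall (n : nat) (t : R),
    ex_derive_n (rad c) n t /\ ex_derive_n (hgt c) n t;
  profile_regular : forall t : R, dom c t ->
    (Derive (rad c) t, Derive (hgt c) t) <> (0, 0);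
  profile_off_axis : forall t : R, dom c t -> ~ is_pole c t -> 0 < rad c t;
  profile_pole : forall t : R, is_pole c t -> forall k : nat,
    Derive_n (rad c) (2 * k) t = 0 /\ Derive_n (hgt c) (2 * k + 1) t = 0;
  profile_closed : kind c = Loop -> forall t : R,
    rad c (t + 1) = rad c t /\ hgt c (t + 1) = hgt c t
}.

Definition immersion (A : frame) (c : component) (t theta : R) : R3 :=
  cylindrical A (rad c t) theta (hgt c t).

(* When the parameters [(t, theta)] and [(t', theta')] denote the same point of
   the abstract surface (which is not the same as having the same image, since
   the immersion need not be injective). *)
Definition same_point (c : component) (t theta t' theta' : R) : Prop :=
  match kind c with
  | Arc _ _ =>
      t' = t /\
      (is_pole c t \/ exists k : Z, theta' = theta + 2 * PI * IZR k)
  | Loop =>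
      (exists j : Z, t' = t + IZR j) /\
      (exists k : Z, theta' = theta + 2 * PI * IZR k)
  end.

Definition component_boundary (c : component) : list circle :=
  flat_map (fun e : R * end_kind =>
              match snd e with
              | Pole => []
              | Boundary => [Circle (rad c (fst e)) (hgt c (fst e))]
              end) (ends c).

(* The disjoint union of its components. *)
Definition surface : Type := list component.

Definition in_S (P Q : circle) (Sigma : surface) : Prop :=
  (forall c : component, In c Sigma -> valid_component c) /\
  Permutation (flat_map component_boundary Sigma) [P; Q].

Definition well_defined (c : component) (u : R -> R -> R) : Prop :=
  forall t theta t' theta' : R, dom c t -> dom c t' ->
    same_point c t theta t' theta' -> u t theta = u t' theta'.

(* Near a pole [(t, theta)] are polar coordinates, so regularity there has to be
   expressed in the corresponding Cartesian coordinates. *)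
Definition regular_at_poles (reg : (R -> R -> R) -> R -> R -> Prop)
    (c : component) (u : R -> R -> R) : Prop :=
  forall t0 : R, is_pole c t0 ->
    exists (U : R -> R -> R) (eps : R), 0 < eps /\
      (forall x y : R, x ^ 2 + y ^ 2 < eps ^ 2 -> reg U x y) /\
      (forall t theta : R, dom c t -> Rabs (t - t0) < eps ->
         u t theta = U (Rabs (t - t0) * cos theta) (Rabs (t - t0) * sin theta)).

(* Smoothness up to the boundary. *)
Definition smooth_on_component (c : component) (u : R -> R -> R) : Prop :=
  well_defined c u /\ regular_at_poles smooth_at c u /\
  exists v : R -> R -> R, (forall t theta : R, smooth_at v t theta) /\
    (forall t theta : R, dom c t -> v t theta = u t theta).

Definition closed_disc (rho : R) (p : R * R) : Prop :=
  fst p ^ 2 + snd p ^ 2 <= rho ^ 2.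

Definition smooth_on_closed_disc (rho : R) (f : R -> R -> R) : Prop :=
  exists g : R -> R -> R, (forall x y : R, smooth_at g x y) /\
    (forall x y : R, closed_disc rho (x, y) -> g x y = f x y).

(* A bijection is a diffeomorphism when it and its inverse pull smooth functions
   back to smooth functions. *)
Definition diffeomorphic_to_disc (c : component) : Prop :=
  exists Phi : R -> R -> R * R,
    (forall t theta : R, dom c t -> closed_disc 1 (Phi t theta)) /\
    (forall p : R * R, closed_disc 1 p ->
       exists t theta : R, dom c t /\ Phi t theta = p) /\
    (forall t theta t' theta' : R, dom c t -> dom c t' ->
       (Phi t theta = Phi t' theta' <-> same_point c t theta t' theta')) /\
    (forall f : R -> R -> R,
       smooth_on_closed_disc 1 f <->
       smooth_on_component c
         (fun t theta => f (fst (Phi t theta)) (snd (Phi t theta)))).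

Definition partial1 (f : R -> R -> R) : R -> R -> R := partial_derive 1 0 f.
Definition partial2 (f : R -> R -> R) : R -> R -> R := partial_derive 0 1 f.

Definition vpartial (d : (R -> R -> R) -> R -> R -> R) (X : R -> R -> R3)
    (t theta : R) : R3 :=
  (d (fun a b => pr1 (X a b)) t theta,
   d (fun a b => pr2 (X a b)) t theta,
   d (fun a b => pr3 (X a b)) t theta).

Definition g11 (X : R -> R -> R3) (t theta : R) : R :=
  dot (vpartial partial1 X t theta) (vpartial partial1 X t theta).
Definition g12 (X : R -> R -> R3) (t theta : R) : R :=
  dot (vpartial partial1 X t theta) (vpartial partial2 X t theta).
Definition g22 (X : R -> R -> R3) (t theta : R) : R :=
  dot (vpartial partial2 X t theta) (vpartial partial2 X t theta).

Definition area_density (X : R -> R -> R3) (t theta : R) : R :=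
  sqrt (g11 X t theta * g22 X t theta - g12 X t theta ^ 2).

(* [1 / sqrt (det g) * sum_ij d_i (sqrt (det g) * g^ij * d_j u)], where
   [sqrt (det g) * g^ij] is the cofactor matrix of [g] over [sqrt (det g)]. *)
Definition laplace_beltrami (X : R -> R -> R3) (u : R -> R -> R)
    (t theta : R) : R :=
  (partial1 (fun a b =>
     (g22 X a b * partial1 u a b - g12 X a b * partial2 u a b)
     / area_density X a b) t theta
   + partial2 (fun a b =>
     (g11 X a b * partial2 u a b - g12 X a b * partial1 u a b)
     / area_density X a b) t theta)
  / area_density X t theta.

(* Eigenfunctions are classical: of class C^2 in the interior, continuous up to
   the boundary, and zero there.  By elliptic regularity they are smooth up to
   the boundary. *)

(* The equation is imposed away from the poles, where [(t, theta)] are genuine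
   coordinates; it holds at the poles by continuity. *)
Definition dirichlet_solution (A : frame) (c : component) (lambda : R)
    (u : R -> R -> R) : Prop :=
  well_defined c u /\
  regular_at_poles C2_at c u /\
  (forall t theta : R, inner c t -> C2_at u t theta) /\
  continuous_on (fun p : R * R => dom c (fst p))
    (fun p : R * R => u (fst p) (snd p)) /\
  (forall t theta : R, is_boundary c t -> u t theta = 0) /\
  (forall t theta : R, inner c t ->
     - laplace_beltrami (immersion A c) u t theta = lambda * u t theta).

(* A function on the surface is a family of functions on its components, indexed
   by their position in the list. *)
Definition dirichlet_eigenvalue (A : frame) (Sigma : surface) (lambda : R) :
    Prop :=
  exists u : nat -> R -> R -> R,
    (forall (i : nat) (c : component), nth_error Sigma i = Some c ->
       dirichlet_solution A c lambda (u i)) /\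
    (exists (i : nat) (c : component) (t theta : R),
       nth_error Sigma i = Some c /\ dom c t /\ u i t theta <> 0).

Definition disc_dirichlet_eigenvalue (rho lambda : R) : Prop :=
  exists f : R -> R -> R,
    (forall x y : R, x ^ 2 + y ^ 2 < rho ^ 2 -> C2_at f x y) /\
    continuous_on (closed_disc rho) (fun p : R * R => f (fst p) (snd p)) /\
    (forall x y : R, x ^ 2 + y ^ 2 = rho ^ 2 -> f x y = 0) /\
    (forall x y : R, x ^ 2 + y ^ 2 < rho ^ 2 ->
       - (partial_derive 2 0 f x y + partial_derive 0 2 f x y)
       = lambda * f x y) /\
    (exists x y : R, closed_disc rho (x, y) /\ f x y <> 0).

(* The spectrum is discrete and bounded below, so the infimum is the smallest
   eigenvalue. *)
Definition lambda1 (A : frame) (Sigma : surface) : Rbar :=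
  Glb_Rbar (dirichlet_eigenvalue A Sigma).

Definition lambda1_disc (rho : R) : Rbar :=
  Glb_Rbar (disc_dirichlet_eigenvalue rho).

(* Main.v *)
Require Import Defs.
From Stdlib Require Import Reals List.
From Stdlib Require Import ZArith Lra Lia Factorial Classical Permutation IndefiniteDescription.
From Coquelicot Require Import Coquelicot.
Open Scope R_scope.

(* The boundary circle of radius [R] bounds a disc component (unless the given disc
   component is closed, and then [0] is an eigenvalue).  In polar coordinates its
   rotationally symmetric solutions satisfy [V' = lam * r * l * w], [w' = - (l / r) * V],
   where [r] is the distance to the axis and [l] the speed of the profile.  Let [J] be the
   corresponding solution on the flat disc of radius [R].

   If [mu] is an eigenvalue of the flat disc and [mu' > mu], then [J] for the parameter
   [mu'] has a zero in [0, R]: otherwise it is a positive strict supersolution, and the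
   maximum principle excludes [mu].  Since [r' <= l], a Wronskian of [w] and [J o r] is
   monotone, and so [w] for [mu'] also has a zero.  Lowering the parameter until the zero
   leaves through the boundary gives an eigenvalue at most [mu'] of the surface. *)

(** * Real analysis *)

(** [lambda1] is an infimum over classical eigenvalues, so a test function in a Rayleigh quotient
    does not suffice: an eigenfunction of the surface has to be produced, of class C^2 across the
    pole and zero on the boundary. Hence the use of an ordinary differential equation and of
    shooting. The equation is singular at the pole, where [r] vanishes; as a system for [w] and the
    flux [V = - (r / l) * w'] it becomes an integral equation, solved by a Neumann series that
    starts from the constant 1. The strict inequality [mu' > mu] keeps the argument on the flat disc
    elementary: it makes the second derivative test at an interior maximum contradictory, where
    equality would call for a strong maximum principle. Letting [mu'] tend to [mu] costs nothing in
    the infimum. The component must be bounded by the larger circle, since shrinking a disc raises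
    its eigenvalues. The given disc component may be bounded by the smaller one; counting circles
    then supplies a second component with one circle, and for this count an annulus must be told
    apart from a disc. *)

Lemma lipschitz_continuous (f : R -> R) (C t : R) :
  (forall s, Rabs (f s - f t) <= C * Rabs (s - t)) -> continuous f t.
Proof.
intros H. apply continuity_pt_filterlim. intros eps Heps.
assert (HC : 0 <= Rabs C) by apply Rabs_pos.
exists (eps / (Rabs C + 1)); split.
  apply Rdiv_lt_0_compat; lra.
intros s [_ Hs]; simpl in *; unfold Rdist in *.
apply Rle_lt_trans with (1 := H s).
apply Rle_lt_trans with (Rabs C * Rabs (s - t)).
  apply Rmult_le_compat_r; [apply Rabs_pos | apply Rle_abs].
apply Rmult_lt_compat_r with (r := Rabs C + 1) in Hs; [|lra].
unfold Rdiv in Hs; rewrite Rmult_assoc, Rinv_l in Hs by lra.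
assert (0 <= Rabs (s - t)) by apply Rabs_pos. nra.
Qed.

Lemma continuous_eps (f : R -> R) (x : R) :
  continuous f x <->
  forall eps, 0 < eps -> exists d, 0 < d /\ forall y, Rabs (y - x) < d -> Rabs (f y - f x) < eps.
Proof.
split; intros H.
  intros eps Heps.
  assert (H1 := proj1 (filterlim_locally _ _) H (mkposreal _ Heps)).
  destruct H1 as [d Hd]. exists d; split; [apply cond_pos|].
  intros y Hy; apply Hd, Hy.
apply filterlim_locally; intros eps.
destruct (H eps (cond_pos eps)) as [d [Hd H1]].
exists (mkposreal d Hd); intros y Hy; apply H1, Hy.
Qed.

Lemma ex_RInt_cont (f : R -> R) (a b : R) :
  (forall s, continuous f s) -> ex_RInt f a b.
Proof. intros Hf; apply (ex_RInt_continuous (V := R_CompleteNormedModule)); intros z _; apply Hf. Qed.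

Lemma RInt_split (f : R -> R) (a b c : R) :
  (forall s, continuous f s) -> RInt f a b + RInt f b c = RInt f a c.
Proof.
intros Hf. apply (RInt_Chasles (V := R_CompleteNormedModule)); now apply ex_RInt_cont.
Qed.

Lemma RInt_ext_all (f g : R -> R) (a b : R) : (forall s, f s = g s) -> RInt f a b = RInt g a b.
Proof. intros H; apply RInt_ext; intros s _; apply H. Qed.

Lemma RInt_lin (f g : R -> R) (a b c : R) :
  (forall s, continuous f s) -> (forall s, continuous g s) ->
  RInt (fun s => f s + c * g s) a b = RInt f a b + c * RInt g a b.
Proof.
intros Hf Hg.
rewrite (RInt_plus (V := R_CompleteNormedModule) f (fun s => c * g s)).
- now rewrite (RInt_scal (V := R_CompleteNormedModule) g) by now apply ex_RInt_cont.
- now apply ex_RInt_cont.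
- apply ex_RInt_cont. intros s. apply (continuous_scal_r c g), Hg.
Qed.

Lemma RInt_pow_0 (m : nat) (t : R) : is_RInt (fun s => s ^ m) 0 t (t ^ (m + 1) / INR (m + 1)).
Proof.
assert (Hm : INR (m + 1) <> 0) by (apply not_0_INR; lia).
evar_last.
  apply (is_RInt_derive (fun s => s ^ (m + 1) / INR (m + 1)) (fun s => s ^ m)).
    intros x _. auto_derive; [easy|]. replace (Nat.pred (m + 1)) with m by lia. field; exact Hm.
  intros x _. apply (ex_derive_continuous (K := R_AbsRing) (V := R_NormedModule)). now auto_derive.
unfold minus, plus, opp; simpl. rewrite (pow_i (m + 1)) by lia. unfold Rdiv; ring.
Qed.

Lemma ex_series_exp (x : R) : ex_series (fun n => x ^ n / INR (fact n)).
Proof.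
exists (exp x). generalize (is_exp_Reals x); unfold is_pseries.
apply is_series_ext; intros n. rewrite pow_n_pow. reflexivity.
Qed.

(** The majorant for Lipschitz bounds: the n-th power has Lipschitz constant [n * L ^ (n - 1)] on
    [- L, L]. *)
Lemma ex_series_exp_shift (x : R) : ex_series (fun n => INR n * x ^ pred n / INR (fact n)).
Proof.
apply ex_series_incr_1.
apply (ex_series_ext (fun n => x ^ n / INR (fact n))); [|apply ex_series_exp].
intros n. replace (fact (S n)) with (S n * fact n)%nat by reflexivity.
rewrite mult_INR. simpl pred.
match goal with |- ?a = ?b => change (@eq R a b) end. field.
split; [apply INR_fact_neq_0 | apply not_0_INR; lia].
Qed.

Lemma Series_minus_bound (a b c : nat -> R) (d : R) :
  ex_series a -> ex_series b -> ex_series c ->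
  (forall n, Rabs (a n - b n) <= c n * d) ->
  Rabs (Series a - Series b) <= Series c * d.
Proof.
intros Ha Hb Hc H.
rewrite <- Series_minus by assumption.
rewrite (Rmult_comm _ d), <- Series_scal_l.
assert (Hcd : ex_series (fun n => d * c n)) by now apply (ex_series_scal_l d c).
assert (Hab : ex_series (fun n => Rabs (a n - b n))).
  apply (ex_series_le (K := R_AbsRing) (V := R_CompleteNormedModule) _ (fun n => d * c n)); [|exact Hcd].
  intros n; unfold norm; simpl; unfold abs; simpl. rewrite Rabs_Rabsolu, Rmult_comm; apply H.
apply Rle_trans with (1 := Series_Rabs _ Hab).
apply Series_le; [|exact Hcd].
intros n; split; [apply Rabs_pos | rewrite Rmult_comm; apply H].
Qed.

Lemma pow_minus_bound (x y L : R) (n : nat) :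
  Rabs x <= L -> Rabs y <= L -> Rabs (x ^ n - y ^ n) <= INR n * L ^ pred n * Rabs (x - y).
Proof.
intros Hx Hy. assert (HL : 0 <= L) by (apply Rle_trans with (2 := Hx), Rabs_pos).
induction n as [|n IH].
  simpl. rewrite Rminus_diag, Rabs_R0; lra.
replace (x ^ S n - y ^ S n) with (x * (x ^ n - y ^ n) + y ^ n * (x - y)) by (simpl; ring).
apply Rle_trans with (1 := Rabs_triang _ _).
rewrite !Rabs_mult, <- RPow_abs.
assert (H1 : Rabs y ^ n <= L ^ n) by (apply pow_incr; split; [apply Rabs_pos | exact Hy]).
assert (H2 : Rabs x * Rabs (x ^ n - y ^ n) <= INR n * L ^ n * Rabs (x - y)).
  destruct n as [|n].
    simpl. rewrite Rminus_diag, Rabs_R0; lra.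
  apply Rle_trans with (L * (INR (S n) * L ^ n * Rabs (x - y))).
    apply Rmult_le_compat; try apply Rabs_pos; assumption.
  right; simpl; ring.
rewrite S_INR; simpl pred.
assert (0 <= Rabs (x - y)) by apply Rabs_pos. nra.
Qed.

Lemma derive_nonneg_le (f df : R -> R) (a b : R) :
  a <= b -> (forall t, a <= t <= b -> continuous f t) ->
  (forall t, a < t < b -> is_derive f t (df t)) -> (forall t, a < t < b -> 0 <= df t) ->
  f a <= f b.
Proof.
intros Hab Hc Hd Hp. destruct (Req_dec a b) as [->|Hne]; [lra|].
(* The mean value point may be an endpoint, where nothing is known of [df]; the truncation is
   nonnegative there as well. *)
destruct (MVT_gen f a b (fun t => Rmax 0 (df t))) as [c [Hcc E]].
- rewrite Rmin_left, Rmax_right by lra. intros x Hx.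
  rewrite Rmax_right; [now apply Hd | now apply Hp].
- rewrite Rmin_left, Rmax_right by lra. intros x Hx. now apply continuity_pt_filterlim, Hc.
- assert (0 <= Rmax 0 (df c)) by apply Rmax_l. nra.
Qed.

(** The zero is the supremum of the points up to which [f] is positive: a value of either sign there
    would persist nearby and contradict the choice. *)
Lemma first_zero (f : R -> R) (a b : R) :
  (forall x, continuous f x) -> a <= b -> 0 < f a -> f b <= 0 ->
  exists c, a < c <= b /\ f c = 0 /\ forall x, a <= x < c -> 0 < f x.
Proof.
intros Hf Hab Ha Hb.
set (E := fun x => a <= x <= b /\ forall y, a <= y <= x -> 0 < f y).
assert (Ea : E a) by (split; [lra|]; intros y Hy; now replace y with a by lra).
destruct (completeness E) as [c [Hc1 Hc2]].
  exists b; intros x [Hx _]; lra.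
  now exists a.
assert (Hac : a <= c) by now apply Hc1.
assert (Hcb : c <= b) by (apply Hc2; intros x [Hx _]; lra).
assert (Hbelow : forall x, a <= x < c -> 0 < f x).
  intros x Hx. destruct (classic (exists y, E y /\ x < y)) as [[y [[Hy1 Hy2] Hxy]]|Hn].
    apply Hy2; lra.
  assert (c <= x); [|lra]. apply Hc2; intros y Hy. destruct (Rle_or_lt y x); [easy|].
  exfalso; apply Hn; now exists y.
assert (Hfc : f c = 0).
  destruct (Rtotal_order (f c) 0) as [Hlt|[Heq|Hgt]]; [|exact Heq|].
  - destruct (proj1 (continuous_eps f c) (Hf c) (- f c) ltac:(lra)) as [d [Hd H]].
    assert (a < c) by (destruct (Req_dec a c); [subst; lra | lra]).
    set (x := Rmax a (c - d / 2)).
    assert (Hx : a <= x < c /\ c - x < d).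
      unfold x, Rmax; destruct Rle_dec; lra.
    assert (H1 := H x). rewrite Rabs_left in H1 by lra. specialize (H1 ltac:(lra)).
    apply Rabs_def2 in H1. assert (H2 := Hbelow x (proj1 Hx)). lra.
  - destruct (proj1 (continuous_eps f c) (Hf c) (f c) ltac:(lra)) as [d [Hd H]].
    assert (Hnc : c < b) by (destruct (Req_dec c b); [subst; lra | lra]).
    set (x := Rmin b (c + d / 2)).
    assert (Hx : c < x <= b /\ x - c < d) by (unfold x, Rmin; destruct Rle_dec; lra).
    assert (E x); [|assert (x <= c) by (now apply Hc1); lra].
    split; [lra|]. intros y Hy. destruct (Rlt_or_le y c); [apply Hbelow; lra|].
    assert (H1 := H y). rewrite Rabs_pos_eq in H1 by lra. specialize (H1 ltac:(lra)).
    apply Rabs_def2 in H1. lra.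
exists c; split; [|split; assumption].
split; [|exact Hcb]. destruct (Req_dec a c); [subst; lra | lra].
Qed.

(** By the mean value theorem the difference quotients at [x] are values of [d] near [x]. This
    carries derivative formulas across the origin, where the norm is not differentiable. *)
Lemma derive_extension (f d : R -> R) (x eps : R) :
  0 < eps -> (forall y, Rabs (y - x) < eps -> continuous f y) ->
  (forall y, Rabs (y - x) < eps -> y <> x -> is_derive f y (d y)) ->
  continuous d x -> is_derive f x (d x).
Proof.
intros He Hf Hd Hc. apply is_derive_Reals. intros eta Heta.
destruct (proj1 (continuous_eps d x) Hc eta Heta) as [del [Hdel H]].
assert (Hm : 0 < Rmin eps del) by now apply Rmin_glb_lt.
exists (mkposreal _ Hm). intros h Hh Hh'; simpl in Hh'.
assert (M1 := Rmin_l eps del). assert (M2 := Rmin_r eps del).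
assert (Hin : forall z, Rmin x (x + h) <= z <= Rmax x (x + h) -> Rabs (z - x) <= Rabs h).
  intros z. unfold Rmin, Rmax. destruct Rle_dec; intros Hz;
    [rewrite !Rabs_pos_eq | rewrite !Rabs_left1]; lra.
destruct (MVT_gen f x (x + h) d) as [c [Hcc E]].
- intros z Hz. apply Hd.
    assert (H1 := Hin z ltac:(lra)). lra.
  intros ->. revert Hz; unfold Rmin, Rmax; destruct Rle_dec; lra.
- intros z Hz. apply continuity_pt_filterlim, Hf. assert (H1 := Hin z Hz). lra.
- rewrite E. replace (d c * (x + h - x) / h - d x) with (d c - d x) by (field; exact Hh).
  apply H. assert (H1 := Hin c Hcc). lra.
Qed.

(** * The radial equation *)

Section RadialEquation.

(** In the application [q = r * l] and [k = l / r]. As [r] vanishes to first order at the pole, [q]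
    is at most linear and [k] at most of order [1 / t]. *)
Variables (T A B : R) (k q : R -> R).
Hypothesis T_pos : 0 < T.
Hypothesis q_cont : forall t, continuous q t.
Hypothesis q_bound : forall t, 0 <= t <= T -> 0 <= q t <= A * t.
Hypothesis k_cont : forall t, 0 < t <= T -> continuous k t.
Hypothesis k_bound : forall t, 0 < t <= T -> 0 <= k t <= B / t.

(* [sol lam] is the Neumann series in [- lam] of [w = 1 - lam * step w].  Clipping the
   argument to [0, T] keeps the integrand, singular at the pole, continuous on the line
   and makes the bounds on the coefficients uniform. *)
Definition clip (t : R) : R := Rmax 0 (Rmin t T).
Definition flux (f : R -> R) (t : R) : R := RInt (fun s => q s * f s) 0 t.
Definition slope (f : R -> R) (t : R) : R := k (clip t) * flux f (clip t).
Definition step (f : R -> R) (t : R) : R := RInt (slope f) 0 (clip t).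

Fixpoint coef (n : nat) : R -> R :=
  match n with 0%nat => fun _ => 1 | S m => step (coef m) end.

Definition sol (lam t : R) : R := Series (fun n => (- lam) ^ n * coef n t).

Lemma clip_range (t : R) : 0 <= clip t <= T.
Proof.
unfold clip, Rmax, Rmin; repeat destruct Rle_dec; lra.
Qed.

Lemma clip_id (t : R) : 0 <= t <= T -> clip t = t.
Proof.
unfold clip, Rmax, Rmin; repeat destruct Rle_dec; lra.
Qed.

Lemma clip_lipschitz (s t : R) : Rabs (clip s - clip t) <= Rabs (s - t).
Proof.
unfold clip, Rmax, Rmin, Rabs; repeat destruct Rle_dec; repeat destruct Rcase_abs; lra.
Qed.

Lemma A_nonneg : 0 <= A.
Proof.
generalize (q_bound T ltac:(lra)); intros H.
destruct (Rle_or_lt 0 A) as [h|h]; [exact h|].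
assert (A * T < 0) by nra. lra.
Qed.

Lemma B_nonneg : 0 <= B.
Proof.
generalize (k_bound T ltac:(lra)); intros H.
destruct (Rle_or_lt 0 B) as [h|h]; [exact h|].
assert (0 < / T) by now apply Rinv_0_lt_compat.
unfold Rdiv in H. nra.
Qed.

Lemma clip_cont (t : R) : continuous clip t.
Proof.
apply (lipschitz_continuous _ 1); intros s; rewrite Rmult_1_l; apply clip_lipschitz.
Qed.

Lemma flux_derive (f : R -> R) (t : R) :
  (forall s, continuous f s) -> is_derive (flux f) t (q t * f t).
Proof.
intros Hf.
assert (Hc : forall s, continuous (fun s => q s * f s) s).
  intros s; apply (continuous_mult q f); [apply q_cont | apply Hf].
apply (is_derive_RInt (fun s => q s * f s) (flux f) 0).
  apply filter_forall; intros s. apply (RInt_correct (V := R_CompleteNormedModule)), (ex_RInt_continuous (V := R_CompleteNormedModule)).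
  intros z _; apply Hc.
apply Hc.
Qed.

Lemma weighted_cont (f : R -> R) :
  (forall s, continuous f s) -> forall s, continuous (fun s => q s * f s) s.
Proof. intros Hf s; apply (continuous_mult q f); [apply q_cont | apply Hf]. Qed.

Lemma flux_bound (f : R -> R) (C : R) (n : nat) (t : R) :
  (forall s, continuous f s) -> 0 <= C ->
  (forall s, 0 <= s <= T -> Rabs (f s) <= C * s ^ n) -> 0 <= t <= T ->
  Rabs (flux f t) <= A * C * t ^ (n + 2).
Proof.
intros Hf HC Hb Ht.
assert (HA := A_nonneg).
replace (A * C * t ^ (n + 2)) with ((t - 0) * (A * t * (C * t ^ n))) by (rewrite pow_add; ring).
apply abs_RInt_le_const; [lra| now apply ex_RInt_cont, weighted_cont |].
intros s Hs. rewrite Rabs_mult.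
assert (Hq := q_bound s ltac:(lra)).
assert (Hfs := Hb s ltac:(lra)).
assert (Hp : s ^ n <= t ^ n) by now apply pow_incr.
apply Rmult_le_compat; try apply Rabs_pos.
  rewrite Rabs_pos_eq; nra.
apply Rle_trans with (1 := Hfs). now apply Rmult_le_compat_l.
Qed.

Lemma flux_0 (f : R -> R) : flux f 0 = 0.
Proof. apply (RInt_point (V := R_CompleteNormedModule)). Qed.

Lemma slope_bound (f : R -> R) (C : R) (n : nat) (t : R) :
  (forall s, continuous f s) -> 0 <= C ->
  (forall s, 0 <= s <= T -> Rabs (f s) <= C * s ^ n) -> 0 <= t <= T ->
  Rabs (slope f t) <= A * B * C * t ^ (n + 1).
Proof.
intros Hf HC Hb Ht. assert (HA := A_nonneg). assert (HB := B_nonneg).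
unfold slope; rewrite (clip_id t Ht).
destruct (Req_dec t 0) as [->|Ht0].
  rewrite flux_0, Rmult_0_r, Rabs_R0. rewrite pow_add.
  simpl. lra.
rewrite Rabs_mult.
replace (A * B * C * t ^ (n + 1)) with ((B / t) * (A * C * t ^ (n + 2)))
  by (rewrite !pow_add; simpl; field; lra).
assert (Hk := k_bound t ltac:(lra)).
apply Rmult_le_compat; try apply Rabs_pos.
  rewrite Rabs_pos_eq; lra.
now apply flux_bound.
Qed.

Lemma cont_bounded (f : R -> R) :
  (forall s, continuous f s) ->
  exists C, 0 <= C /\ forall s, 0 <= s <= T -> Rabs (f s) <= C.
Proof.
intros Hf.
destruct (continuity_ab_maj (fun s => Rabs (f s)) 0 T) as [m [Hm _]].
  lra.
  intros c _. apply continuity_pt_filterlim.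
  apply (continuous_comp f Rabs); [apply Hf | apply continuous_Rabs].
exists (Rabs (f m)); split; [apply Rabs_pos | exact Hm].
Qed.

(** Nothing bounds [k] at 0, but the flux vanishes there, and nearby it is quadratic against a
    factor of order [1 / t]. So [slope f] is bounded by a multiple of [clip], which gives continuity
    where [clip t = 0]. *)
Lemma slope_cont (f : R -> R) (t : R) :
  (forall s, continuous f s) -> continuous (slope f) t.
Proof.
intros Hf.
destruct (Rle_or_lt t 0) as [Ht|Ht].
- destruct (cont_bounded f Hf) as [C [HC Hb]].
  assert (Hz : clip t = 0) by (unfold clip, Rmax, Rmin; repeat destruct Rle_dec; lra).
  apply (lipschitz_continuous _ (A * B * C)). intros s.
  assert (E : slope f t = 0) by (unfold slope; rewrite Hz, flux_0; ring).
  rewrite E, Rminus_0_r.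
  replace (slope f s) with (slope f (clip s))
    by (unfold slope; rewrite (clip_id (clip s)); [reflexivity | apply clip_range]).
  apply Rle_trans with (A * B * C * clip s ^ (0 + 1)).
    apply slope_bound; try assumption; [|apply clip_range].
    intros u Hu; rewrite Rmult_1_r; now apply Hb.
  simpl; rewrite Rmult_1_r.
  assert (HA := A_nonneg). assert (HB := B_nonneg).
  apply Rmult_le_compat_l; [repeat apply Rmult_le_pos; assumption|].
  generalize (clip_lipschitz s t); rewrite Hz, Rminus_0_r.
  rewrite Rabs_pos_eq; [easy | apply clip_range].
- assert (Hc : 0 < clip t <= T)
    by (unfold clip, Rmax, Rmin; repeat destruct Rle_dec; lra).
  apply (continuous_comp clip (fun s => k s * flux f s)); [apply clip_cont|].
  apply (continuous_mult k (flux f)); [now apply k_cont|].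
  apply (ex_derive_continuous (K := R_AbsRing) (V := R_NormedModule) (flux f)); eexists; now apply flux_derive.
Qed.

Lemma step_cont (f : R -> R) (t : R) :
  (forall s, continuous f s) -> continuous (step f) t.
Proof.
intros Hf. apply (continuous_comp clip (RInt (slope f) 0)); [apply clip_cont|].
apply (ex_derive_continuous (K := R_AbsRing) (V := R_NormedModule) (RInt (slope f) 0)); eexists.
apply (is_derive_RInt (slope f) (RInt (slope f) 0) 0); [|now apply slope_cont].
apply filter_forall; intros s; apply (RInt_correct (V := R_CompleteNormedModule)), ex_RInt_cont.
intros u; now apply slope_cont.
Qed.

Lemma step_derive (f : R -> R) (t : R) :
  (forall s, continuous f s) -> 0 < t < T -> is_derive (step f) t (k t * flux f t).
Proof.
intros Hf Ht.
apply (is_derive_ext_loc (RInt (slope f) 0)).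
  assert (Hd : 0 < Rmin t (T - t)) by (apply Rmin_glb_lt; lra).
  exists (mkposreal _ Hd). intros s Hs. unfold step.
  rewrite clip_id; [reflexivity|].
  change (Rabs (s - t) < Rmin t (T - t)) in Hs.
  assert (H1 := Rmin_l t (T - t)). assert (H2 := Rmin_r t (T - t)).
  apply Rabs_def2 in Hs. lra.
replace (k t * flux f t) with (slope f t) by (unfold slope; rewrite clip_id; [reflexivity|lra]).
apply (is_derive_RInt (slope f) (RInt (slope f) 0) 0); [|now apply slope_cont].
apply filter_forall; intros s; apply (RInt_correct (V := R_CompleteNormedModule)), ex_RInt_cont.
intros u; now apply slope_cont.
Qed.

Lemma step_bound (f : R -> R) (C : R) (n : nat) (t : R) :
  (forall s, continuous f s) -> 0 <= C ->
  (forall s, 0 <= s <= T -> Rabs (f s) <= C * s ^ n) -> 0 <= t <= T ->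
  Rabs (step f t) <= A * B * C * (t ^ (n + 2) / INR (n + 2)).
Proof.
intros Hf HC Hb Ht. unfold step; rewrite (clip_id t Ht).
assert (Hs : ex_RInt (slope f) 0 t) by (apply ex_RInt_cont; intros s; now apply slope_cont).
apply Rle_trans with (RInt (fun s => Rabs (slope f s)) 0 t).
  apply abs_RInt_le; [lra | exact Hs].
assert (HI : is_RInt (fun s => A * B * C * s ^ (n + 1)) 0 t (A * B * C * (t ^ (n + 2) / INR (n + 2)))).
  replace (n + 2)%nat with (n + 1 + 1)%nat by lia.
  apply (is_RInt_scal (fun s => s ^ (n + 1)) 0 t (A * B * C)), RInt_pow_0.
rewrite <- (is_RInt_unique _ _ _ _ HI).
apply RInt_le; [lra | | eexists; exact HI |].
  apply ex_RInt_cont; intros s; apply (continuous_comp (slope f) Rabs);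
    [now apply slope_cont | apply continuous_Rabs].
intros s Hs'. apply slope_bound; try assumption; lra.
Qed.

Lemma coef_cont (n : nat) (t : R) : continuous (coef n) t.
Proof.
revert t; induction n as [|n IH]; intros t; simpl.
  apply continuous_const.
now apply step_cont.
Qed.

(** One step gains [t ^ 2]: the flux gains two powers, [k] loses one and the outer integral gains
    one. That integral also divides by [2 * n + 2 >= n + 1], which builds up the factorial. *)
Lemma coef_bound_pow (n : nat) (t : R) :
  0 <= t <= T -> Rabs (coef n t) <= (A * B) ^ n / INR (fact n) * t ^ (2 * n).
Proof.
assert (HA := A_nonneg). assert (HB := B_nonneg).
assert (HAB : 0 <= A * B) by now apply Rmult_le_pos.
revert t; induction n as [|n IH]; intros t Ht.
  simpl; rewrite Rabs_R1; lra.
assert (Hn : 0 < INR (fact n)) by apply INR_fact_lt_0.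
assert (HSn : 0 < INR (S n)) by (apply lt_0_INR; lia).
assert (HC : 0 <= (A * B) ^ n / INR (fact n)).
  apply Rmult_le_pos; [now apply pow_le | left; now apply Rinv_0_lt_compat].
simpl coef.
eapply Rle_trans; [apply step_bound; [apply coef_cont | exact HC | exact IH | exact Ht]|].
replace (2 * S n)%nat with (2 * n + 2)%nat by lia.
replace (fact (S n)) with (S n * fact n)%nat by reflexivity.
rewrite mult_INR. simpl ((A * B) ^ (S n)).
assert (Hi : INR (S n) <= INR (2 * n + 2)) by (apply le_INR; lia).
assert (Htp : 0 <= t ^ (2 * n + 2)) by (apply pow_le; lra).
replace (A * B * (A * B) ^ n / (INR (S n) * INR (fact n)) * t ^ (2 * n + 2))
  with (A * B * ((A * B) ^ n / INR (fact n)) * (t ^ (2 * n + 2) / INR (S n)))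
  by (field; lra).
apply Rmult_le_compat_l; [now apply Rmult_le_pos|].
apply Rmult_le_compat_l; [exact Htp|].
now apply Rinv_le_contravar.
Qed.

Lemma coef_clip (n : nat) (t : R) : coef n (clip t) = coef n t.
Proof.
destruct n; simpl; [reflexivity|]. unfold step.
now rewrite (clip_id (clip t)) by apply clip_range.
Qed.

Definition growth : R := A * B * T ^ 2.

Lemma growth_nonneg : 0 <= growth.
Proof.
unfold growth. apply Rmult_le_pos; [|apply pow_le; lra].
apply Rmult_le_pos; [apply A_nonneg | apply B_nonneg].
Qed.

Lemma coef_bound (n : nat) (t : R) : Rabs (coef n t) <= growth ^ n / INR (fact n).
Proof.
rewrite <- coef_clip. assert (Hc := clip_range t).
apply Rle_trans with (1 := coef_bound_pow n _ Hc).
unfold growth. rewrite (Rpow_mult_distr (A * B) (T ^ 2)), <- pow_mult.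
assert (HA := A_nonneg). assert (HB := B_nonneg).
assert (Hn : 0 < INR (fact n)) by apply INR_fact_lt_0.
unfold Rdiv. rewrite Rmult_assoc, (Rmult_assoc ((A * B) ^ n)).
apply Rmult_le_compat_l; [apply pow_le; now apply Rmult_le_pos|].
rewrite (Rmult_comm (T ^ (2 * n))).
apply Rmult_le_compat_l; [left; now apply Rinv_0_lt_compat|].
now apply pow_incr.
Qed.

Lemma coef_0 (n : nat) : coef (S n) 0 = 0.
Proof. simpl. unfold step. rewrite clip_id by lra. apply (RInt_point (V := R_CompleteNormedModule)). Qed.

Lemma term_bound (lam : R) (n : nat) (t : R) :
  Rabs ((- lam) ^ n * coef n t) <= (Rabs lam * growth) ^ n / INR (fact n).
Proof.
rewrite Rabs_mult, <- RPow_abs, Rabs_Ropp, Rpow_mult_distr.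
unfold Rdiv; rewrite Rmult_assoc.
apply Rmult_le_compat_l; [apply pow_le, Rabs_pos | apply coef_bound].
Qed.

Lemma ex_series_sol (lam t : R) : ex_series (fun n => (- lam) ^ n * coef n t).
Proof.
apply (ex_series_le (K := R_AbsRing) (V := R_CompleteNormedModule) _
  (fun n => (Rabs lam * growth) ^ n / INR (fact n))).
  intros n; apply term_bound.
apply ex_series_exp.
Qed.

(** The constant is the same for all [t], so that positivity on the whole of [0, T] is an open
    condition on the parameter; shooting rests on this. *)
Lemma sol_lipschitz_param (L : R) : 0 <= L ->
  exists C, forall lam mu t, Rabs lam <= L -> Rabs mu <= L ->
    Rabs (sol lam t - sol mu t) <= C * Rabs (lam - mu).
Proof.
intros HL. assert (HG := growth_nonneg).
exists (Series (fun n => growth * (INR n * (L * growth) ^ pred n / INR (fact n)))).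
intros lam mu t Hlam Hmu.
apply Series_minus_bound; try apply ex_series_sol.
  apply (ex_series_scal_l (V := R_NormedModule) growth), ex_series_exp_shift.
intros n. rewrite <- Rmult_minus_distr_r, Rabs_mult.
assert (H1 : Rabs ((- lam) ^ n - (- mu) ^ n) <= INR n * L ^ pred n * Rabs (lam - mu)).
  replace (Rabs (lam - mu)) with (Rabs (- lam - - mu))
    by (rewrite <- (Rabs_Ropp (lam - mu)); f_equal; ring).
  apply pow_minus_bound; rewrite Rabs_Ropp; assumption.
apply Rle_trans with ((INR n * L ^ pred n * Rabs (lam - mu)) * (growth ^ n / INR (fact n))).
  apply Rmult_le_compat; try apply Rabs_pos; [exact H1 | apply coef_bound].
right. rewrite Rpow_mult_distr.
destruct n as [|n]; [simpl; field|]. simpl pred. simpl (growth ^ (S n)).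
field. apply INR_fact_neq_0.
Qed.

Lemma coef_lipschitz (n : nat) (s t : R) :
  Rabs (coef (S n) s - coef (S n) t) <=
  A * B * T * (growth ^ n / INR (fact n)) * Rabs (s - t).
Proof.
assert (HA := A_nonneg). assert (HB := B_nonneg). assert (HG := growth_nonneg).
assert (HC : 0 <= growth ^ n / INR (fact n)).
  apply Rmult_le_pos; [now apply pow_le | left; apply Rinv_0_lt_compat, INR_fact_lt_0].
assert (Hex : forall a b, ex_RInt (slope (coef n)) a b).
  intros a b; apply ex_RInt_cont; intros u; apply slope_cont, coef_cont.
assert (Hle : forall s t, s <= t ->
  Rabs (coef (S n) s - coef (S n) t) <= A * B * T * (growth ^ n / INR (fact n)) * Rabs (s - t)).
  clear s t; intros s t Hst.
  apply Rle_trans with (A * B * T * (growth ^ n / INR (fact n)) * Rabs (clip s - clip t)).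
  2: { apply Rmult_le_compat_l; [|apply clip_lipschitz].
       apply Rmult_le_pos; [|exact HC].
       apply Rmult_le_pos; [now apply Rmult_le_pos | lra]. }
  assert (Hct : clip s <= clip t)
    by (unfold clip, Rmax, Rmin; repeat destruct Rle_dec; lra).
  rewrite Rabs_minus_sym, (Rabs_minus_sym (clip s)), (Rabs_pos_eq (clip t - clip s)) by lra.
  rewrite (Rmult_comm _ (clip t - clip s)).
  assert (E : coef (S n) t - coef (S n) s = RInt (slope (coef n)) (clip s) (clip t)).
    simpl; unfold step. apply (Rplus_eq_reg_l (RInt (slope (coef n)) 0 (clip s))).
    rewrite (RInt_split _ 0 (clip s) (clip t)); [ring|].
    intros u; apply slope_cont, coef_cont.
  rewrite E.
  apply abs_RInt_le_const; [exact Hct | apply Hex |].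
  intros u Hu. assert (Hs := clip_range s). assert (Ht := clip_range t).
  eapply Rle_trans.
    apply (slope_bound (coef n) (growth ^ n / INR (fact n)) 0); [apply coef_cont | exact HC | | lra].
    intros v _; rewrite Rmult_1_r; apply coef_bound.
  simpl; rewrite Rmult_1_r.
  replace (A * B * T * (growth ^ n / INR (fact n))) with (A * B * (growth ^ n / INR (fact n)) * T) by ring.
  apply Rmult_le_compat_l; [|lra].
  apply Rmult_le_pos; [now apply Rmult_le_pos | exact HC].
destruct (Rle_or_lt s t) as [H|H]; [now apply Hle|].
rewrite Rabs_minus_sym, (Rabs_minus_sym s). apply Hle; lra.
Qed.

Lemma sol_cont (lam t : R) : continuous (sol lam) t.
Proof.
apply (lipschitz_continuous _
  (Series (fun n => Rabs lam * (A * B * T) * (INR n * (Rabs lam * growth) ^ pred n / INR (fact n))))).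
intros s. apply Series_minus_bound; try apply ex_series_sol.
  apply (ex_series_scal_l (V := R_NormedModule) (Rabs lam * (A * B * T))), ex_series_exp_shift.
intros n. rewrite <- Rmult_minus_distr_l, Rabs_mult, <- RPow_abs, Rabs_Ropp.
destruct n as [|n].
  simpl. rewrite Rminus_diag, Rabs_R0; right; field.
apply Rle_trans with (Rabs lam ^ S n * (A * B * T * (growth ^ n / INR (fact n)) * Rabs (s - t))).
  apply Rmult_le_compat_l; [apply pow_le, Rabs_pos | apply coef_lipschitz].
right. replace (fact (S n)) with (S n * fact n)%nat by reflexivity.
rewrite mult_INR, Rpow_mult_distr. simpl pred. simpl (Rabs lam ^ S n). field.
split; [apply INR_fact_neq_0 | apply not_0_INR; lia].
Qed.

Lemma sol_0 (lam : R) : sol lam 0 = 1.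
Proof.
unfold sol. rewrite Series_incr_1 by apply ex_series_sol.
rewrite (Series_ext _ (fun _ => 0 * 0)).
  rewrite Series_scal_l; simpl; ring.
intros n. rewrite coef_0; ring.
Qed.

Lemma flux_lin (f g : R -> R) (c t : R) :
  (forall s, continuous f s) -> (forall s, continuous g s) ->
  flux (fun s => f s + c * g s) t = flux f t + c * flux g t.
Proof.
intros Hf Hg. unfold flux.
rewrite <- RInt_lin by now apply weighted_cont.
apply RInt_ext_all; intros s; simpl; ring.
Qed.

Lemma step_lin (f g : R -> R) (c t : R) :
  (forall s, continuous f s) -> (forall s, continuous g s) ->
  step (fun s => f s + c * g s) t = step f t + c * step g t.
Proof.
intros Hf Hg. unfold step.
rewrite <- RInt_lin by (intros s; now apply slope_cont).
apply RInt_ext_all; intros s; unfold slope. rewrite flux_lin by assumption. ring.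
Qed.

Definition psum (lam : R) (N : nat) (t : R) : R :=
  sum_n (fun n => (- lam) ^ n * coef n t) N.

Lemma psum_cont (lam : R) (N : nat) (t : R) : continuous (psum lam N) t.
Proof.
induction N as [|N IH].
  apply (continuous_ext (fun s => (- lam) ^ 0 * coef 0 s)).
    intros s; unfold psum; now rewrite sum_O.
  apply (continuous_scal_r ((- lam) ^ 0) (coef 0)), coef_cont.
apply (continuous_ext (fun s => psum lam N s + (- lam) ^ S N * coef (S N) s)).
  intros s; unfold psum; now rewrite sum_Sn.
apply (continuous_plus (psum lam N)); [exact IH|].
apply (continuous_scal_r ((- lam) ^ S N) (coef (S N))), coef_cont.
Qed.

Lemma step_ext (f g : R -> R) (t : R) : (forall s, f s = g s) -> step f t = step g t.
Proof.
intros H. unfold step, slope, flux. apply RInt_ext; intros s _.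
f_equal. apply RInt_ext_all; intros u; simpl; now rewrite H.
Qed.

Lemma psum_step (lam : R) (N : nat) (t : R) :
  psum lam (S N) t = 1 - lam * step (psum lam N) t.
Proof.
induction N as [|N IH].
  unfold psum at 1; rewrite sum_Sn, sum_O. unfold plus; simpl.
  rewrite (step_ext (psum lam 0) (fun _ => 1)); [ring|].
  intros s; unfold psum; rewrite sum_O; simpl; ring.
unfold psum at 1; rewrite sum_Sn. fold (psum lam (S N) t). rewrite IH.
rewrite (step_ext (psum lam (S N)) (fun s => psum lam N s + (- lam) ^ S N * coef (S N) s)).
  rewrite step_lin; [|intros s; apply psum_cont|intros s; apply coef_cont].
  unfold plus; simpl; ring.
intros s; unfold psum; now rewrite sum_Sn.
Qed.

Lemma psum_tail (lam : R) :
  is_lim_seq (fun N => Series (fun n => (Rabs lam * growth) ^ (S N + n) / INR (fact (S N + n)))) 0.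
Proof.
set (a := fun n => (Rabs lam * growth) ^ n / INR (fact n)).
assert (Ha : ex_series a) by apply ex_series_exp.
apply is_lim_seq_ext with (fun N => Series a - sum_n a N).
  intros N. rewrite (Series_incr_n a (S N)); [|lia|exact Ha].
  simpl pred. rewrite sum_n_Reals. unfold a. simpl plus. ring.
replace (Finite 0) with (Finite (Series a - Series a)) by (f_equal; ring).
apply (is_lim_seq_minus' (fun _ => Series a) (sum_n a)); [apply is_lim_seq_const|].
exact (Series_correct a Ha).
Qed.

Lemma psum_bound (lam : R) (N : nat) (t : R) :
  Rabs (sol lam t - psum lam N t) <=
  Series (fun n => (Rabs lam * growth) ^ (S N + n) / INR (fact (S N + n))).
Proof.
unfold sol. rewrite (Series_incr_n _ (S N)); [|lia|apply ex_series_sol].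
simpl pred. unfold psum. rewrite sum_n_Reals.
set (s := sum_f_R0 _ N).
match goal with |- Rabs (s + ?x - s) <= _ => replace (s + x - s) with x by ring end.
assert (Hex : ex_series (fun n => (Rabs lam * growth) ^ (S N + n) / INR (fact (S N + n))))
  by exact (proj1 (ex_series_incr_n (fun n => (Rabs lam * growth) ^ n / INR (fact n)) (S N)) (ex_series_exp _)).
eapply Rle_trans; [apply Series_Rabs|].
  apply (ex_series_le (K := R_AbsRing) (V := R_CompleteNormedModule) _ _) with (2 := Hex).
  intros n; unfold norm; simpl norm; unfold abs; simpl abs. rewrite Rabs_Rabsolu; apply (term_bound lam (S N + n)).
apply Series_le; [|exact Hex].
intros n; split; [apply Rabs_pos | apply (term_bound lam (S N + n))].
Qed.

(** The limit of [psum_step]: [step] is Lipschitz for the sup norm with constant at most [growth],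
    and the partial sums converge uniformly, with a tail of the exponential series as error [e]. *)
Lemma sol_step (lam t : R) : sol lam t = 1 - lam * step (sol lam) t.
Proof.
set (e := fun N => Series (fun n => (Rabs lam * growth) ^ (S N + n) / INR (fact (S N + n)))).
assert (He : is_lim_seq e 0) by apply psum_tail.
assert (He0 : forall N, 0 <= e N).
  intros N; apply Rle_trans with (2 := psum_bound lam N t); apply Rabs_pos.
assert (HA := A_nonneg). assert (HB := B_nonneg). assert (HG := growth_nonneg).
assert (Hstep : forall N, Rabs (step (psum lam N) t - step (sol lam) t) <= growth * e N).
  intros N.
  replace (step (psum lam N) t - step (sol lam) t)
    with (step (fun s => psum lam N s + (- 1) * sol lam s) t).
  2: { rewrite step_lin; [ring | intros s; apply psum_cont | intros s; apply sol_cont]. }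
  assert (Hd : forall s, continuous (fun s => psum lam N s + (- 1) * sol lam s) s).
    intros s. apply (continuous_plus (psum lam N)); [apply psum_cont|].
    apply (continuous_scal_r (- 1) (sol lam)), sol_cont.
  assert (Hc := clip_range t).
  replace (step (fun s => psum lam N s + (- 1) * sol lam s) t)
    with (step (fun s => psum lam N s + (- 1) * sol lam s) (clip t))
    by (unfold step; now rewrite (clip_id (clip t) Hc)).
  eapply Rle_trans.
    apply (step_bound _ (e N) 0); [exact Hd | apply He0 | | exact Hc].
    intros s _. replace (psum lam N s + (- 1) * sol lam s) with (- (sol lam s - psum lam N s)) by ring.
    rewrite Rabs_Ropp, Rmult_1_r. apply psum_bound.
  assert (Hpow : clip t ^ 2 <= T ^ 2) by now apply pow_incr.
  change (0 + 2)%nat with 2%nat. change (INR 2) with 2. unfold growth.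
  replace (A * B * T ^ 2 * e N) with (A * B * e N * T ^ 2) by ring.
  apply Rmult_le_compat_l; [repeat apply Rmult_le_pos; auto|].
  assert (0 <= clip t ^ 2) by (apply pow_le; lra). lra.
assert (Hlim : is_lim_seq (fun N => psum lam (S N) t) (1 - lam * step (sol lam) t)).
  apply is_lim_seq_ext with (fun N => 1 - lam * step (psum lam N) t).
    intros N; now rewrite psum_step.
  apply (is_lim_seq_minus' (fun _ => 1)); [apply is_lim_seq_const|].
  apply (is_lim_seq_scal_l (fun N => step (psum lam N) t) lam (Finite (step (sol lam) t))).
  apply is_lim_seq_ext with (fun N => (step (psum lam N) t - step (sol lam) t) + step (sol lam) t).
    intros N; ring.
  replace (Finite (step (sol lam) t)) with (Finite (0 + step (sol lam) t)) by (f_equal; ring).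
  apply is_lim_seq_plus'; [|apply is_lim_seq_const].
  apply is_lim_seq_abs_0.
  apply is_lim_seq_le_le with (fun _ => 0) (fun N => growth * e N).
    intros N; split; [apply Rabs_pos | apply Hstep].
    apply is_lim_seq_const.
  replace (Finite 0) with (Rbar_mult growth 0) by (simpl; f_equal; ring).
  now apply is_lim_seq_scal_l.
apply is_lim_seq_incr_1 in Hlim.
assert (Hlim' : is_lim_seq (fun N => psum lam N t) (sol lam t)).
  exact (Series_correct _ (ex_series_sol lam t)).
apply is_lim_seq_unique in Hlim. apply is_lim_seq_unique in Hlim'.
assert (E := eq_trans (eq_sym Hlim') Hlim). now injection E.
Qed.

Definition momentum (lam t : R) : R := lam * flux (sol lam) t.

Lemma momentum_0 (lam : R) : momentum lam 0 = 0.
Proof. unfold momentum; rewrite flux_0; ring. Qed.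

Lemma momentum_derive (lam t : R) : is_derive (momentum lam) t (lam * (q t * sol lam t)).
Proof.
apply (is_derive_scal (flux (sol lam)) t lam), flux_derive. intros s; apply sol_cont.
Qed.

Lemma sol_derive (lam t : R) : 0 < t < T -> is_derive (sol lam) t (- (k t * momentum lam t)).
Proof.
intros Ht.
apply (is_derive_ext (fun t => 1 - lam * step (sol lam) t)).
  intros s; now rewrite <- sol_step.
replace (- (k t * momentum lam t)) with (minus zero (lam * (k t * flux (sol lam) t)))
  by (unfold momentum, minus, plus, opp, zero; simpl; ring).
apply (is_derive_minus (fun _ => 1)); [apply is_derive_Reals, derivable_pt_lim_const|].
apply (is_derive_scal (step (sol lam)) t lam), step_derive; [|exact Ht].
intros s; apply sol_cont.
Qed.

Lemma coef_nonneg (n : nat) (t : R) : 0 <= t <= T -> 0 <= coef n t.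
Proof.
revert t; induction n as [|n IH]; intros t Ht; simpl; [lra|].
unfold step; rewrite clip_id by lra.
apply RInt_ge_0; [lra | apply ex_RInt_cont; intros s; apply slope_cont, coef_cont |].
intros s Hs. unfold slope; rewrite clip_id by lra.
apply Rmult_le_pos; [apply k_bound; lra|].
apply RInt_ge_0; [lra | now apply ex_RInt_cont, weighted_cont; intros u; apply coef_cont |].
intros u Hu. apply Rmult_le_pos; [apply q_bound; lra | apply IH; lra].
Qed.

(** All terms of the Neumann series are nonnegative and the first is 1. A solution with a zero thus
    forces a positive parameter. *)
Lemma sol_nonpos_param (lam t : R) : lam <= 0 -> 0 <= t <= T -> 1 <= sol lam t.
Proof.
intros Hlam Ht. unfold sol. rewrite Series_incr_1 by apply ex_series_sol.
assert (H : 0 <= Series (fun n => (- lam) ^ S n * coef (S n) t)).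
  replace 0 with (Series (fun _ => 0 * 0)) by (rewrite Series_scal_l; ring).
  apply Series_le; [|exact (proj1 (ex_series_incr_n (fun n => (- lam) ^ n * coef n t) 1) (ex_series_sol lam t))].
  intros n; split; [lra|]. rewrite Rmult_0_l.
  apply Rmult_le_pos; [apply pow_le; lra | now apply coef_nonneg].
simpl coef in *. simpl pow at 1. lra.
Qed.

(** [f] may have zeros; strictness comes from an interval next to 0, where [f] exceeds 1/2 because
    [f 0 = 1]. *)
Lemma flux_pos (f : R -> R) (t : R) :
  (forall s, continuous f s) -> (forall s, 0 < s <= T -> 0 < q s) -> f 0 = 1 -> 0 < t <= T ->
  (forall s, 0 <= s <= t -> 0 <= f s) -> 0 < flux f t.
Proof.
intros Hf Hq Hf0 Ht Hpos.
destruct (proj1 (continuous_eps f 0) (Hf 0) (1 / 2)) as [d [Hd H]]; [lra|].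
set (m := Rmin t (d / 2)).
assert (Hm : 0 < m) by (apply Rmin_glb_lt; lra).
assert (Hmt : m <= t) by apply Rmin_l.
assert (Hmd : m <= d / 2) by apply Rmin_r.
assert (Hw := weighted_cont f Hf).
assert (E : flux f t = flux f m + RInt (fun s => q s * f s) m t).
  symmetry; now apply RInt_split.
assert (H1 : 0 < flux f m).
  apply RInt_gt_0; [exact Hm | | intros s _; apply Hw].
  intros s Hs. apply Rmult_lt_0_compat; [apply Hq; lra|].
  assert (Hs' := H s). rewrite Hf0, Rminus_0_r, (Rabs_pos_eq s) in Hs' by lra.
  specialize (Hs' ltac:(lra)). apply Rabs_def2 in Hs'. lra.
assert (H2 : 0 <= RInt (fun s => q s * f s) m t).
  apply RInt_ge_0; [exact Hmt | now apply ex_RInt_cont |].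
  intros s Hs. apply Rmult_le_pos; [apply q_bound; lra | apply Hpos; lra].
lra.
Qed.

Lemma flux_nonneg (f : R -> R) (t : R) :
  (forall s, continuous f s) -> 0 <= t <= T -> (forall s, 0 <= s <= t -> 0 <= f s) -> 0 <= flux f t.
Proof.
intros Hf Ht Hpos. apply RInt_ge_0; [lra | now apply ex_RInt_cont, weighted_cont |].
intros s Hs. apply Rmult_le_pos; [apply q_bound; lra | apply Hpos; lra].
Qed.

End RadialEquation.

(** Here [r] is the distance to the axis and [l] the speed, with derivatives [dr] and [dl]. The
    condition at 0 says that the profile leaves the axis orthogonally, and [prof_dr_le] that the
    distance to the axis grows no faster than arc length; the latter is what the comparison with the
    flat disc exploits. *)
Record pole_profile (T : R) (r dr l dl : R -> R) : Prop := {
  prof_T : 0 < T;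
  prof_r_0 : r 0 = 0;
  prof_l_0 : l 0 = dr 0;
  prof_r_cont : forall t, continuous r t;
  prof_l_cont : forall t, continuous l t;
  prof_r_derive : forall t, 0 <= t <= T -> is_derive r t (dr t);
  prof_l_derive : forall t, 0 <= t <= T -> is_derive l t (dl t);
  prof_dr_cont : forall t, 0 <= t <= T -> continuous dr t;
  prof_dl_cont : forall t, 0 <= t <= T -> continuous dl t;
  prof_l_pos : forall t, 0 <= t <= T -> 0 < l t;
  prof_dr_le : forall t, 0 <= t <= T -> dr t <= l t;
  prof_r_pos : forall t, 0 < t <= T -> 0 < r t
}.

(** What later arguments use of the Neumann series, for the surface and for the flat disc alike. Up
    to a factor [2 * PI], [V] is the flux of [- grad w] through a parallel circle. Being an integral
    it has a derivative everywhere, whereas [w] is clipped and has one only inside the interval. *)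
Record radial_family (T : R) (r l : R -> R) (w V : R -> R -> R) : Prop := {
  fam_w_0 : forall lam, w lam 0 = 1;
  fam_w_cont : forall lam t, continuous (w lam) t;
  fam_V_0 : forall lam, V lam 0 = 0;
  fam_V_derive : forall lam t, is_derive (V lam) t (lam * (r t * l t * w lam t));
  fam_w_derive : forall lam t, 0 < t < T -> is_derive (w lam) t (- (l t / r t * V lam t));
  fam_lipschitz : forall L, 0 <= L -> exists C, forall lam mu t,
    Rabs lam <= L -> Rabs mu <= L -> Rabs (w lam t - w mu t) <= C * Rabs (lam - mu);
  fam_nonpos : forall lam t, lam <= 0 -> 0 <= t <= T -> 1 <= w lam t;
  fam_V_nonneg : forall lam t, 0 <= lam -> 0 <= t <= T ->
    (forall s, 0 <= s <= t -> 0 <= w lam s) -> 0 <= V lam t;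
  fam_V_pos : forall lam t, 0 < lam -> 0 < t <= T ->
    (forall s, 0 <= s <= t -> 0 <= w lam s) -> 0 < V lam t
}.

Lemma derive_linear_bounds (T d : R) (r : R -> R) :
  0 < T -> r 0 = 0 -> (forall t, continuous r t) -> is_derive r 0 d -> 0 < d ->
  (forall t, 0 < t <= T -> 0 < r t) ->
  exists a b, 0 < a /\ 0 < b /\ forall t, 0 <= t <= T -> a * t <= r t <= b * t.
Proof.
intros HT H0 Hc Hd Hd0 Hpos.
apply is_derive_Reals in Hd.
destruct (Hd (d / 2)) as [del Hdel]; [lra|].
assert (Hdp := cond_pos del).
assert (Hnear : forall t, 0 <= t < del -> d / 2 * t <= r t <= 3 * d / 2 * t).
  intros t Ht. destruct (Req_dec t 0) as [->|Ht0]; [rewrite H0; lra|].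
  assert (H1 := Hdel t Ht0). rewrite Rplus_0_l, H0, Rminus_0_r in H1.
  rewrite Rabs_pos_eq in H1 by lra. specialize (H1 ltac:(lra)).
  apply Rabs_def2 in H1. destruct H1 as [H1 H2].
  assert (E : r t = r t / t * t) by (field; lra).
  rewrite E; split; apply Rmult_le_compat_r; lra.
destruct (Rle_or_lt T (del / 2)) as [HTd|HTd].
  exists (d / 2), (3 * d / 2); split; [lra|split; [lra|]].
  intros t Ht; apply Hnear; lra.
assert (Hc' : forall c, del / 2 <= c <= T -> continuity_pt r c)
  by (intros c _; apply continuity_pt_filterlim, Hc).
destruct (continuity_ab_maj r (del / 2) T ltac:(lra) Hc') as [M [HM HM']].
destruct (continuity_ab_min r (del / 2) T ltac:(lra) Hc') as [m [Hm Hm']].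
assert (Hrm : 0 < r m) by (apply Hpos; lra).
assert (HrM : 0 < r M) by (apply Hpos; lra).
assert (P1 : 0 < r m / T) by now apply Rdiv_lt_0_compat.
assert (P2 : 0 < 2 * r M / del) by (apply Rdiv_lt_0_compat; lra).
(* The first entries serve near 0, by differentiability. On [del / 2, T] the extrema [r m] and [r M]
   are compared with linear functions by means of [t <= T] and [t >= del / 2]. *)
exists (Rmin (d / 2) (r m / T)), (Rmax (3 * d / 2) (2 * r M / del)).
split; [apply Rmin_glb_lt; lra|]. split; [apply Rlt_le_trans with (2 := Rmax_l _ _); lra|].
assert (Q1 := Rmin_l (d / 2) (r m / T)). assert (Q2 := Rmin_r (d / 2) (r m / T)).
assert (Q3 := Rmax_l (3 * d / 2) (2 * r M / del)). assert (Q4 := Rmax_r (3 * d / 2) (2 * r M / del)).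
set (x := Rmin _ _) in *. set (y := Rmax _ _) in *.
intros t Ht. destruct (Rlt_or_le t (del / 2)) as [Htd|Htd].
  destruct (Hnear t ltac:(lra)) as [N1 N2].
  split; [apply Rle_trans with (2 := N1) | apply Rle_trans with (1 := N2)];
    apply Rmult_le_compat_r; lra.
assert (N1 := HM t ltac:(lra)). assert (N2 := Hm t ltac:(lra)). split.
  apply Rle_trans with (r m / T * t); [apply Rmult_le_compat_r; lra|].
  apply Rle_trans with (r m / T * T); [apply Rmult_le_compat_l; lra|].
  unfold Rdiv; rewrite Rmult_assoc, Rinv_l; lra.
apply Rle_trans with (2 * r M / del * t); [|apply Rmult_le_compat_r; lra].
apply Rle_trans with (2 * r M / del * (del / 2)); [|apply Rmult_le_compat_l; lra].
replace (2 * r M / del * (del / 2)) with (r M) by (field; lra). exact N1.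
Qed.

Lemma radial_family_exists (T : R) (r dr l dl : R -> R) :
  pole_profile T r dr l dl -> exists w V, radial_family T r l w V.
Proof.
intros H.
assert (HT := prof_T _ _ _ _ _ H).
assert (Hd0 : 0 < dr 0) by (rewrite <- (prof_l_0 _ _ _ _ _ H); apply (prof_l_pos _ _ _ _ _ H); lra).
destruct (derive_linear_bounds T (dr 0) r HT (prof_r_0 _ _ _ _ _ H) (prof_r_cont _ _ _ _ _ H))
  as [a [b [Ha [Hb Hab]]]].
  apply (prof_r_derive _ _ _ _ _ H); lra.
  exact Hd0.
  apply (prof_r_pos _ _ _ _ _ H).
destruct (continuity_ab_maj l 0 T ltac:(lra)) as [M [HM HM']].
  intros c _; apply continuity_pt_filterlim, (prof_l_cont _ _ _ _ _ H).
assert (HlM := prof_l_pos _ _ _ _ _ H M HM').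
set (k := fun t => l t / r t). set (q := fun t => r t * l t).
assert (q_cont : forall t, continuous q t).
  intros t; apply (continuous_mult r l); [apply (prof_r_cont _ _ _ _ _ H) | apply (prof_l_cont _ _ _ _ _ H)].
assert (q_bound : forall t, 0 <= t <= T -> 0 <= q t <= (b * l M) * t).
  intros t Ht. assert (H1 := Hab t Ht). assert (H2 := prof_l_pos _ _ _ _ _ H t Ht).
  assert (H3 := HM t Ht). assert (H4 : 0 <= a * t) by (apply Rmult_le_pos; lra). unfold q. split; [apply Rmult_le_pos; lra|].
  replace (b * l M * t) with (b * t * l M) by ring. apply Rmult_le_compat; lra.
assert (k_cont : forall t, 0 < t <= T -> continuous k t).
  intros t Ht. apply (continuous_mult l (fun t => / r t)); [apply (prof_l_cont _ _ _ _ _ H)|].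
  apply continuous_Rinv_comp; [apply (prof_r_cont _ _ _ _ _ H)|].
  assert (H1 := prof_r_pos _ _ _ _ _ H t Ht). lra.
assert (k_bound : forall t, 0 < t <= T -> 0 <= k t <= (l M / a) / t).
  intros t Ht. assert (H1 := Hab t ltac:(lra)). assert (H2 := prof_l_pos _ _ _ _ _ H t ltac:(lra)).
  assert (H3 := HM t ltac:(lra)). assert (H4 := prof_r_pos _ _ _ _ _ H t Ht).
  assert (Hat : 0 < a * t) by nra. unfold k; split.
    left; now apply Rdiv_lt_0_compat.
  replace (l M / a / t) with (l M / (a * t)) by (field; lra).
  apply Rmult_le_compat; [lra | left; now apply Rinv_0_lt_compat | exact H3 |].
  now apply Rinv_le_contravar.
assert (q_pos : forall t, 0 < t <= T -> 0 < q t).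
  intros t Ht; apply Rmult_lt_0_compat; [now apply (prof_r_pos _ _ _ _ _ H) | apply (prof_l_pos _ _ _ _ _ H); lra].
exists (sol T k q), (momentum T k q). split.
- intros lam. eapply sol_0; eassumption.
- intros lam t. eapply sol_cont; eassumption.
- intros lam. apply momentum_0.
- intros lam t. exact (momentum_derive T _ _ k q HT q_cont q_bound k_cont k_bound lam t).
- intros lam t Ht. exact (sol_derive T _ _ k q HT q_cont q_bound k_cont k_bound lam t Ht).
- intros L HL. eapply sol_lipschitz_param; eassumption.
- intros lam t Hlam Ht. eapply sol_nonpos_param; eassumption.
- intros lam t Hlam Ht Hp. apply Rmult_le_pos; [exact Hlam|].
  eapply flux_nonneg; try eassumption. intros s; eapply sol_cont; eassumption.
- intros lam t Hlam Ht Hp. apply Rmult_lt_0_compat; [exact Hlam|].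
  eapply flux_pos; try eassumption; [intros s; eapply sol_cont; eassumption | eapply sol_0; eassumption].
Qed.

(* At the largest parameter up to which all solutions are positive, the solution
   is nonnegative with a zero; being nonincreasing, it vanishes at [T]. *)
Lemma shooting (T : R) (r l : R -> R) (w V : R -> R -> R) (mu : R) :
  0 < T -> (forall t, 0 < t < T -> 0 <= l t / r t) -> radial_family T r l w V ->
  (exists t, 0 <= t <= T /\ w mu t <= 0) ->
  exists lam, lam <= mu /\ w lam T = 0.
Proof.
intros HT Hk H [t0 [Ht0 Hw0]].
assert (Hmu : 0 < mu).
  destruct (Rle_or_lt mu 0) as [h|h]; [|exact h].
  assert (H1 := fam_nonpos _ _ _ _ _ H mu t0 h Ht0). lra.
destruct (fam_lipschitz _ _ _ _ _ H mu ltac:(lra)) as [C HC].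
assert (HC' : forall x y t, 0 <= x <= mu -> 0 <= y <= mu -> Rabs (w x t - w y t) <= Rabs C * Rabs (x - y)).
  intros x y t Hx Hy. apply Rle_trans with (C * Rabs (x - y)).
    apply HC; rewrite Rabs_pos_eq; lra.
  apply Rmult_le_compat_r; [apply Rabs_pos | apply Rle_abs].
clear HC. assert (HCp := Rabs_pos C). set (K := Rabs C) in *.
set (E := fun x => 0 <= x <= mu /\ forall y t, 0 <= y <= x -> 0 <= t <= T -> 0 < w y t).
assert (E0 : E 0).
  split; [lra|]. intros y t Hy Ht. replace y with 0 by lra.
  assert (H1 := fam_nonpos _ _ _ _ _ H 0 t ltac:(lra) Ht). lra.
destruct (completeness E) as [c [Hc1 Hc2]].
  exists mu; intros x [Hx _]; lra.
  now exists 0.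
assert (H0c : 0 <= c) by now apply Hc1.
assert (Hcb : c <= mu) by (apply Hc2; intros x [Hx _]; lra).
assert (Hbelow : forall x t, 0 <= x < c -> 0 <= t <= T -> 0 < w x t).
  intros x t Hx Ht. destruct (classic (exists y, E y /\ x < y)) as [[y [[Hy1 Hy2] Hxy]]|Hn].
    apply Hy2; lra.
  assert (c <= x); [|lra]. apply Hc2; intros y Hy. destruct (Rle_or_lt y x); [easy|].
  exfalso; apply Hn; now exists y.
assert (Hnn : forall t, 0 <= t <= T -> 0 <= w c t).
  intros t Ht. destruct (Rle_or_lt 0 (w c t)) as [h|h]; [exact h|exfalso].
  destruct (Req_dec c 0) as [Ec|Hc0].
    rewrite Ec in h. assert (H1 := fam_nonpos _ _ _ _ _ H 0 t ltac:(lra) Ht). lra.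
  (* By the Lipschitz bound, a parameter within [d] below [c] would still give a value at most 0.
     Such a parameter exists within the range as [c] is not 0. *)
  set (d := - w c t / (K + 1)).
  assert (Hd : 0 < d) by (apply Rdiv_lt_0_compat; lra).
  set (x := Rmax 0 (c - d)).
  assert (Hx : 0 <= x < c /\ c - x <= d) by (unfold x, Rmax; destruct Rle_dec; lra).
  assert (H1 := Hbelow x t (proj1 Hx) Ht).
  assert (H2 := HC' x c t ltac:(lra) ltac:(lra)).
  rewrite (Rabs_left (x - c)) in H2 by lra.
  assert (Hkd : K * - (x - c) <= - w c t).
    apply Rle_trans with (K * d); [apply Rmult_le_compat_l; lra|].
    apply Rle_trans with ((K + 1) * d); [nra|]. unfold d; right; field; lra.
  rewrite Rabs_pos_eq in H2; lra.
assert (Hz : exists t, 0 <= t <= T /\ w c t <= 0).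
  (* Otherwise [w c] has a positive minimum, and the uniform Lipschitz bound keeps the solutions
     positive for parameters slightly above [c], against the choice of [c]. There is room above
     because [w mu] is not positive at [t0]. *)
  apply NNPP; intros Hn.
  destruct (continuity_ab_min (w c) 0 T ltac:(lra)) as [m [Hm Hm']].
    intros x _; apply continuity_pt_filterlim, (fam_w_cont _ _ _ _ _ H).
  assert (Hmp : 0 < w c m).
    destruct (Rlt_or_le 0 (w c m)); [easy|]. exfalso; apply Hn; now exists m.
  assert (Hcm : c < mu).
    destruct (Req_dec c mu) as [e|e]; [|lra]. exfalso; apply Hn; exists t0; rewrite e; now split.
  set (d := w c m / (K + 1)).
  assert (Hd : 0 < d) by (apply Rdiv_lt_0_compat; lra).
  set (x := Rmin mu (c + d / 2)).
  assert (Hx : c < x <= mu /\ x - c < d) by (unfold x, Rmin; destruct Rle_dec; lra).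
  assert (E x); [|assert (x <= c) by (now apply Hc1); lra].
  split; [lra|]. intros y t Hy Ht. destruct (Rlt_or_le y c); [apply Hbelow; lra|].
  assert (H2 := HC' y c t ltac:(lra) ltac:(lra)).
  rewrite (Rabs_pos_eq (y - c)) in H2 by lra.
  assert (Hkd : K * (y - c) < w c m).
    apply Rle_lt_trans with (K * (x - c)); [apply Rmult_le_compat_l; lra|].
    apply Rlt_le_trans with ((K + 1) * d); [nra|]. unfold d; right; field; lra.
  assert (H3 := Hm t Ht).
  assert (H4 : Rabs (w y t - w c t) < w c m) by lra. apply Rabs_def2 in H4. lra.
exists c; split; [exact Hcb|].
destruct Hz as [t [Ht Hwt]].
assert (Hdec : - w c t <= - w c T).
  apply (derive_nonneg_le (fun s => - w c s) (fun s => - - (l s / r s * V c s))); [lra | | |].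
  - intros s _. apply (continuous_opp (w c)), (fam_w_cont _ _ _ _ _ H).
  - intros s Hs. apply (is_derive_opp (w c)), (fam_w_derive _ _ _ _ _ H); lra.
  - intros s Hs. rewrite Ropp_involutive. apply Rmult_le_pos; [apply Hk; lra|].
    apply (fam_V_nonneg _ _ _ _ _ H); [exact H0c | lra |]. intros u Hu; apply Hnn; lra.
assert (H1 := Hnn T ltac:(lra)). lra.
Qed.

(* With [J], [VJ] the solution on the flat disc, [E t = V t * J (r t) - VJ (r t) * w t]
   has derivative [(l - dr) * (mu * r * w * J + V * VJ / r) >= 0], whereas it would
   be negative where [r] first reaches the first zero of [J] if [w] were positive. *)
Lemma disc_comparison (T R0 : R) (r dr l dl : R -> R) (w V J VJ : R -> R -> R) (mu : R) :
  pole_profile T r dr l dl -> r T = R0 ->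
  radial_family T r l w V ->
  radial_family R0 (fun x => x) (fun _ => 1) J VJ ->
  0 < mu -> (exists x, 0 <= x <= R0 /\ J mu x <= 0) ->
  exists t, 0 <= t <= T /\ w mu t <= 0.
Proof.
intros Hp HrT H HJ Hmu [x [Hx HJx]].
apply NNPP; intros Hn.
assert (Hw : forall t, 0 <= t <= T -> 0 < w mu t).
  intros t Ht. destruct (Rlt_or_le 0 (w mu t)); [easy|]. exfalso; apply Hn; now exists t.
assert (HT := prof_T _ _ _ _ _ Hp). assert (Hr0 := prof_r_0 _ _ _ _ _ Hp).
assert (Hrc := prof_r_cont _ _ _ _ _ Hp).
destruct (first_zero (J mu) 0 x) as [j [Hj [HJj HJpos]]].
  apply (fam_w_cont _ _ _ _ _ HJ). lra. rewrite (fam_w_0 _ _ _ _ _ HJ); lra. exact HJx.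
(* [r] need not be monotone, and the signs of [J] and [VJ] are known up to [j] only; so the
   comparison stops when [r] first reaches [j], which happens because [r T = R0 >= j]. *)
destruct (first_zero (fun t => j - r t) 0 T) as [t1 [Ht1 [Hrt1 Hbelow]]].
  intros t; apply (continuous_minus (fun _ => j) r); [apply continuous_const | apply Hrc].
  lra. rewrite Hr0; lra. lra.
assert (HJnn : forall y, 0 <= y <= j -> 0 <= J mu y).
  intros y Hy. destruct (Req_dec y j) as [->|]; [lra|]. left; apply HJpos; lra.
assert (HVJ : forall y, 0 <= y <= j -> 0 <= VJ mu y).
  intros y Hy. apply (fam_V_nonneg _ _ _ _ _ HJ); [lra|lra|]. intros s Hs; apply HJnn; lra.
assert (HVJj : 0 < VJ mu j).
  apply (fam_V_pos _ _ _ _ _ HJ); [lra|lra|]. intros s Hs; apply HJnn; lra.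
assert (HV : forall t, 0 <= t <= T -> 0 <= V mu t).
  intros t Ht. apply (fam_V_nonneg _ _ _ _ _ H); [lra|lra|]. intros s Hs; left; apply Hw; lra.
set (E := fun t => V mu t * J mu (r t) - VJ mu (r t) * w mu t).
set (dE := fun t => (l t - dr t) * (mu * r t * w mu t * J mu (r t) + V mu t * VJ mu (r t) / r t)).
assert (HE : E 0 <= E t1).
  apply (derive_nonneg_le E dE); [lra | | |].
  - intros t Ht.
    assert (C1 : continuous (V mu) t)
      by (apply (ex_derive_continuous (K := R_AbsRing) (V := R_NormedModule)); eexists;
          apply (fam_V_derive _ _ _ _ _ H)).
    assert (C2 : continuous (VJ mu) (r t))
      by (apply (ex_derive_continuous (K := R_AbsRing) (V := R_NormedModule)); eexists;
          apply (fam_V_derive _ _ _ _ _ HJ)).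
    apply (continuous_minus (fun t => V mu t * J mu (r t)) (fun t => VJ mu (r t) * w mu t)).
      apply (continuous_mult (V mu) (fun t => J mu (r t))); [exact C1|].
      apply (continuous_comp r (J mu)); [apply Hrc | apply (fam_w_cont _ _ _ _ _ HJ)].
    apply (continuous_mult (fun t => VJ mu (r t)) (w mu)).
      apply (continuous_comp r (VJ mu)); [apply Hrc | exact C2].
    apply (fam_w_cont _ _ _ _ _ H).
  - intros t Ht.
    assert (Hrt : 0 < r t < j).
      split; [apply (prof_r_pos _ _ _ _ _ Hp); lra | specialize (Hbelow t); lra].
    assert (D1 := fam_V_derive _ _ _ _ _ H mu t).
    assert (D2 := fam_w_derive _ _ _ _ _ H mu t ltac:(lra)).
    assert (D3 := fam_V_derive _ _ _ _ _ HJ mu (r t)).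
    assert (D4 := fam_w_derive _ _ _ _ _ HJ mu (r t) ltac:(lra)).
    assert (D5 := prof_r_derive _ _ _ _ _ Hp t ltac:(lra)).
    assert (D6 := is_derive_comp (K := R_AbsRing) (V := R_NormedModule) (J mu) r t _ _ D4 D5).
    assert (D7 := is_derive_comp (K := R_AbsRing) (V := R_NormedModule) (VJ mu) r t _ _ D3 D5).
    evar_last.
      apply (is_derive_minus (V := R_NormedModule) (fun t => V mu t * J mu (r t)) (fun t => VJ mu (r t) * w mu t)).
        apply (is_derive_mult (V mu) (fun t => J mu (r t))); [exact D1 | exact D6 | intros; apply Rmult_comm].
      apply (is_derive_mult (fun t => VJ mu (r t)) (w mu)); [exact D7 | exact D2 | intros; apply Rmult_comm].
    unfold dE, minus, plus, opp, scal, mult; simpl; unfold mult; simpl. field. lra.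
  - intros t Ht.
    assert (Hrt : 0 < r t < j).
      split; [apply (prof_r_pos _ _ _ _ _ Hp); lra | specialize (Hbelow t); lra].
    apply Rmult_le_pos; [assert (H1 := prof_dr_le _ _ _ _ _ Hp t ltac:(lra)); lra|].
    apply Rplus_le_le_0_compat.
      repeat apply Rmult_le_pos; [lra | lra | left; apply Hw; lra | apply HJnn; lra].
    apply Rmult_le_pos; [apply Rmult_le_pos; [apply HV; lra | apply HVJ; lra]|].
    left; apply Rinv_0_lt_compat; lra.
assert (Hr1 : r t1 = j) by lra.
unfold E in HE. rewrite Hr0, Hr1, HJj, (fam_V_0 _ _ _ _ _ H), (fam_V_0 _ _ _ _ _ HJ) in HE.
assert (Hw1 := Hw t1 ltac:(lra)). nra.
Qed.

(** * Regularity at the pole *)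

Definition divided (d : R) (f : R -> R) (t : R) : R := if Req_EM_T t 0 then d else f t / t.

Lemma divided_difference_continuous (f : R -> R) (d : R) :
  f 0 = 0 -> is_derive f 0 d -> continuous (divided d f) 0.
Proof.
intros H0 Hd. apply is_derive_Reals in Hd. apply continuous_eps. intros eps Heps.
destruct (Hd eps Heps) as [del H]. exists del; split; [apply cond_pos|].
intros y Hy. rewrite Rminus_0_r in Hy. unfold divided.
destruct (Req_EM_T y 0) as [|Hy0]; destruct (Req_EM_T 0 0) as [_|]; try lra.
  rewrite Rminus_diag, Rabs_R0; exact Heps.
assert (H1 := H y Hy0 Hy). now rewrite Rplus_0_l, H0, Rminus_0_r in H1.
Qed.

(** [F t - v 0 / 2 * t ^ 2] has derivative [t * (v t - v 0) = o(t)], so it is [o(t ^ 2)] by the mean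
    value theorem. *)
Lemma second_difference_continuous (F v : R -> R) :
  F 0 = 0 -> (forall t, is_derive F t (t * v t)) -> continuous v 0 ->
  continuous (fun t => if Req_EM_T t 0 then v 0 / 2 else F t / t ^ 2) 0.
Proof.
intros H0 Hd Hv. apply continuous_eps. intros eps Heps.
destruct (proj1 (continuous_eps v 0) Hv (eps / 2) ltac:(lra)) as [d [Hd0 H]].
exists d; split; [exact Hd0|]. intros y Hy.
destruct (Req_EM_T y 0) as [|Hy0]; destruct (Req_EM_T 0 0) as [_|]; try lra.
  rewrite Rminus_diag, Rabs_R0; exact Heps.
destruct (MVT_gen (fun t => F t - v 0 / 2 * t ^ 2) 0 y (fun t => t * (v t - v 0))) as [c [Hc E]].
- intros x _. evar_last.
    apply (is_derive_minus F (fun t => v 0 / 2 * t ^ 2)); [apply Hd|].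
    auto_derive; [easy|reflexivity].
  unfold minus, plus, opp; simpl. field.
- intros x _. apply continuity_pt_filterlim.
  apply (continuous_minus F (fun t => v 0 / 2 * t ^ 2)).
    apply (ex_derive_continuous (K := R_AbsRing) (V := R_NormedModule)); eexists; apply Hd.
  apply (ex_derive_continuous (K := R_AbsRing) (V := R_NormedModule)); now auto_derive.
- rewrite H0 in E.
  assert (Hcy : Rabs c <= Rabs y).
    revert Hc; unfold Rmin, Rmax; destruct Rle_dec; intros Hc;
      [rewrite !Rabs_pos_eq | rewrite !Rabs_left1]; lra.
  rewrite Rminus_0_r in Hy.
  assert (H1 := H c). rewrite Rminus_0_r in H1. specialize (H1 ltac:(lra)).
  replace (F y / y ^ 2 - v 0 / 2) with ((c * (v c - v 0)) * y / y ^ 2).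
  2: { rewrite Rminus_0_r in E. rewrite <- E. field; exact Hy0. }
  assert (Hya : 0 < Rabs y) by now apply Rabs_pos_lt.
  replace ((c * (v c - v 0)) * y / y ^ 2) with ((c * (v c - v 0)) / y) by (field; exact Hy0).
  rewrite Rabs_div by exact Hy0. rewrite Rabs_mult.
  apply Rle_lt_trans with (eps / 2); [|lra].
  apply Rmult_le_reg_r with (Rabs y); [exact Hya|].
  unfold Rdiv at 1. rewrite Rmult_assoc, Rinv_l, Rmult_1_r by lra.
  rewrite (Rmult_comm (eps / 2)).
  apply Rmult_le_compat; try apply Rabs_pos; lra.
Qed.

Lemma divided_off_0 (d : R) (f : R -> R) (t : R) : t <> 0 -> divided d f t = f t / t.
Proof. intros H; unfold divided; now destruct (Req_EM_T t 0). Qed.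

Lemma divided_at_0 (d : R) (f : R -> R) : divided d f 0 = d.
Proof. unfold divided; destruct (Req_EM_T 0 0); [reflexivity | lra]. Qed.

Lemma continuous_off_0 (f g : R -> R) (t : R) :
  t <> 0 -> (forall s, s <> 0 -> f s = g s) -> continuous f t -> continuous g t.
Proof.
intros Ht H. apply continuous_ext_loc.
assert (Ha : 0 < Rabs t) by now apply Rabs_pos_lt.
exists (mkposreal _ Ha). intros s Hs. change (Rabs (s - t) < Rabs t) in Hs.
apply H. intros ->. rewrite Rminus_0_l, Rabs_Ropp in Hs. lra.
Qed.

(** [g] is [w' / t] and [w2] is [w''], both continuous up to the pole. Their agreement at 0 makes
    the Hessian of [w (norm2 x y)] continuous at the origin; its trace is [w2 + g]. *)
Record radial_regular (T : R) (w g w2 : R -> R) : Prop := {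
  reg_w_cont : forall t, continuous w t;
  reg_g_cont : forall t, 0 <= t < T -> continuous g t;
  reg_w2_cont : forall t, 0 <= t < T -> continuous w2 t;
  reg_w_derive : forall t, 0 < t < T -> is_derive w t (t * g t);
  reg_g_derive : forall t, 0 < t < T -> is_derive g t ((w2 t - g t) / t);
  reg_0 : w2 0 = g 0
}.

(* With [rho = r / t] and [nu = V / t ^ 2], which extend continuously to [0], the
   derivatives of [w] are [w' = - t * (l / rho) * nu] and
   [w'' = (l * dr / rho ^ 2 - t * dl / rho) * nu - lam * l ^ 2 * w]. *)
Lemma solution_regular (T : R) (r dr l dl : R -> R) (w V : R -> R -> R) (lam : R) :
  pole_profile T r dr l dl -> radial_family T r l w V ->
  exists g w2, radial_regular T (w lam) g w2 /\
    (forall t, 0 < t < T -> t * g t = - (l t / r t * V lam t)) /\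
    g 0 = - (lam * l 0 ^ 2 / 2).
Proof.
intros Hp H.
assert (HT := prof_T _ _ _ _ _ Hp). assert (Hr0 := prof_r_0 _ _ _ _ _ Hp).
assert (Hl0 := prof_l_pos _ _ _ _ _ Hp 0 ltac:(lra)).
set (rho := divided (l 0) r).
set (v := fun t => lam * (rho t * l t * w lam t)).
set (nu := fun t => if Req_EM_T t 0 then v 0 / 2 else V lam t / t ^ 2).
assert (Erho : forall t, r t = t * rho t).
  intros t. destruct (Req_dec t 0) as [->|Ht]; [rewrite Hr0; ring|].
  unfold rho; rewrite divided_off_0 by exact Ht. field; exact Ht.
assert (Crho : forall t, continuous rho t).
  intros t. destruct (Req_dec t 0) as [->|Ht].
    apply divided_difference_continuous; [exact Hr0|].
    rewrite (prof_l_0 _ _ _ _ _ Hp). apply (prof_r_derive _ _ _ _ _ Hp); lra.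
  apply (continuous_off_0 (fun t => r t * / t)); [exact Ht| |].
    intros s Hs; unfold rho; now rewrite divided_off_0.
  apply (continuous_mult r Rinv); [apply (prof_r_cont _ _ _ _ _ Hp) | now apply continuous_Rinv].
assert (Cv : forall t, continuous v t).
  intros t. apply (continuous_scal_r lam (fun t => rho t * l t * w lam t)).
  apply (continuous_mult (fun t => rho t * l t) (w lam)); [|apply (fam_w_cont _ _ _ _ _ H)].
  apply (continuous_mult rho l); [apply Crho | apply (prof_l_cont _ _ _ _ _ Hp)].
assert (DV : forall t, is_derive (V lam) t (t * v t)).
  intros t. replace (t * v t) with (lam * (r t * l t * w lam t)).
    apply (fam_V_derive _ _ _ _ _ H).
  rewrite Erho; unfold v; ring.
assert (CV : forall t, continuous (V lam) t).
  intros t. apply (ex_derive_continuous (K := R_AbsRing) (V := R_NormedModule)); eexists; apply DV.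
assert (Enu : forall t, V lam t = t ^ 2 * nu t).
  intros t. unfold nu. destruct (Req_EM_T t 0) as [->|Ht]; [rewrite (fam_V_0 _ _ _ _ _ H); ring|].
  field; exact Ht.
assert (Cnu : forall t, continuous nu t).
  intros t. destruct (Req_dec t 0) as [->|Ht].
    apply second_difference_continuous; [apply (fam_V_0 _ _ _ _ _ H) | apply DV | apply Cv].
  apply (continuous_off_0 (fun t => V lam t * / t ^ 2)); [exact Ht| |].
    intros s Hs; unfold nu; now destruct (Req_EM_T s 0).
  apply (continuous_mult (V lam) (fun t => / t ^ 2)); [apply CV|].
  apply (ex_derive_continuous (K := R_AbsRing) (V := R_NormedModule)); auto_derive.
  intros E; apply Ht. destruct (Rmult_integral _ _ E) as [|E']; [easy|lra].
assert (Prho : forall t, 0 <= t < T -> 0 < rho t).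
  intros t Ht. destruct (Req_dec t 0) as [->|Ht0]; [unfold rho; now rewrite divided_at_0|].
  unfold rho; rewrite divided_off_0 by exact Ht0.
  apply Rdiv_lt_0_compat; [apply (prof_r_pos _ _ _ _ _ Hp)|]; lra.
assert (Cirho : forall t, 0 <= t < T -> continuous (fun t => / rho t) t).
  intros t Ht. apply continuous_Rinv_comp; [apply Crho|]. assert (H1 := Prho t Ht); lra.
set (g := fun t => - (l t * / rho t * nu t)).
set (w2 := fun t => (l t * dr t * (/ rho t * / rho t) - t * dl t * / rho t) * nu t - lam * (l t * l t * w lam t)).
assert (Eg : forall t, 0 < t < T -> t * g t = - (l t / r t * V lam t)).
  intros t Ht. unfold g. rewrite Erho, Enu. assert (H1 := Prho t ltac:(lra)). field; lra.
exists g, w2; split; [split|split; [exact Eg|]].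
- apply (fam_w_cont _ _ _ _ _ H).
- intros t Ht. apply (continuous_opp (fun t => l t * / rho t * nu t)).
  apply (continuous_mult (fun t => l t * / rho t) nu); [|apply Cnu].
  apply (continuous_mult l (fun t => / rho t)); [apply (prof_l_cont _ _ _ _ _ Hp) | now apply Cirho].
- intros t Ht. assert (Cl := prof_l_cont _ _ _ _ _ Hp t).
  apply (continuous_minus (fun t => (l t * dr t * (/ rho t * / rho t) - t * dl t * / rho t) * nu t)
    (fun t => lam * (l t * l t * w lam t))).
    apply (continuous_mult (fun t => l t * dr t * (/ rho t * / rho t) - t * dl t * / rho t) nu); [|apply Cnu].
    apply (continuous_minus (fun t => l t * dr t * (/ rho t * / rho t)) (fun t => t * dl t * / rho t)).
      apply (continuous_mult (fun t => l t * dr t) (fun t => / rho t * / rho t)).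
        apply (continuous_mult l dr); [exact Cl | apply (prof_dr_cont _ _ _ _ _ Hp); lra].
      apply (continuous_mult (fun t => / rho t) (fun t => / rho t)); now apply Cirho.
    apply (continuous_mult (fun t => t * dl t) (fun t => / rho t)); [|now apply Cirho].
    apply (continuous_mult (fun t => t) dl); [apply continuous_id | apply (prof_dl_cont _ _ _ _ _ Hp); lra].
  apply (continuous_scal_r lam (fun t => l t * l t * w lam t)).
  apply (continuous_mult (fun t => l t * l t) (w lam)); [|apply (fam_w_cont _ _ _ _ _ H)].
  apply (continuous_mult l l); exact Cl.
- intros t Ht. rewrite Eg by exact Ht. now apply (fam_w_derive _ _ _ _ _ H).
- intros t Ht.
  assert (Pr := prof_r_pos _ _ _ _ _ Hp t ltac:(lra)).
  (* [rho] and [nu] are only known to be continuous, so [g] is differentiated through [r], [l] and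
     [V], and the result is rewritten afterwards. *)
  apply (is_derive_ext_loc (fun t => - (l t / r t * V lam t) / t)).
    assert (Hd : 0 < Rmin t (T - t)) by (apply Rmin_glb_lt; lra).
    exists (mkposreal _ Hd). intros s Hs.
    change (Rabs (s - t) < Rmin t (T - t)) in Hs.
    assert (H1 := Rmin_l t (T - t)). assert (H2 := Rmin_r t (T - t)).
    apply Rabs_def2 in Hs. rewrite <- Eg by lra.
    match goal with |- ?a = ?b => change (@eq R a b) end. field; lra.
  assert (Dl := prof_l_derive _ _ _ _ _ Hp t ltac:(lra)).
  assert (Dr := prof_r_derive _ _ _ _ _ Hp t ltac:(lra)).
  assert (DVt := fam_V_derive _ _ _ _ _ H lam t).
  evar_last.
    apply (is_derive_div (fun t => - (l t / r t * V lam t)) (fun t => t)); [| apply (is_derive_id (K := R_AbsRing)) | lra].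
    apply (is_derive_opp (fun t => l t / r t * V lam t)).
    apply (is_derive_mult (fun t => l t / r t) (V lam)); [|exact DVt | intros; apply Rmult_comm].
    apply is_derive_div; [exact Dl | exact Dr | lra].
  assert (H1 := Prho t ltac:(lra)).
  unfold minus, plus, opp, scal, mult, one, w2, g; simpl; unfold mult; simpl.
  rewrite !Erho, Enu. field; lra.
- unfold w2, g, nu, v. destruct (Req_EM_T 0 0) as [_|]; [|lra].
  unfold rho; rewrite divided_at_0, (fam_w_0 _ _ _ _ _ H), <- (prof_l_0 _ _ _ _ _ Hp). field; lra.
- unfold g, nu, v. destruct (Req_EM_T 0 0) as [_|]; [|lra].
  unfold rho; rewrite divided_at_0, (fam_w_0 _ _ _ _ _ H). field; lra.
Qed.

(** [ex_diff_n] nests [Derive], and an inner derivative can be replaced by a formula only if the two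
    agree in a neighbourhood; hence the open set [P], on all of which the formulas hold. *)
Lemma C2_of_partials (P : R -> R -> Prop) (U a b aa ab ba bb : R -> R -> R) :
  (forall x y, P x y -> locally_2d P x y) ->
  (forall x y, P x y -> is_derive (fun z => U z y) x (a x y) /\ is_derive (fun z => U x z) y (b x y)) ->
  (forall x y, P x y -> is_derive (fun z => a z y) x (aa x y) /\ is_derive (fun z => a x z) y (ab x y)) ->
  (forall x y, P x y -> is_derive (fun z => b z y) x (ba x y) /\ is_derive (fun z => b x z) y (bb x y)) ->
  (forall x y, P x y -> continuity_2d_pt U x y /\ continuity_2d_pt a x y /\ continuity_2d_pt b x y) ->
  (forall x y, P x y -> continuity_2d_pt aa x y /\ continuity_2d_pt ab x y) ->
  (forall x y, P x y -> continuity_2d_pt ba x y /\ continuity_2d_pt bb x y) ->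
  forall x y, P x y -> C2_at U x y /\
    partial_derive 2 0 U x y = aa x y /\ partial_derive 0 2 U x y = bb x y.
Proof.
intros HP D0 Da Db C0 Ca Cb x y Hxy.
assert (Ha : forall u v, P u v -> Derive (fun z => U z v) u = a u v)
  by (intros u v Huv; apply is_derive_unique, D0, Huv).
assert (Hb : forall u v, P u v -> Derive (fun z => U u z) v = b u v)
  by (intros u v Huv; apply is_derive_unique, D0, Huv).
assert (L : forall f g : R -> R -> R, (forall u v, P u v -> f u v = g u v) -> forall u v, P u v ->
   locally_2d (fun s t => f s t = g s t) u v).
  intros f g Hfg u v Huv. generalize (HP u v Huv). apply locally_2d_impl, locally_2d_forall.
  intros s t; apply Hfg.
assert (Lx : forall f g : R -> R -> R, (forall u v, P u v -> f u v = g u v) -> forall u v, P u v ->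
   locally u (fun s => f s v = g s v)).
  intros f g Hfg u v Huv. apply (locally_2d_1d_const_y (fun s t => f s t = g s t)). now apply L.
assert (Ly : forall f g : R -> R -> R, (forall u v, P u v -> f u v = g u v) -> forall u v, P u v ->
   locally v (fun t => f u t = g u t)).
  intros f g Hfg u v Huv. apply (locally_2d_1d_const_x (fun s t => f s t = g s t)). now apply L.
assert (Haa : forall u v, P u v -> Derive (fun z => Derive (fun t => U t v) z) u = aa u v).
  intros u v Huv. rewrite (Derive_ext_loc _ (fun z => a z v)).
    apply is_derive_unique, Da, Huv.
  now apply (Lx (fun z v => Derive (fun t => U t v) z) a).
assert (Hab : forall u v, P u v -> Derive (fun z => Derive (fun t => U t z) u) v = ab u v).
  intros u v Huv. rewrite (Derive_ext_loc _ (fun z => a u z)).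
    apply is_derive_unique, Da, Huv.
  now apply (Ly (fun z v => Derive (fun t => U t v) z) a).
assert (Hba : forall u v, P u v -> Derive (fun z => Derive (fun t => U z t) v) u = ba u v).
  intros u v Huv. rewrite (Derive_ext_loc _ (fun z => b z v)).
    apply is_derive_unique, Db, Huv.
  now apply (Lx (fun z v => Derive (fun t => U z t) v) b).
assert (Hbb : forall u v, P u v -> Derive (fun z => Derive (fun t => U u t) z) v = bb u v).
  intros u v Huv. rewrite (Derive_ext_loc _ (fun z => b u z)).
    apply is_derive_unique, Db, Huv.
  now apply (Ly (fun z v => Derive (fun t => U z t) v) b).
split; [|split; [apply Haa, Hxy | apply Hbb, Hxy]].
split; [apply C0, Hxy|].
split; [exists (a x y); apply D0, Hxy|]. split; [exists (b x y); apply D0, Hxy|].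
split.
- apply (ex_diff_n_ext_loc a).
    apply (L a (fun u v => Derive (fun z => U z v) u)); [|exact Hxy].
    intros u v Huv; now rewrite Ha.
  split; [apply C0, Hxy|].
  split; [exists (aa x y); apply Da, Hxy|]. split; [exists (ab x y); apply Da, Hxy|].
  split; (split; [|easy]).
    apply (continuity_2d_pt_ext_loc aa); [|apply Ca, Hxy].
    apply (L aa (fun u v => Derive (fun z => a z v) u)); [|exact Hxy].
    intros u v Huv; symmetry; apply is_derive_unique, Da, Huv.
  apply (continuity_2d_pt_ext_loc ab); [|apply Ca, Hxy].
  apply (L ab (fun u v => Derive (fun z => a u z) v)); [|exact Hxy].
  intros u v Huv; symmetry; apply is_derive_unique, Da, Huv.
- apply (ex_diff_n_ext_loc b).
    apply (L b (fun u v => Derive (fun z => U u z) v)); [|exact Hxy].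
    intros u v Huv; now rewrite Hb.
  split; [apply C0, Hxy|].
  split; [exists (ba x y); apply Db, Hxy|]. split; [exists (bb x y); apply Db, Hxy|].
  split; (split; [|easy]).
    apply (continuity_2d_pt_ext_loc ba); [|apply Cb, Hxy].
    apply (L ba (fun u v => Derive (fun z => b z v) u)); [|exact Hxy].
    intros u v Huv; symmetry; apply is_derive_unique, Db, Huv.
  apply (continuity_2d_pt_ext_loc bb); [|apply Cb, Hxy].
  apply (L bb (fun u v => Derive (fun z => b u z) v)); [|exact Hxy].
  intros u v Huv; symmetry; apply is_derive_unique, Db, Huv.
Qed.

(** * Radial functions of two variables *)

Definition norm2 (x y : R) : R := sqrt (x ^ 2 + y ^ 2).

Lemma sum_sq_nonneg (x y : R) : 0 <= x ^ 2 + y ^ 2.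
Proof. assert (H1 := pow2_ge_0 x). assert (H2 := pow2_ge_0 y). lra. Qed.

Lemma norm2_sqr (x y : R) : norm2 x y ^ 2 = x ^ 2 + y ^ 2.
Proof. unfold norm2. rewrite <- Rsqr_pow2. apply Rsqr_sqrt, sum_sq_nonneg. Qed.

Lemma norm2_nonneg (x y : R) : 0 <= norm2 x y.
Proof. apply sqrt_pos. Qed.

Lemma norm2_sym (x y : R) : norm2 x y = norm2 y x.
Proof. unfold norm2; f_equal; ring. Qed.

Lemma norm2_0 : norm2 0 0 = 0.
Proof. unfold norm2. replace (0 ^ 2 + 0 ^ 2) with 0 by ring. apply sqrt_0. Qed.

Lemma norm2_pos (x y : R) : x <> 0 \/ y <> 0 -> 0 < norm2 x y.
Proof.
intros H. apply sqrt_lt_R0.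
destruct H as [H|H]; apply pow2_gt_0 in H;
  assert (H1 := pow2_ge_0 x); assert (H2 := pow2_ge_0 y); lra.
Qed.

Lemma norm2_dichotomy (x y : R) : 0 < norm2 x y \/ (x = 0 /\ y = 0).
Proof.
destruct (Req_dec x 0) as [Hx|Hx]; [destruct (Req_dec y 0) as [Hy|Hy]; [now right|]|];
  left; apply norm2_pos; tauto.
Qed.

Lemma norm2_polar (s theta : R) : 0 <= s -> norm2 (s * cos theta) (s * sin theta) = s.
Proof.
intros Hs. unfold norm2. replace ((s * cos theta) ^ 2 + (s * sin theta) ^ 2) with (s ^ 2).
  now apply sqrt_pow2.
transitivity (s ^ 2 * (Rsqr (sin theta) + Rsqr (cos theta))); [rewrite sin2_cos2; ring | unfold Rsqr; ring].
Qed.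

Lemma norm2_lt (x y d : R) : 0 < d -> x ^ 2 + y ^ 2 < d ^ 2 <-> norm2 x y < d.
Proof.
intros Hd. rewrite <- norm2_sqr. assert (H := norm2_nonneg x y). split; intros H1.
  destruct (Rlt_or_le (norm2 x y) d); nra.
nra.
Qed.

Lemma norm2_cont (x y : R) : continuity_2d_pt norm2 x y.
Proof.
apply (continuity_1d_2d_pt_comp sqrt (fun x y => x ^ 2 + y ^ 2)).
  apply continuity_pt_sqrt, sum_sq_nonneg.
apply continuity_2d_pt_plus.
  apply (continuity_2d_pt_ext (fun x _ => x * x)); [intros; ring|].
  apply continuity_2d_pt_mult; apply continuity_2d_pt_id1.
apply (continuity_2d_pt_ext (fun _ y => y * y)); [intros; ring|].
apply continuity_2d_pt_mult; apply continuity_2d_pt_id2.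
Qed.

Lemma norm2_derive (x y : R) : 0 < norm2 x y -> is_derive (fun z => norm2 z y) x (x / norm2 x y).
Proof.
intros H. assert (H1 := norm2_sqr x y). unfold norm2 in *.
auto_derive.
  rewrite !Rmult_1_r. nra.
replace (x * (x * 1)) with (x ^ 2) by ring. replace (y * (y * 1)) with (y ^ 2) by ring.
field. lra.
Qed.

Lemma continuity_2d_radial (f : R -> R) (x y : R) :
  continuous f (norm2 x y) -> continuity_2d_pt (fun x y => f (norm2 x y)) x y.
Proof.
intros H. apply (continuity_1d_2d_pt_comp f norm2); [|apply norm2_cont].
now apply continuity_pt_filterlim.
Qed.

Lemma continuity_2d_line (f : R -> R -> R) (x y : R) :
  continuity_2d_pt f x y -> continuous (fun z => f z y) x.
Proof.
intros H. apply continuous_eps. intros eps Heps.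
destruct (H (mkposreal _ Heps)) as [d Hd]. exists d; split; [apply cond_pos|].
intros z Hz. apply Hd; [exact Hz|]. rewrite Rminus_diag, Rabs_R0. apply cond_pos.
Qed.

Lemma continuity_2d_pt_swap (f : R -> R -> R) (x y : R) :
  continuity_2d_pt f y x -> continuity_2d_pt (fun x y => f y x) x y.
Proof. intros H eps. destruct (H eps) as [d Hd]. exists d. intros u v Hu Hv. now apply Hd. Qed.

(** Meant for [x ^ 2 / norm2 x y ^ 2] and [x * y / norm2 x y ^ 2]: they have no limit at the origin
    but are bounded, and the factor [z] tends to 0 there. *)
Lemma bounded_times_small (q : R -> R -> R) (z : R -> R) (x y : R) :
  (forall x y, Rabs (q x y) <= 1) ->
  (0 < norm2 x y -> continuity_2d_pt q x y) ->
  z 0 = 0 -> continuous z (norm2 x y) ->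
  continuity_2d_pt (fun x y => q x y * z (norm2 x y)) x y.
Proof.
intros Hq Hqc Hz0 Hz.
destruct (Rle_lt_or_eq_dec 0 (norm2 x y) (norm2_nonneg x y)) as [Hn|Hn].
  apply continuity_2d_pt_mult; [now apply Hqc | now apply continuity_2d_radial].
intros eps.
destruct (continuity_2d_radial z x y Hz eps) as [d Hd]. exists d. intros u v Hu Hv.
assert (H1 := Hd u v Hu Hv). rewrite <- Hn, Hz0, Rminus_0_r in H1.
rewrite <- Hn, Hz0, Rmult_0_r, Rminus_0_r, Rabs_mult.
apply Rle_lt_trans with (2 := H1).
rewrite <- (Rmult_1_l (Rabs (z (norm2 u v)))) at 2.
apply Rmult_le_compat_r; [apply Rabs_pos | apply Hq].
Qed.

Lemma quotient_le_1 (a x y : R) : Rabs a <= norm2 x y ^ 2 -> Rabs (a / norm2 x y ^ 2) <= 1.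
Proof.
intros H. destruct (Req_dec (norm2 x y ^ 2) 0) as [E|E].
  rewrite E. unfold Rdiv; rewrite Rinv_0, Rmult_0_r, Rabs_R0; lra.
assert (Hp := pow2_ge_0 (norm2 x y)).
rewrite Rabs_div, (Rabs_pos_eq (norm2 x y ^ 2)) by (exact E || exact Hp).
apply Rmult_le_reg_r with (norm2 x y ^ 2); [lra|].
unfold Rdiv; rewrite Rmult_assoc, Rinv_l by exact E. lra.
Qed.

Lemma quotient_cont (f : R -> R -> R) (x y : R) :
  continuity_2d_pt f x y -> 0 < norm2 x y -> continuity_2d_pt (fun x y => f x y / norm2 x y ^ 2) x y.
Proof.
intros Hf Hn. apply continuity_2d_pt_mult; [exact Hf|].
apply continuity_2d_pt_inv; [|apply pow_nonzero; lra].
apply (continuity_2d_pt_ext (fun x y => norm2 x y * norm2 x y)); [intros; ring|].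
apply continuity_2d_pt_mult; apply norm2_cont.
Qed.

Section RadialFunction.

Variables (T : R) (w g w2 : R -> R).
Hypothesis T_pos : 0 < T.
Hypothesis reg : radial_regular T w g w2.

(** [xx] and [xy] are entries of the Hessian of [w (norm2 x y)]; the remaining one is [xx] with its
    arguments exchanged. [z] is the difference of the radial and the tangential eigenvalue. *)
Let z (t : R) : R := w2 t - g t.
Let xx (x y : R) : R := g (norm2 x y) + x ^ 2 / norm2 x y ^ 2 * z (norm2 x y).
Let xy (x y : R) : R := x * y / norm2 x y ^ 2 * z (norm2 x y).
Let P (x y : R) : Prop := norm2 x y < T.

Lemma radial_z_cont (t : R) : 0 <= t < T -> continuous z t.
Proof.
intros Ht. apply (continuous_minus w2 g); [now apply (reg_w2_cont _ _ _ _ reg) | now apply (reg_g_cont _ _ _ _ reg)].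
Qed.

Lemma radial_z_0 : z 0 = 0.
Proof. unfold z; rewrite (reg_0 _ _ _ _ reg); ring. Qed.

Lemma radial_open (x y : R) : P x y -> locally_2d P x y.
Proof.
intros H. assert (He : 0 < T - norm2 x y) by (unfold P in H; lra).
destruct (norm2_cont x y (mkposreal _ He)) as [d Hd]. exists d. intros u v Hu Hv.
assert (H1 := Hd u v Hu Hv); simpl in H1. apply Rabs_def2 in H1. unfold P; lra.
Qed.

Lemma radial_xx_cont (x y : R) : P x y -> continuity_2d_pt xx x y.
Proof.
intros H. assert (Hn := norm2_nonneg x y). unfold P in H. apply continuity_2d_pt_plus.
  apply continuity_2d_radial, (reg_g_cont _ _ _ _ reg); lra.
apply (bounded_times_small (fun x y => x ^ 2 / norm2 x y ^ 2) z); [| |apply radial_z_0 | apply radial_z_cont; lra].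
  intros u v. apply quotient_le_1. rewrite norm2_sqr, Rabs_pos_eq by apply pow2_ge_0.
  assert (H1 := pow2_ge_0 v); lra.
intros Hp. apply (quotient_cont (fun x y => x ^ 2)); [|exact Hp].
apply (continuity_2d_pt_ext (fun x _ => x * x)); [intros; ring|].
apply continuity_2d_pt_mult; apply continuity_2d_pt_id1.
Qed.

Lemma radial_xy_cont (x y : R) : P x y -> continuity_2d_pt xy x y.
Proof.
intros H. assert (Hn := norm2_nonneg x y). unfold P in H.
apply (bounded_times_small (fun x y => x * y / norm2 x y ^ 2) z); [| |apply radial_z_0 | apply radial_z_cont; lra].
  intros u v. apply quotient_le_1. rewrite norm2_sqr. apply Rabs_le.
  assert (H1 := pow2_ge_0 (u + v)). assert (H2 := pow2_ge_0 (u - v)).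
  assert (H3 := pow2_ge_0 u). assert (H4 := pow2_ge_0 v). nra.
intros Hp. apply (quotient_cont (fun x y => x * y)); [|exact Hp].
apply continuity_2d_pt_mult; [apply continuity_2d_pt_id1 | apply continuity_2d_pt_id2].
Qed.

Lemma norm2_near_0 (u : R) : Rabs (u - 0) < T -> norm2 u 0 < T.
Proof.
rewrite Rminus_0_r. intros H. apply norm2_lt; [exact T_pos|].
apply Rabs_def2 in H. nra.
Qed.

(** Off the origin this is the chain rule. At the origin the formula extends by continuity along the
    first axis. *)
Lemma radial_derive_x (x y : R) : P x y ->
  is_derive (fun u => w (norm2 u y)) x (x * g (norm2 x y)).
Proof.
assert (Off : forall x y, 0 < norm2 x y < T -> is_derive (fun u => w (norm2 u y)) x (x * g (norm2 x y))).
  clear x y; intros x y H. evar_last.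
    apply (is_derive_comp (K := R_AbsRing) (V := R_NormedModule) w (fun u => norm2 u y)).
      now apply (reg_w_derive _ _ _ _ reg).
    now apply norm2_derive.
  unfold scal; simpl; unfold mult; simpl. field; lra.
intros H. destruct (norm2_dichotomy x y) as [Hn|[-> ->]]; [now apply Off|].
apply (derive_extension (fun u => w (norm2 u 0)) (fun u => u * g (norm2 u 0)) 0 T T_pos).
- intros u _. apply (continuity_2d_line (fun x y => w (norm2 x y))), continuity_2d_radial, (reg_w_cont _ _ _ _ reg).
- intros u Hu Hu0. apply Off; split; [apply norm2_pos; now left | now apply norm2_near_0].
- apply (continuity_2d_line (fun x y => x * g (norm2 x y))).
  apply continuity_2d_pt_mult; [apply continuity_2d_pt_id1|].
  apply continuity_2d_radial, (reg_g_cont _ _ _ _ reg). rewrite norm2_0; lra.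
Qed.

Lemma radial_g_derive (x y : R) : 0 < norm2 x y < T ->
  is_derive (fun u => g (norm2 u y)) x (x / norm2 x y ^ 2 * z (norm2 x y)).
Proof.
intros H. evar_last.
  apply (is_derive_comp (K := R_AbsRing) (V := R_NormedModule) g (fun u => norm2 u y)).
    now apply (reg_g_derive _ _ _ _ reg).
  now apply norm2_derive.
unfold scal, z; simpl; unfold mult; simpl. field; lra.
Qed.

Lemma radial_derive_xx (x y : R) : P x y ->
  is_derive (fun u => u * g (norm2 u y)) x (xx x y).
Proof.
assert (Off : forall x y, 0 < norm2 x y < T -> is_derive (fun u => u * g (norm2 u y)) x (xx x y)).
  clear x y; intros x y H. evar_last.
    apply (is_derive_mult (fun u => u) (fun u => g (norm2 u y)));
      [apply (is_derive_id (K := R_AbsRing)) | now apply radial_g_derive | intros; apply Rmult_comm].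
  unfold plus, mult, one, xx; simpl; unfold Rdiv; ring.
intros H. destruct (norm2_dichotomy x y) as [Hn|[-> ->]]; [now apply Off|].
apply (derive_extension (fun u => u * g (norm2 u 0)) (fun u => xx u 0) 0 T T_pos).
- intros u Hu. apply (continuity_2d_line (fun x y => x * g (norm2 x y))).
  apply continuity_2d_pt_mult; [apply continuity_2d_pt_id1|].
  apply continuity_2d_radial, (reg_g_cont _ _ _ _ reg).
  split; [apply norm2_nonneg | now apply norm2_near_0].
- intros u Hu Hu0. apply Off; split; [apply norm2_pos; now left | now apply norm2_near_0].
- apply (continuity_2d_line xx), radial_xx_cont. exact H.
Qed.

Lemma radial_derive_xy (x y : R) : P x y ->
  is_derive (fun u => y * g (norm2 u y)) x (xy x y).
Proof.
intros H. destruct (norm2_dichotomy x y) as [Hn|[-> ->]].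
  evar_last.
    apply (is_derive_scal (fun u => g (norm2 u y)) x y). now apply radial_g_derive.
  unfold xy, Rdiv; simpl; ring.
replace (xy 0 0) with 0 by (unfold xy, Rdiv; ring).
apply (is_derive_ext (fun _ => 0)); [intros; simpl; ring|].
apply (is_derive_const (K := R_AbsRing) (V := R_NormedModule)).
Qed.

(** Derivatives in the second variable come from those in the first by the symmetry of [norm2]. The
    trace collapses by [x ^ 2 + y ^ 2 = norm2 x y ^ 2], and at the origin by [w2 0 = g 0]. *)
Lemma radial_C2 (x y : R) : P x y ->
  C2_at (fun x y => w (norm2 x y)) x y /\
  partial_derive 2 0 (fun x y => w (norm2 x y)) x y + partial_derive 0 2 (fun x y => w (norm2 x y)) x y
  = w2 (norm2 x y) + g (norm2 x y).
Proof.
intros H.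
destruct (C2_of_partials P (fun x y => w (norm2 x y)) (fun x y => x * g (norm2 x y))
  (fun x y => y * g (norm2 x y)) xx (fun x y => xy y x) xy (fun x y => xx y x)) with (x := x) (y := y)
  as [H1 [H2 H3]].
- apply radial_open.
- intros u v Huv. split; [now apply radial_derive_x|].
  apply (is_derive_ext (fun s => w (norm2 s u))); [intros; now rewrite norm2_sym|].
  rewrite (norm2_sym u v). apply radial_derive_x. unfold P; now rewrite norm2_sym.
- intros u v Huv. split; [now apply radial_derive_xx|].
  apply (is_derive_ext (fun s => u * g (norm2 s u))); [intros; now rewrite norm2_sym|].
  apply radial_derive_xy. unfold P; now rewrite norm2_sym.
- intros u v Huv. split; [now apply radial_derive_xy|].
  apply (is_derive_ext (fun s => s * g (norm2 s u))); [intros; now rewrite norm2_sym|].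
  apply radial_derive_xx. unfold P; now rewrite norm2_sym.
- intros u v Huv. assert (Hn := norm2_nonneg u v). unfold P in Huv.
  assert (Cg : continuity_2d_pt (fun x y => g (norm2 x y)) u v)
    by (apply continuity_2d_radial, (reg_g_cont _ _ _ _ reg); lra).
  split; [apply continuity_2d_radial, (reg_w_cont _ _ _ _ reg)|].
  split; apply continuity_2d_pt_mult; try exact Cg; [apply continuity_2d_pt_id1 | apply continuity_2d_pt_id2].
- intros u v Huv. split; [now apply radial_xx_cont|].
  apply (continuity_2d_pt_ext xy); [|now apply radial_xy_cont].
  intros s t. unfold xy. rewrite (norm2_sym t s). f_equal. f_equal. ring.
- intros u v Huv. split; [now apply radial_xy_cont|].
  apply (continuity_2d_pt_swap xx), radial_xx_cont. unfold P; now rewrite norm2_sym.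
- exact H.
- split; [exact H1|]. rewrite H2, H3. unfold xx. rewrite (norm2_sym y x).
  destruct (norm2_dichotomy x y) as [Hn|[-> ->]].
    replace (x ^ 2) with (norm2 x y ^ 2 - y ^ 2) by (rewrite norm2_sqr; ring).
    unfold z. field; lra.
  rewrite norm2_0, (reg_0 _ _ _ _ reg). unfold Rdiv; ring.
Qed.

End RadialFunction.

(** * The maximum principle on the disc *)

Lemma continuous_on_eps (D : R * R -> Prop) (f : R -> R -> R) :
  continuous_on D (fun p : R * R => f (fst p) (snd p)) <->
  forall x y, D (x, y) -> forall eps, 0 < eps -> exists d : posreal, forall u v, D (u, v) ->
    Rabs (u - x) < d -> Rabs (v - y) < d -> Rabs (f u v - f x y) < eps.
Proof.
split.
- intros H x y Hxy eps Heps.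
  assert (H1 := proj1 (filterlim_locally _ _) (H (x, y) Hxy) (mkposreal _ Heps)).
  destruct H1 as [d Hd]. exists d. intros u v Huv Hu Hv.
  now apply (Hd (u, v)).
- intros H [x y] Hxy. apply filterlim_locally. intros eps.
  destruct (H x y Hxy eps (cond_pos eps)) as [d Hd].
  exists d. intros [u v] [Hu Hv] Huv. now apply Hd.
Qed.

(** Compactness yields a positive lower bound for the radii of boxes that cover the square. A
    uniform bound on a function is obtained by letting the radius of a box also encode the bound
    that holds in it. *)
Lemma square_cover (a : R) (P : R -> R -> posreal -> Prop) :
  (forall u v, exists del, P u v del) ->
  exists d : posreal, forall x y, - a <= x <= a -> - a <= y <= a ->
    exists u v (del : posreal), P u v del /\ Rabs (x - u) < del /\ Rabs (y - v) < del /\ d <= del.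
Proof.
intros H.
destruct (functional_choice (fun (p : R * R) del => P (fst p) (snd p) del)) as [delta Hdelta].
  intros [u v]; apply H.
destruct (compactness_value_2d (- a) a (- a) a (fun u v => delta (u, v))) as [d Hd].
exists d. intros x y Hx Hy. destruct (NNPP _ (Hd x y Hx Hy)) as [u [v [_ [_ [H1 [H2 H3]]]]]].
exists u, v, (delta (u, v)). split; [apply (Hdelta (u, v))|]. easy.
Qed.

Lemma outside_closed_disc (rho u v : R) : 0 <= rho -> ~ closed_disc rho (u, v) ->
  exists del : posreal, forall x y, closed_disc rho (x, y) -> Rabs (x - u) < del -> Rabs (y - v) < del -> False.
Proof.
intros Hrho H. unfold closed_disc in H; simpl fst in H; simpl snd in H.
assert (Hn : rho < norm2 u v).
  destruct (Rlt_or_le rho (norm2 u v)) as [|Hle]; [easy|]. exfalso; apply H.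
  rewrite <- norm2_sqr. apply pow_incr. split; [apply norm2_nonneg | exact Hle].
destruct (norm2_cont u v (mkposreal (norm2 u v - rho) ltac:(lra))) as [d Hd].
exists d. intros x y Hxy Hx Hy. assert (H1 := Hd x y Hx Hy). simpl in H1. apply Rabs_def2 in H1.
unfold closed_disc in Hxy; simpl fst in Hxy; simpl snd in Hxy.
assert (H2 : rho < norm2 x y) by lra.
rewrite <- norm2_sqr in Hxy. assert (H3 := norm2_nonneg x y). nra.
Qed.

Lemma closed_disc_coord (rho x y : R) : 0 <= rho -> closed_disc rho (x, y) ->
  - rho <= x <= rho /\ - rho <= y <= rho.
Proof.
unfold closed_disc; simpl fst; simpl snd; intros Hr H.
assert (H1 := pow2_ge_0 x). assert (H2 := pow2_ge_0 y).
repeat split; nra.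
Qed.

(** Two covers. In the first a box of radius [del] carries the bound [h <= / del], so [h] is
    bounded; in the second it carries [h <= s - del], so a supremum [s] that is not attained could
    be lowered. Boxes around points outside the disc are taken so small that they miss it. *)
Lemma closed_disc_max (rho : R) (h : R -> R -> R) :
  0 <= rho -> continuous_on (closed_disc rho) (fun p : R * R => h (fst p) (snd p)) ->
  exists x0 y0, closed_disc rho (x0, y0) /\ forall x y, closed_disc rho (x, y) -> h x y <= h x0 y0.
Proof.
intros Hrho Hc. assert (Hc' := proj1 (continuous_on_eps _ _) Hc).
assert (Hbound : exists M, forall x y, closed_disc rho (x, y) -> h x y <= M).
  destruct (square_cover rho (fun u v del => forall x y, closed_disc rho (x, y) ->
    Rabs (x - u) < del -> Rabs (y - v) < del -> h x y <= / del)) as [d Hd].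
  - intros u v. destruct (classic (closed_disc rho (u, v))) as [Huv|Huv].
    + destruct (Hc' u v Huv 1 ltac:(lra)) as [d Hd].
      assert (Ha := Rabs_pos (h u v)).
      assert (Hp : 0 < / (Rabs (h u v) + 1)) by (apply Rinv_0_lt_compat; lra).
      assert (Hm : 0 < Rmin d (/ (Rabs (h u v) + 1))) by (apply Rmin_glb_lt; [apply cond_pos | exact Hp]).
      exists (mkposreal _ Hm); simpl. intros x y Hxy Hx Hy.
      assert (M1 := Rmin_l d (/ (Rabs (h u v) + 1))). assert (M2 := Rmin_r d (/ (Rabs (h u v) + 1))).
      assert (H1 := Hd x y Hxy ltac:(lra) ltac:(lra)). apply Rabs_def2 in H1.
      assert (H2 := Rle_abs (h u v)).
      apply Rle_trans with (Rabs (h u v) + 1); [lra|].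
      rewrite <- (Rinv_inv (Rabs (h u v) + 1)) at 1. apply Rinv_le_contravar; [exact Hm | exact M2].
    + destruct (outside_closed_disc rho u v Hrho Huv) as [d Hd]. exists d.
      intros x y Hxy Hx Hy. destruct (Hd x y Hxy Hx Hy).
  - exists (/ d). intros x y Hxy. destruct (closed_disc_coord rho x y Hrho Hxy) as [Hx Hy].
    destruct (Hd x y Hx Hy) as [u [v [del [H1 [H2 [H3 H4]]]]]].
    apply Rle_trans with (/ del); [now apply H1|]. apply Rinv_le_contravar; [apply cond_pos | exact H4].
destruct Hbound as [M HM].
set (E := fun z => exists x y, closed_disc rho (x, y) /\ z = h x y).
destruct (completeness E) as [s [Hs1 Hs2]].
  exists M. intros z [x [y [Hxy ->]]]. now apply HM.
  exists (h 0 0), 0, 0. split; [|reflexivity]. unfold closed_disc; simpl. nra.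
apply NNPP; intros Hn.
assert (Hlt : forall x y, closed_disc rho (x, y) -> h x y < s).
  intros x y Hxy. assert (H1 : h x y <= s) by (apply Hs1; now exists x, y).
  destruct (Rle_lt_or_eq_dec _ _ H1) as [|Heq]; [easy|].
  exfalso; apply Hn. exists x, y. split; [exact Hxy|]. intros u v Huv. rewrite Heq.
  apply Hs1; now exists u, v.
destruct (square_cover rho (fun u v del => forall x y, closed_disc rho (x, y) ->
  Rabs (x - u) < del -> Rabs (y - v) < del -> h x y <= s - del)) as [d Hd].
- intros u v. destruct (classic (closed_disc rho (u, v))) as [Huv|Huv].
  + assert (He : 0 < (s - h u v) / 2) by (assert (H1 := Hlt u v Huv); lra).
    destruct (Hc' u v Huv _ He) as [d Hd].
    assert (Hm : 0 < Rmin d ((s - h u v) / 2)) by (apply Rmin_glb_lt; [apply cond_pos | exact He]).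
    exists (mkposreal _ Hm); simpl. intros x y Hxy Hx Hy.
    assert (M1 := Rmin_l d ((s - h u v) / 2)). assert (M2 := Rmin_r d ((s - h u v) / 2)).
    assert (H1 := Hd x y Hxy ltac:(lra) ltac:(lra)). apply Rabs_def2 in H1. lra.
  + destruct (outside_closed_disc rho u v Hrho Huv) as [d Hd]. exists d.
    intros x y Hxy Hx Hy. destruct (Hd x y Hxy Hx Hy).
- assert (Hd0 := cond_pos d). assert (s <= s - d); [|lra].
  apply Hs2. intros z [x [y [Hxy ->]]]. destruct (closed_disc_coord rho x y Hrho Hxy) as [Hx Hy].
  destruct (Hd x y Hx Hy) as [u [v [del [H1 [H2 [H3 H4]]]]]].
  apply Rle_trans with (s - del); [now apply H1 | lra].
Qed.

(** [df] vanishes at [x]. If [d2] were positive, [df] would be positive just to the right of [x],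
    and [f] would exceed [f x] there. *)
Lemma second_derivative_at_max (f df : R -> R) (x d2 : R) :
  locally x (fun t => is_derive f t (df t)) -> is_derive df x d2 ->
  locally x (fun t => f t <= f x) -> d2 <= 0.
Proof.
intros [d1 H1] H2 [d3 H3].
assert (P1 := cond_pos d1). assert (P3 := cond_pos d3).
assert (H1' : forall t, Rabs (t - x) < d1 -> is_derive f t (df t)) by (intros t Ht; now apply H1).
assert (H3' : forall t, Rabs (t - x) < d3 -> f t <= f x) by (intros t Ht; now apply H3).
clear H1 H3.
apply is_derive_Reals in H2.
assert (E0 : df x = 0).
  assert (Dx := H1' x ltac:(rewrite Rminus_diag, Rabs_R0; lra)). apply is_derive_Reals in Dx.
  destruct (Rtotal_order (df x) 0) as [Hlt|[|Hgt]]; [exfalso|easy|exfalso].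
  - destruct (Dx (- df x) ltac:(lra)) as [d H]. assert (Pd := cond_pos d).
    set (h := - Rmin (d / 2) (d3 / 2)).
    assert (Hh : h < 0 /\ - h < d /\ - h < d3) by (unfold h, Rmin; destruct Rle_dec; lra).
    assert (H4 := H h ltac:(lra)). rewrite (Rabs_left h) in H4 by lra. specialize (H4 ltac:(lra)).
    apply Rabs_def2 in H4.
    assert (H5 := H3' (x + h)). replace (x + h - x) with h in H5 by ring.
    rewrite (Rabs_left h) in H5 by lra. specialize (H5 ltac:(lra)).
    assert (H6 : (f (x + h) - f x) / h * h = f (x + h) - f x) by (field; lra). nra.
  - destruct (Dx (df x) ltac:(lra)) as [d H]. assert (Pd := cond_pos d).
    set (h := Rmin (d / 2) (d3 / 2)).
    assert (Hh : 0 < h /\ h < d /\ h < d3) by (unfold h, Rmin; destruct Rle_dec; lra).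
    assert (H4 := H h ltac:(lra)). rewrite (Rabs_pos_eq h) in H4 by lra. specialize (H4 ltac:(lra)).
    apply Rabs_def2 in H4.
    assert (H5 := H3' (x + h)). replace (x + h - x) with h in H5 by ring.
    rewrite (Rabs_pos_eq h) in H5 by lra. specialize (H5 ltac:(lra)).
    assert (H6 : (f (x + h) - f x) / h * h = f (x + h) - f x) by (field; lra). nra.
destruct (Rle_or_lt d2 0) as [|Hpos]; [easy|exfalso].
destruct (H2 d2 Hpos) as [d H]. assert (Pd := cond_pos d).
set (h := Rmin (d / 2) (Rmin (d1 / 2) (d3 / 2))).
assert (Hh : 0 < h /\ h < d /\ h < d1 /\ h < d3) by (unfold h, Rmin; repeat destruct Rle_dec; lra).
destruct (MVT_cor2 f df x (x + h)) as [c [E Hc]]; [lra| |].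
  intros c Hc. apply is_derive_Reals, H1'. rewrite Rabs_pos_eq; lra.
assert (H4 := H (c - x) ltac:(lra)). rewrite (Rabs_pos_eq (c - x)) in H4 by lra. specialize (H4 ltac:(lra)).
replace (x + (c - x)) with c in H4 by ring. rewrite E0, Rminus_0_r in H4. apply Rabs_def2 in H4.
assert (H5 : df c / (c - x) * (c - x) = df c) by (field; lra).
assert (H6 : 0 < df c) by nra.
assert (H7 := H3' (x + h)). replace (x + h - x) with h in H7 by ring. rewrite Rabs_pos_eq in H7 by lra.
specialize (H7 ltac:(lra)). nra.
Qed.

Lemma C2_slices (f : R -> R -> R) (x y : R) : C2_at f x y ->
  (ex_derive (fun z => f z y) x /\ ex_derive (fun z => Derive (fun t => f t y) z) x) /\
  (ex_derive (fun z => f x z) y /\ ex_derive (fun z => Derive (fun t => f x t) z) y).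
Proof. intros [_ [H1 [H2 [[_ [H3 _]] [_ [_ [H4 _]]]]]]]. split; split; assumption. Qed.

Lemma open_disc_locally (rho x y : R) : 0 < rho -> x ^ 2 + y ^ 2 < rho ^ 2 ->
  locally_2d (fun u v => u ^ 2 + v ^ 2 < rho ^ 2) x y.
Proof.
intros Hr H. apply norm2_lt in H; [|exact Hr].
destruct (norm2_cont x y (mkposreal (rho - norm2 x y) ltac:(lra))) as [d Hd].
exists d. intros u v Hu Hv. assert (H1 := Hd u v Hu Hv). simpl in H1. apply Rabs_def2 in H1.
apply norm2_lt; [exact Hr | lra].
Qed.

Lemma slice_comparison (f g : R -> R) (sigma s x : R) :
  locally x (fun t => ex_derive f t) -> locally x (fun t => ex_derive g t) ->
  ex_derive (Derive f) x -> ex_derive (Derive g) x ->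
  locally x (fun t => sigma * f t - s * g t <= sigma * f x - s * g x) ->
  sigma * Derive (Derive f) x - s * Derive (Derive g) x <= 0.
Proof.
intros Hf Hg Hf2 Hg2 Hmax.
apply (second_derivative_at_max (fun t => sigma * f t - s * g t)
  (fun t => sigma * Derive f t - s * Derive g t) x).
- generalize (filter_and _ _ Hf Hg). apply filter_imp. intros t [H1 H2].
  apply (is_derive_minus (fun t => sigma * f t) (fun t => s * g t)).
    apply is_derive_scal. now apply Derive_correct.
  apply is_derive_scal. now apply Derive_correct.
- apply (is_derive_minus (fun t => sigma * Derive f t) (fun t => s * Derive g t)).
    apply is_derive_scal. now apply Derive_correct.
  apply is_derive_scal. now apply Derive_correct.
- exact Hmax.
Qed.

(** The disc is parametrized by the distance to its center, so that its solutions can be composed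
    with the [r] of another profile. *)
Lemma disc_profile (rho : R) : 0 < rho -> pole_profile rho (fun x => x) (fun _ => 1) (fun _ => 1) (fun _ => 0).
Proof.
intros Hrho.
split; intros; first [lra | apply continuous_const | apply continuous_id
    | apply (is_derive_const (K := R_AbsRing) (V := R_NormedModule)) | apply (is_derive_id (K := R_AbsRing))].
Qed.

(* At a maximum of [sigma * f / G], with [G] radial and [- Lap G = mu' * G], the function
   [sigma * f - s * G] has a maximum with value [0] but Laplacian [(mu' - mu) * s * G]. *)
Lemma disc_solution_nonpos (rho mu mu' sigma : R) (J VJ : R -> R -> R) (f : R -> R -> R) :
  0 < rho -> radial_family rho (fun x => x) (fun _ => 1) J VJ ->
  mu < mu' -> (forall x, 0 <= x <= rho -> 0 < J mu' x) ->
  (forall x y, x ^ 2 + y ^ 2 < rho ^ 2 -> C2_at f x y) ->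
  continuous_on (closed_disc rho) (fun p : R * R => f (fst p) (snd p)) ->
  (forall x y, x ^ 2 + y ^ 2 = rho ^ 2 -> f x y = 0) ->
  (forall x y, x ^ 2 + y ^ 2 < rho ^ 2 ->
     - (partial_derive 2 0 f x y + partial_derive 0 2 f x y) = mu * f x y) ->
  forall x y, closed_disc rho (x, y) -> sigma * f x y <= 0.
Proof.
intros Hrho HJ Hmu HJpos HC2 Hc Hbd Heq x1 y1 H1.
assert (Hprof := disc_profile rho Hrho).
destruct (solution_regular rho _ _ _ _ J VJ mu' Hprof HJ) as [g [w2 [Hreg [Eg Eg0]]]].
(* On the flat disc [VJ = - t ^ 2 * g]. Differentiating both sides gives the radial equation off the
   center; at the center it follows from [w2 0 = g 0 = - mu' / 2]. *)
assert (HL : forall t, 0 <= t < rho -> w2 t + g t = - mu' * J mu' t).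
  intros t Ht. destruct (Req_dec t 0) as [->|Ht0].
    rewrite (reg_0 _ _ _ _ Hreg), Eg0, (fam_w_0 _ _ _ _ _ HJ). field.
  assert (D1 : is_derive (fun s => - (s ^ 2 * g s)) t (mu' * (t * 1 * J mu' t))).
    apply (is_derive_ext_loc (VJ mu')); [|apply (fam_V_derive _ _ _ _ _ HJ)].
    assert (Hd : 0 < Rmin t (rho - t)) by (apply Rmin_glb_lt; lra).
    exists (mkposreal _ Hd). intros s Hs.
    change (Rabs (s - t) < Rmin t (rho - t)) in Hs.
    assert (M1 := Rmin_l t (rho - t)). assert (M2 := Rmin_r t (rho - t)).
    apply Rabs_def2 in Hs. replace (s ^ 2 * g s) with (s * (s * g s)) by ring.
    rewrite Eg by lra. match goal with |- ?a = ?b => change (@eq R a b) end. field; lra.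
  assert (D2 : is_derive (fun s => - (s ^ 2 * g s)) t (- (2 * t * g t + t ^ 2 * ((w2 t - g t) / t)))).
    apply (is_derive_opp (fun s => s ^ 2 * g s)).
    apply (is_derive_mult (fun s => s ^ 2) g); [|apply (reg_g_derive _ _ _ _ Hreg); lra | intros; apply Rmult_comm].
    auto_derive; [easy|ring].
  assert (E := eq_trans (eq_sym (is_derive_unique _ _ _ D1)) (is_derive_unique _ _ _ D2)).
  apply (Rmult_eq_reg_l t); [|exact Ht0].
  transitivity (- (mu' * (t * 1 * J mu' t))); [rewrite E; field; exact Ht0 | ring].
set (G := fun x y => J mu' (norm2 x y)).
assert (GC2 : forall x y, x ^ 2 + y ^ 2 < rho ^ 2 -> C2_at G x y /\
  partial_derive 2 0 G x y + partial_derive 0 2 G x y = - mu' * G x y).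
  intros x y Hxy. apply norm2_lt in Hxy; [|exact Hrho].
  destruct (radial_C2 rho (J mu') g w2 Hrho Hreg x y Hxy) as [Ha Hb].
  split; [exact Ha|]. unfold G. rewrite Hb.
  apply HL. split; [apply norm2_nonneg | exact Hxy].
assert (Gpos : forall x y, closed_disc rho (x, y) -> 0 < G x y).
  intros x y Hxy. apply HJpos. split; [apply norm2_nonneg|].
  unfold closed_disc in Hxy; simpl fst in Hxy; simpl snd in Hxy. rewrite <- norm2_sqr in Hxy.
  assert (H2 := norm2_nonneg x y). nra.
assert (Gc : forall x y, continuity_2d_pt G x y).
  intros x y. apply continuity_2d_radial, (fam_w_cont _ _ _ _ _ HJ).
destruct (Rle_or_lt (sigma * f x1 y1) 0) as [|Hpos]; [easy|exfalso].
destruct (closed_disc_max rho (fun x y => sigma * f x y / G x y)) as [x0 [y0 [H0 Hmax]]].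
- lra.
- intros [x y] Hxy.
  apply (filterlim_comp_2 (G := locally (sigma * f x y)) (H := locally (/ G x y))
    (fun p : R * R => sigma * f (fst p) (snd p)) (fun p : R * R => / G (fst p) (snd p)) Rmult).
  + apply (filterlim_comp _ _ _ (fun p : R * R => f (fst p) (snd p)) (fun z => sigma * z) _ (locally (f x y))).
      exact (Hc (x, y) Hxy).
    apply (continuous_scal_r (U := R_UniformSpace) (V := R_NormedModule) sigma (fun z => z)), (continuous_id (U := R_UniformSpace)).
  + apply (filterlim_filter_le_1 (F := locally (x, y)) (G := within (closed_disc rho) (locally (x, y))) (H := locally (/ G x y))).
      apply filter_le_within.
    apply (continuity_2d_pt_filterlim (fun x y => / G x y)).
    apply continuity_2d_pt_inv; [apply Gc | assert (H2 := Gpos x y Hxy); lra].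
  + apply (filterlim_mult (K := R_AbsRing)).
- set (s := sigma * f x0 y0 / G x0 y0) in *.
  assert (G0 := Gpos x0 y0 H0). assert (G1 := Gpos x1 y1 H1).
  assert (Hs : 0 < s).
    apply Rlt_le_trans with (2 := Hmax x1 y1 H1). now apply Rdiv_lt_0_compat.
  assert (Es : sigma * f x0 y0 = s * G x0 y0) by (unfold s; field; lra).
  assert (Hin : x0 ^ 2 + y0 ^ 2 < rho ^ 2).
    destruct (Rle_lt_or_eq_dec _ _ H0) as [|Heq0]; [easy|]. simpl fst in Heq0; simpl snd in Heq0.
    exfalso. rewrite (Hbd x0 y0 Heq0) in Es. assert (0 < s * G x0 y0) by now apply Rmult_lt_0_compat. lra.
  assert (Hle : forall x y, x ^ 2 + y ^ 2 < rho ^ 2 -> sigma * f x y - s * G x y <= sigma * f x0 y0 - s * G x0 y0).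
    intros x y Hxy. assert (Hcd : closed_disc rho (x, y)) by (unfold closed_disc; simpl fst; simpl snd; lra).
    assert (H2 := Hmax x y Hcd). assert (H3 := Gpos x y Hcd).
    apply Rmult_le_compat_r with (r := G x y) in H2; [|lra].
    unfold Rdiv in H2; rewrite Rmult_assoc, Rinv_l in H2 by lra. lra.
  assert (Lx := locally_2d_1d_const_y _ _ _ (open_disc_locally rho x0 y0 Hrho Hin)).
  assert (Ly := locally_2d_1d_const_x _ _ _ (open_disc_locally rho x0 y0 Hrho Hin)).
  assert (Sf := C2_slices f x0 y0 (HC2 x0 y0 Hin)).
  assert (SG := C2_slices G x0 y0 (proj1 (GC2 x0 y0 Hin))).
  assert (Ix : sigma * partial_derive 2 0 f x0 y0 - s * partial_derive 2 0 G x0 y0 <= 0).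
    apply (slice_comparison (fun t => f t y0) (fun t => G t y0)); [| |exact (proj2 (proj1 Sf))|exact (proj2 (proj1 SG))|].
    + revert Lx; apply filter_imp. intros t Ht. exact (proj1 (proj1 (C2_slices f t y0 (HC2 t y0 Ht)))).
    + revert Lx; apply filter_imp. intros t Ht. exact (proj1 (proj1 (C2_slices G t y0 (proj1 (GC2 t y0 Ht))))).
    + revert Lx; apply filter_imp. intros t Ht. exact (Hle _ _ Ht).
  assert (Iy : sigma * partial_derive 0 2 f x0 y0 - s * partial_derive 0 2 G x0 y0 <= 0).
    apply (slice_comparison (fun t => f x0 t) (fun t => G x0 t)); [| |exact (proj2 (proj2 Sf))|exact (proj2 (proj2 SG))|].
    + revert Ly; apply filter_imp. intros t Ht. exact (proj1 (proj2 (C2_slices f x0 t (HC2 x0 t Ht)))).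
    + revert Ly; apply filter_imp. intros t Ht. exact (proj1 (proj2 (C2_slices G x0 t (proj1 (GC2 x0 t Ht))))).
    + revert Ly; apply filter_imp. intros t Ht. exact (Hle _ _ Ht).
  assert (E1 := Heq x0 y0 Hin). assert (E2 := proj2 (GC2 x0 y0 Hin)).
  assert (E3 : 0 < (mu' - mu) * (s * G x0 y0)) by (apply Rmult_lt_0_compat; [lra | now apply Rmult_lt_0_compat]).
  assert (E4 : sigma * (partial_derive 2 0 f x0 y0 + partial_derive 0 2 f x0 y0) = - mu * (s * G x0 y0)).
    rewrite <- Es. replace (partial_derive 2 0 f x0 y0 + partial_derive 0 2 f x0 y0) with (- (mu * f x0 y0)) by lra.
    ring.
  assert (E5 : s * (partial_derive 2 0 G x0 y0 + partial_derive 0 2 G x0 y0) = - mu' * (s * G x0 y0)).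
    rewrite E2; ring.
  rewrite Rmult_plus_distr_l in E4, E5. rewrite Rmult_minus_distr_r in E3. lra.
Qed.

Lemma disc_eigenvalue_zero (rho mu mu' : R) (J VJ : R -> R -> R) :
  0 < rho -> radial_family rho (fun x => x) (fun _ => 1) J VJ ->
  disc_dirichlet_eigenvalue rho mu -> mu < mu' -> exists x, 0 <= x <= rho /\ J mu' x <= 0.
Proof.
intros Hrho HJ [f [HC2 [Hc [Hbd [Heq [x [y [Hxy Hf]]]]]]]] Hmu.
apply NNPP; intros Hn.
assert (HJpos : forall x, 0 <= x <= rho -> 0 < J mu' x).
  intros t Ht. destruct (Rlt_or_le 0 (J mu' t)); [easy|]. exfalso; apply Hn; now exists t.
(* The two signs of [sigma] together force the eigenfunction to vanish. *)
assert (H1 := disc_solution_nonpos rho mu mu' 1 J VJ f Hrho HJ Hmu HJpos HC2 Hc Hbd Heq x y Hxy).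
assert (H2 := disc_solution_nonpos rho mu mu' (- 1) J VJ f Hrho HJ Hmu HJpos HC2 Hc Hbd Heq x y Hxy).
lra.
Qed.

(** * Axially symmetric functions on a component *)

Lemma partial1_eq (f : R -> R -> R) (t theta : R) : partial1 f t theta = Derive (fun s => f s theta) t.
Proof. reflexivity. Qed.

Lemma partial2_eq (f : R -> R -> R) (t theta : R) : partial2 f t theta = Derive (fun s => f t s) theta.
Proof. reflexivity. Qed.

Lemma immersion_metric (A : frame) (c : component) (t theta : R) :
  orthonormal A -> ex_derive (rad c) t -> ex_derive (hgt c) t ->
  g11 (immersion A c) t theta = Derive (rad c) t ^ 2 + Derive (hgt c) t ^ 2 /\
  g12 (immersion A c) t theta = 0 /\ g22 (immersion A c) t theta = rad c t ^ 2.
Proof.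
intros [H11 [H22 [H33 [H12 [H13 H23]]]]] Hr Hh.
assert (D1 : forall p : R3 -> R, Derive (fun s => p (origin A) + rad c s * cos theta * p (dir1 A)
    + rad c s * sin theta * p (dir2 A) + hgt c s * p (axis_dir A)) t
  = Derive (rad c) t * cos theta * p (dir1 A) + Derive (rad c) t * sin theta * p (dir2 A)
    + Derive (hgt c) t * p (axis_dir A)).
  intros p. apply is_derive_unique. auto_derive; [tauto|].
  change (Derive (fun x => rad c x) t) with (Derive (rad c) t).
  change (Derive (fun x => hgt c x) t) with (Derive (hgt c) t). ring.
assert (D2 : forall p : R3 -> R, Derive (fun s => p (origin A) + rad c t * cos s * p (dir1 A)
    + rad c t * sin s * p (dir2 A) + hgt c t * p (axis_dir A)) theta
  = - (rad c t * sin theta * p (dir1 A)) + rad c t * cos theta * p (dir2 A)).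
  intros p. apply is_derive_unique. auto_derive; [easy|]. ring.
assert (V1 : vpartial partial1 (immersion A c) t theta =
  let f (p : R3 -> R) := Derive (rad c) t * cos theta * p (dir1 A) + Derive (rad c) t * sin theta * p (dir2 A)
    + Derive (hgt c) t * p (axis_dir A) in (f pr1, f pr2, f pr3)).
  simpl; rewrite <- (D1 pr1), <- (D1 pr2), <- (D1 pr3). reflexivity.
assert (V2 : vpartial partial2 (immersion A c) t theta =
  let f (p : R3 -> R) := - (rad c t * sin theta * p (dir1 A)) + rad c t * cos theta * p (dir2 A) in
  (f pr1, f pr2, f pr3)).
  simpl; rewrite <- (D2 pr1), <- (D2 pr2), <- (D2 pr3). reflexivity.
unfold g11, g12, g22. rewrite V1, V2. unfold dot in *.
set (r' := Derive (rad c) t). set (h' := Derive (hgt c) t). set (r := rad c t).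
cbv [pr1 pr2 pr3 fst snd] in *.
destruct (origin A) as [[o1 o2] o3], (dir1 A) as [[a1 a2] a3], (dir2 A) as [[b1 b2] b3], (axis_dir A) as [[c1 c2] c3].
assert (Hcs : sin theta ^ 2 + cos theta ^ 2 = 1) by (rewrite <- (sin2_cos2 theta); unfold Rsqr; ring).
set (C := cos theta) in *. set (S := sin theta) in *.
split; [|split].
(* The terms are grouped by the inner products of the frame, so that orthonormality applies by
   rewriting. *)
- transitivity (r' ^ 2 * (C ^ 2 * (a1 * a1 + a2 * a2 + a3 * a3) + S ^ 2 * (b1 * b1 + b2 * b2 + b3 * b3)
    + 2 * C * S * (a1 * b1 + a2 * b2 + a3 * b3)) + h' ^ 2 * (c1 * c1 + c2 * c2 + c3 * c3)
    + 2 * r' * h' * (C * (a1 * c1 + a2 * c2 + a3 * c3) + S * (b1 * c1 + b2 * c2 + b3 * c3))); [ring|].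
  rewrite H11, H22, H33, H12, H13, H23. replace (C ^ 2) with (1 - S ^ 2) by lra. ring.
- transitivity (r' * r * ((C ^ 2 - S ^ 2) * (a1 * b1 + a2 * b2 + a3 * b3)
    + C * S * ((b1 * b1 + b2 * b2 + b3 * b3) - (a1 * a1 + a2 * a2 + a3 * a3)))
    + r * h' * (C * (b1 * c1 + b2 * c2 + b3 * c3) - S * (a1 * c1 + a2 * c2 + a3 * c3))); [ring|].
  rewrite H11, H22, H12, H13, H23. ring.
- transitivity (r ^ 2 * (S ^ 2 * (a1 * a1 + a2 * a2 + a3 * a3) + C ^ 2 * (b1 * b1 + b2 * b2 + b3 * b3)
    - 2 * C * S * (a1 * b1 + a2 * b2 + a3 * b3))); [ring|].
  rewrite H11, H22, H12. replace (C ^ 2) with (1 - S ^ 2) by lra. ring.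
Qed.

Definition speed (c : component) (t : R) : R := sqrt (Derive (rad c) t ^ 2 + Derive (hgt c) t ^ 2).

Lemma valid_derivable (c : component) (n : nat) (t : R) : valid_component c ->
  ex_derive (Derive_n (rad c) n) t /\ ex_derive (Derive_n (hgt c) n) t.
Proof. intros H. exact (profile_smooth _ H (S n) t). Qed.

(** The square root is kept: it equals [speed c a * rad c a] only where [rad c a >= 0], which is
    known on the domain alone, while the identity is stated for every [t]. *)
Lemma laplace_beltrami_axial (A : frame) (c : component) (phi : R -> R) (t theta : R) :
  orthonormal A -> valid_component c ->
  laplace_beltrami (immersion A c) (fun a _ => phi a) t theta =
  Derive (fun a => rad c a ^ 2 * Derive phi a / sqrt (speed c a ^ 2 * rad c a ^ 2)) t
  / sqrt (speed c t ^ 2 * rad c t ^ 2).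
Proof.
intros HA Hv.
assert (Hs : forall a, speed c a ^ 2 = Derive (rad c) a ^ 2 + Derive (hgt c) a ^ 2).
  intros a. unfold speed. rewrite <- Rsqr_pow2. apply Rsqr_sqrt, sum_sq_nonneg.
assert (HD : forall a b, area_density (immersion A c) a b = sqrt (speed c a ^ 2 * rad c a ^ 2)).
  intros a b. unfold area_density.
  destruct (immersion_metric A c a b HA) as [E1 [E2 E3]]; try apply (valid_derivable c 0 a Hv).
  rewrite E1, E2, E3, Hs. f_equal. ring.
assert (P2 : forall a b, partial2 (fun x _ => phi x) a b = 0).
  intros a b. rewrite partial2_eq. apply Derive_const.
unfold laplace_beltrami. rewrite HD. f_equal.
rewrite partial1_eq, partial2_eq.
rewrite (Derive_ext (fun s => _ / area_density (immersion A c) t s) (fun _ => 0)), Derive_const, Rplus_0_r.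
- apply Derive_ext. intros a. rewrite HD, P2, partial1_eq.
  destruct (immersion_metric A c a theta HA) as [E1 [E2 E3]]; try apply (valid_derivable c 0 a Hv).
  rewrite E2, E3. f_equal. change (Derive (fun s => phi s) a) with (Derive phi a). ring.
- intros b. rewrite P2.
  destruct (immersion_metric A c t b HA) as [E1 [E2 E3]]; try apply (valid_derivable c 0 t Hv).
  rewrite E2. unfold Rdiv; ring.
Qed.

Lemma C2_const (k x y : R) : C2_at (fun _ _ => k) x y.
Proof.
assert (D : forall z, is_derive (fun _ : R => k) z 0 /\ is_derive (fun _ : R => 0) z 0)
  by (intros z; split; apply (is_derive_const (K := R_AbsRing) (V := R_NormedModule))).
assert (C : forall x y z, continuity_2d_pt (fun _ _ => z) x y) by (intros; apply continuity_2d_pt_const).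
apply (C2_of_partials (fun _ _ => True) (fun _ _ => k) (fun _ _ => 0) (fun _ _ => 0)
  (fun _ _ => 0) (fun _ _ => 0) (fun _ _ => 0) (fun _ _ => 0)); [|intros u v _..|exact I].
- intros u v _. now apply locally_2d_forall.
- split; apply D.
- split; apply D.
- split; apply D.
- split; [apply C|split; apply C].
- split; apply C.
- split; apply C.
Qed.

(** Applied with [k = 0] to extend a solution by zero to other components, and with [k = 1],
    [lambda = 0] on a component without boundary. *)
Lemma constant_solution (A : frame) (c : component) (lambda k : R) :
  orthonormal A -> valid_component c -> lambda * k = 0 -> (k = 0 \/ forall t, ~ is_boundary c t) ->
  dirichlet_solution A c lambda (fun _ _ => k).
Proof.
intros HA Hv Hlk Hb. split; [easy|]. split; [|split; [|split; [|split]]].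
- intros t0 _. exists (fun _ _ => k), 1. split; [lra|]. split; [|easy].
  intros x y _. apply C2_const.
- intros t theta _. apply C2_const.
- intros p _. apply filterlim_const.
- intros t theta Ht. destruct Hb as [->|Hb]; [reflexivity | destruct (Hb t Ht)].
- intros t theta _. rewrite (laplace_beltrami_axial A c (fun _ => k) t theta HA Hv).
  rewrite (Derive_ext _ (fun _ => 0)), Derive_const, Hlk; [unfold Rdiv; ring|].
  intros a. rewrite Derive_const. unfold Rdiv; ring.
Qed.

(** Extension by zero. Functions are indexed by position, so a further copy of [c] in the list also
    receives zero. *)
Lemma eigenvalue_of_component (A : frame) (Sigma : surface) (c : component) (lambda : R) (u : R -> R -> R) :
  orthonormal A -> (forall c, In c Sigma -> valid_component c) -> In c Sigma ->
  dirichlet_solution A c lambda u -> (exists t theta, dom c t /\ u t theta <> 0) ->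
  dirichlet_eigenvalue A Sigma lambda.
Proof.
intros HA Hv Hc Hu [t [theta [Ht Hne]]].
destruct (In_nth_error _ _ Hc) as [i0 Hi0].
exists (fun i => if Nat.eq_dec i i0 then u else fun _ _ => 0). split.
- intros i c' Hi. destruct (Nat.eq_dec i i0) as [->|_].
    rewrite Hi0 in Hi; now injection Hi as <-.
  apply constant_solution; [exact HA | eapply Hv, nth_error_In, Hi | ring | now left].
- exists i0, c, t, theta. destruct (Nat.eq_dec i0 i0); [|easy]. now split.
Qed.

(* The pole is at [t0] and [sg = 1] or [-1], so that [t0 + sg * s] is at parameter
   distance [s] from it. *)
Definition one_pole (c : component) (t0 sg : R) : Prop :=
  (kind c = Arc Pole Boundary /\ t0 = 0 /\ sg = 1) \/ (kind c = Arc Boundary Pole /\ t0 = 1 /\ sg = -1).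

Section OnePole.

Variables (c : component) (t0 sg : R).
Hypothesis Hv : valid_component c.
Hypothesis Hone : one_pole c t0 sg.

Lemma one_pole_dom (t : R) : dom c t <-> 0 <= t <= 1.
Proof. unfold dom. now destruct Hone as [[-> _]|[-> _]]. Qed.

Lemma one_pole_inner (t : R) : inner c t <-> 0 < t < 1.
Proof. unfold inner. now destruct Hone as [[-> _]|[-> _]]. Qed.

Lemma one_pole_is_pole (t : R) : is_pole c t <-> t = t0.
Proof.
unfold is_pole, ends. destruct Hone as [[-> [-> _]]|[-> [-> _]]]; simpl; split.
- intros [H|[H|[]]]; congruence.
- intros ->; now left.
- intros [H|[H|[]]]; congruence.
- intros ->; right; now left.
Qed.

Lemma one_pole_is_boundary (t : R) : is_boundary c t <-> t = t0 + sg.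
Proof.
unfold is_boundary, ends. destruct Hone as [[-> [-> ->]]|[-> [-> ->]]]; simpl; split.
- intros [H|[H|[]]]; [congruence|]. injection H as <-. ring.
- intros ->; right; left. f_equal. ring.
- intros [H|[H|[]]]; [|congruence]. injection H as <-. ring.
- intros ->; left. f_equal. ring.
Qed.

Lemma one_pole_sg : sg * sg = 1.
Proof. destruct Hone as [[_ [_ ->]]|[_ [_ ->]]]; ring. Qed.

Lemma one_pole_abs (t : R) : 0 <= t <= 1 -> Rabs (t - t0) = sg * (t - t0).
Proof.
destruct Hone as [[_ [-> ->]]|[_ [-> ->]]]; intros Ht; [rewrite Rabs_pos_eq | rewrite Rabs_left1]; lra.
Qed.

Lemma one_pole_dist_inner (t : R) : 0 < t < 1 <-> 0 < sg * (t - t0) < 1.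
Proof. destruct Hone as [[_ [-> ->]]|[_ [-> ->]]]; lra. Qed.

Lemma one_pole_param (s : R) : 0 <= s <= 1 -> 0 <= t0 + sg * s <= 1.
Proof. destruct Hone as [[_ [-> ->]]|[_ [-> ->]]]; lra. Qed.

Definition pole_rad (s : R) : R := rad c (t0 + sg * s).
Definition pole_drad (s : R) : R := sg * Derive (rad c) (t0 + sg * s).
Definition pole_speed (s : R) : R := speed c (t0 + sg * s).
Definition pole_dspeed (s : R) : R :=
  sg * ((Derive (rad c) (t0 + sg * s) * Derive_n (rad c) 2 (t0 + sg * s)
   + Derive (hgt c) (t0 + sg * s) * Derive_n (hgt c) 2 (t0 + sg * s)) / speed c (t0 + sg * s)).

Lemma speed_pos (t : R) : dom c t -> 0 < speed c t.
Proof.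
intros Ht. apply norm2_pos. apply NNPP; intros Hn. apply (profile_regular _ Hv t Ht).
f_equal; apply NNPP; tauto.
Qed.

Lemma derive_affine (f : R -> R) (s d : R) :
  is_derive f (t0 + sg * s) d -> is_derive (fun s => f (t0 + sg * s)) s (sg * d).
Proof.
intros H. apply (is_derive_comp (K := R_AbsRing) (V := R_NormedModule) f (fun s => t0 + sg * s)); [exact H|].
auto_derive; [easy|ring].
Qed.

Lemma continuous_affine (f : R -> R) (s : R) :
  continuous f (t0 + sg * s) -> continuous (fun s => f (t0 + sg * s)) s.
Proof.
intros H. apply (continuous_comp (fun s => t0 + sg * s) f); [|exact H].
apply (ex_derive_continuous (K := R_AbsRing) (V := R_NormedModule)). now auto_derive.
Qed.

Lemma rad_n_continuous (n : nat) (t : R) : continuous (Derive_n (rad c) n) t /\ continuous (Derive_n (hgt c) n) t.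
Proof.
destruct (valid_derivable c n t Hv) as [D1 D2].
split; apply (ex_derive_continuous (K := R_AbsRing) (V := R_NormedModule)); [exact D1 | exact D2].
Qed.

Lemma speed_continuous (t : R) : continuous (speed c) t.
Proof.
destruct (rad_n_continuous 1 t) as [C1 C2].
apply (continuous_comp (fun t => Derive (rad c) t ^ 2 + Derive (hgt c) t ^ 2) sqrt); [|apply continuous_sqrt].
apply (continuous_plus (fun t => Derive (rad c) t ^ 2) (fun t => Derive (hgt c) t ^ 2)).
  apply (continuous_ext (fun t => Derive (rad c) t * Derive (rad c) t)); [intros; simpl; ring|].
  now apply (continuous_mult (Derive (rad c)) (Derive (rad c))).
apply (continuous_ext (fun t => Derive (hgt c) t * Derive (hgt c) t)); [intros; simpl; ring|].
now apply (continuous_mult (Derive (hgt c)) (Derive (hgt c))).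
Qed.

Lemma speed_derive (t : R) : dom c t ->
  is_derive (speed c) t ((Derive (rad c) t * Derive_n (rad c) 2 t + Derive (hgt c) t * Derive_n (hgt c) 2 t) / speed c t).
Proof.
intros Ht. assert (Hp := speed_pos t Ht).
destruct (valid_derivable c 1 t Hv) as [D1 D2].
assert (E : 0 < Derive (rad c) t ^ 2 + Derive (hgt c) t ^ 2).
  destruct (Rlt_or_le 0 (Derive (rad c) t ^ 2 + Derive (hgt c) t ^ 2)) as [|Hle]; [easy|].
  unfold speed in Hp. rewrite sqrt_neg_0 in Hp by exact Hle. lra.
evar_last.
  apply (is_derive_comp (K := R_AbsRing) (V := R_NormedModule) sqrt
    (fun t => Derive (rad c) t ^ 2 + Derive (hgt c) t ^ 2)).
    apply is_derive_Reals, derivable_pt_lim_sqrt, E.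
  apply (is_derive_plus (V := R_NormedModule) (fun t => Derive (rad c) t ^ 2) (fun t => Derive (hgt c) t ^ 2)).
    apply (is_derive_pow (Derive (rad c)) 2). apply Derive_correct; exact D1.
  apply (is_derive_pow (Derive (hgt c)) 2). apply Derive_correct; exact D2.
unfold scal, plus, speed in *; simpl; unfold mult; simpl.
change (Derive (fun x => Derive (fun x0 => rad c x0) x) t) with (Derive (Derive (rad c)) t).
change (Derive (fun x => Derive (fun x0 => hgt c x0) x) t) with (Derive (Derive (hgt c)) t).
field. simpl in Hp. lra.
Qed.

Lemma one_pole_profile : pole_profile 1 pole_rad pole_drad pole_speed pole_dspeed.
Proof.
assert (Hp0 : is_pole c t0) by now apply one_pole_is_pole.
assert (Dr : forall s, is_derive pole_rad s (pole_drad s)).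
  intros s. apply derive_affine, Derive_correct, (valid_derivable c 0 _ Hv).
assert (Hr0 : pole_rad 0 = 0).
  unfold pole_rad. rewrite Rmult_0_r, Rplus_0_r. apply (profile_pole _ Hv t0 Hp0 0).
assert (Hrp : forall s, 0 < s <= 1 -> 0 < pole_rad s).
  intros s Hs. apply (profile_off_axis _ Hv).
    apply one_pole_dom, one_pole_param; lra.
  intros H. apply one_pole_is_pole in H.
  assert (sg * s = 0) by lra. assert (H1 := one_pole_sg). nra.
split.
- lra.
- exact Hr0.
(* The height is even at the pole, so the speed there is the absolute value of the derivative of
   [rad]. Its sign is settled by [pole_rad], which is 0 at the pole and positive beyond it. *)
- assert (Hh : Derive (hgt c) t0 = 0) by apply (proj2 (profile_pole _ Hv t0 Hp0 0)).
  unfold pole_speed, pole_drad, speed. rewrite Rmult_0_r, Rplus_0_r, Hh.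
  replace (Derive (rad c) t0 ^ 2 + 0 ^ 2) with ((sg * Derive (rad c) t0) ^ 2)
    by (assert (H1 := one_pole_sg); transitivity (sg * sg * Derive (rad c) t0 ^ 2); [ring | rewrite H1; ring]).
  apply sqrt_pow2.
  destruct (Rle_or_lt 0 (sg * Derive (rad c) t0)) as [|Hneg]; [easy|exfalso].
  assert (D0 := Dr 0). unfold pole_drad in D0. rewrite Rmult_0_r, Rplus_0_r in D0.
  apply is_derive_Reals in D0. destruct (D0 (- (sg * Derive (rad c) t0)) ltac:(lra)) as [d H].
  assert (Pd := cond_pos d). set (h := Rmin 1 (d / 2)).
  assert (Hh' : 0 < h <= 1 /\ h < d) by (unfold h, Rmin; destruct Rle_dec; lra).
  assert (H1 := H h ltac:(lra)). rewrite (Rabs_pos_eq h) in H1 by lra. specialize (H1 ltac:(lra)).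
  rewrite Rplus_0_l, Hr0, Rminus_0_r in H1. apply Rabs_def2 in H1.
  assert (0 < pole_rad h / h) by (apply Rdiv_lt_0_compat; [apply Hrp|]; lra). lra.
- intros s. apply continuous_affine. exact (proj1 (rad_n_continuous 0 _)).
- intros s. apply continuous_affine, speed_continuous.
- intros s _. apply Dr.
- intros s Hs. apply derive_affine, speed_derive, one_pole_dom, one_pole_param, Hs.
- intros s _. apply (continuous_scal_r sg (fun s => Derive (rad c) (t0 + sg * s))).
  apply (continuous_affine (Derive (rad c))). exact (proj1 (rad_n_continuous 1 _)).
- intros s Hs. apply (continuous_scal_r sg (fun s =>
    (Derive (rad c) (t0 + sg * s) * Derive_n (rad c) 2 (t0 + sg * s)
   + Derive (hgt c) (t0 + sg * s) * Derive_n (hgt c) 2 (t0 + sg * s)) / speed c (t0 + sg * s))).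
  apply (continuous_affine (fun t => (Derive (rad c) t * Derive_n (rad c) 2 t
   + Derive (hgt c) t * Derive_n (hgt c) 2 t) / speed c t)).
  set (t := t0 + sg * s).
  apply (continuous_mult (fun t => Derive (rad c) t * Derive_n (rad c) 2 t
   + Derive (hgt c) t * Derive_n (hgt c) 2 t) (fun t => / speed c t)).
    apply (continuous_plus (fun t => Derive (rad c) t * Derive_n (rad c) 2 t)
      (fun t => Derive (hgt c) t * Derive_n (hgt c) 2 t)).
      apply (continuous_mult (Derive (rad c)) (Derive_n (rad c) 2)); [exact (proj1 (rad_n_continuous 1 _)) | exact (proj1 (rad_n_continuous 2 _))].
    apply (continuous_mult (Derive (hgt c)) (Derive_n (hgt c) 2)); [exact (proj2 (rad_n_continuous 1 _)) | exact (proj2 (rad_n_continuous 2 _))].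
  apply continuous_Rinv_comp; [apply speed_continuous|].
  assert (0 < speed c t); [|lra]. apply speed_pos, one_pole_dom, one_pole_param, Hs.
- intros s Hs. apply speed_pos, one_pole_dom, one_pole_param, Hs.
- intros s _. unfold pole_drad, pole_speed, speed.
  apply Rle_trans with (Rabs (sg * Derive (rad c) (t0 + sg * s))); [apply Rle_abs|].
  rewrite <- sqrt_Rsqr_abs. apply sqrt_le_1_alt. unfold Rsqr.
  assert (H1 := one_pole_sg). assert (H2 := pow2_ge_0 (Derive (hgt c) (t0 + sg * s))).
  replace (sg * Derive (rad c) (t0 + sg * s) * (sg * Derive (rad c) (t0 + sg * s)))
    with (sg * sg * Derive (rad c) (t0 + sg * s) ^ 2) by ring.
  rewrite H1. lra.
- exact Hrp.
Qed.

Lemma one_pole_solution (A : frame) (w V : R -> R -> R) (lam : R) :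
  orthonormal A -> radial_family 1 pole_rad pole_speed w V -> w lam 1 = 0 ->
  dirichlet_solution A c lam (fun t _ => w lam (Rabs (t - t0))).
Proof.
intros HA H Hw1.
destruct (solution_regular 1 _ _ _ _ w V lam one_pole_profile H) as [g [w2 [Hreg [Eg _]]]].
(* The absolute value is the polar radius of [regular_at_poles]. On the domain it equals the signed
   distance [s t], which is smooth and serves for differentiation. *)
set (phi := fun t => w lam (Rabs (t - t0))).
set (s := fun t => sg * (t - t0)).
assert (Hsg := one_pole_sg).
assert (Loc : forall t, 0 < t < 1 -> locally t (fun a => 0 < a < 1)).
  intros t Ht. assert (Hd : 0 < Rmin t (1 - t)) by (apply Rmin_glb_lt; lra).
  exists (mkposreal _ Hd). intros a Ha. change (Rabs (a - t) < Rmin t (1 - t)) in Ha.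
  assert (M1 := Rmin_l t (1 - t)). assert (M2 := Rmin_r t (1 - t)). apply Rabs_def2 in Ha. lra.
assert (Ds : forall (f : R -> R) t d, is_derive f (s t) d -> is_derive (fun a => f (s a)) t (sg * d)).
  intros f t d Hd.
  apply (is_derive_comp (K := R_AbsRing) (V := R_NormedModule) f s); [exact Hd|].
  unfold s; auto_derive; [easy|ring].
assert (Cs : forall (f : R -> R) t, continuous f (s t) -> continuous (fun a => f (s a)) t).
  intros f t Hf. apply (continuous_comp s f); [|exact Hf].
  apply (ex_derive_continuous (K := R_AbsRing) (V := R_NormedModule)). unfold s; now auto_derive.
assert (Dphi : forall t, 0 < t < 1 -> is_derive phi t (sg * (s t * g (s t)))).
  intros t Ht. apply (is_derive_ext_loc (fun a => w lam (s a))).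
    generalize (Loc t Ht). apply filter_imp. intros a Ha. unfold phi, s. rewrite one_pole_abs; [reflexivity|lra].
  apply Ds, (reg_w_derive _ _ _ _ Hreg). exact (proj1 (one_pole_dist_inner t) Ht).
assert (Cphi : forall t, continuous phi t).
  intros t. apply (continuous_comp (fun t => Rabs (t - t0)) (w lam)); [|apply (fam_w_cont _ _ _ _ _ H)].
  apply (continuous_comp (fun t => t - t0) Rabs); [|apply continuous_Rabs].
  apply (ex_derive_continuous (K := R_AbsRing) (V := R_NormedModule)). now auto_derive.
assert (C1 : forall (f : R -> R) t theta, continuous f t -> continuity_2d_pt (fun a _ => f a) t theta).
  intros f t theta Hf. apply (continuity_1d_2d_pt_comp f (fun a _ => a)); [|apply continuity_2d_pt_id1].
  now apply continuity_pt_filterlim.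
split; [|split; [|split; [|split; [|split]]]].
- intros t theta t' theta' _ _ Hsp. replace t' with t; [reflexivity|].
  unfold same_point in Hsp. destruct Hone as [[Hk _]|[Hk _]]; rewrite Hk in Hsp; now destruct Hsp.
- intros t1 Ht1. apply one_pole_is_pole in Ht1; subst t1.
  exists (fun x y => w lam (norm2 x y)), 1. split; [lra|]. split.
    intros x y Hxy. apply (radial_C2 1 (w lam) g w2); [lra | exact Hreg |].
    apply norm2_lt; lra.
  intros t theta _ _. rewrite norm2_polar; [reflexivity | apply Rabs_pos].
- intros t theta Ht. apply one_pole_inner in Ht.
  apply (C2_of_partials (fun t _ => 0 < t < 1) (fun t _ => phi t) (fun t _ => sg * (s t * g (s t))) (fun _ _ => 0)
    (fun t _ => w2 (s t)) (fun _ _ => 0) (fun _ _ => 0) (fun _ _ => 0)); [ | | | | | | | exact Ht].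
  + intros a b Ha. destruct (Loc a Ha) as [d Hd]. exists d. intros u v Hu _. now apply Hd.
  + intros a b Ha. split; [now apply Dphi | apply (is_derive_const (K := R_AbsRing) (V := R_NormedModule))].
  + intros a b Ha. split; [|apply (is_derive_const (K := R_AbsRing) (V := R_NormedModule))].
    assert (Hsa := proj1 (one_pole_dist_inner a) Ha). fold (s a) in Hsa.
    replace (w2 (s a)) with (sg * (sg * w2 (s a))) by (rewrite <- Rmult_assoc, Hsg; ring).
    apply is_derive_scal. apply (Ds (fun x => x * g x)). evar_last.
      apply (is_derive_mult (fun x => x) g); [apply (is_derive_id (K := R_AbsRing)) | now apply (reg_g_derive _ _ _ _ Hreg) | intros; apply Rmult_comm].
    unfold plus, mult, one; simpl. field; lra.
  + intros a b Ha. split; apply (is_derive_const (K := R_AbsRing) (V := R_NormedModule)).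
  + intros a b Ha. assert (Hsa := proj1 (one_pole_dist_inner a) Ha). fold (s a) in Hsa.
    split; [apply C1, Cphi|]. split; [|apply continuity_2d_pt_const].
    apply (C1 (fun a => sg * (s a * g (s a)))). apply (continuous_scal_r sg (fun a => s a * g (s a))).
    apply (Cs (fun x => x * g x)). apply (continuous_mult (fun x => x) g); [apply continuous_id|].
    apply (reg_g_cont _ _ _ _ Hreg); lra.
  + intros a b Ha. assert (Hsa := proj1 (one_pole_dist_inner a) Ha). fold (s a) in Hsa.
    split; [|apply continuity_2d_pt_const].
    apply (C1 (fun a => w2 (s a))), (Cs w2), (reg_w2_cont _ _ _ _ Hreg). lra.
  + intros a b Ha. split; apply continuity_2d_pt_const.
- apply (continuous_on_eps (fun p => dom c (fst p)) (fun t _ => phi t)). intros t theta _ eps Heps.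
  destruct (proj1 (continuous_eps phi t) (Cphi t) eps Heps) as [d [Hd H1]].
  exists (mkposreal d Hd). intros u v _ Hu _. now apply H1.
- intros t theta Ht. apply one_pole_is_boundary in Ht. subst t.
  replace (t0 + sg - t0) with sg by ring.
  replace (Rabs sg) with 1; [exact Hw1|].
  destruct Hone as [[_ [_ ->]]|[_ [_ ->]]]; [rewrite Rabs_R1 | rewrite Rabs_left by lra]; lra.
- intros t theta Ht. apply one_pole_inner in Ht.
  change (- laplace_beltrami (immersion A c) (fun a _ => phi a) t theta = lam * phi t).
  rewrite (laplace_beltrami_axial A c phi t theta HA Hv).
  assert (Hst : forall a, t0 + sg * s a = a).
    intros a. unfold s. rewrite <- Rmult_assoc, Hsg. ring.
  assert (Hpos : forall a, 0 < a < 1 -> 0 < speed c a /\ 0 < rad c a).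
    intros a Ha. split; [apply speed_pos, one_pole_dom; lra|].
    rewrite <- (Hst a). apply (prof_r_pos _ _ _ _ _ one_pole_profile).
    assert (Hsa := proj1 (one_pole_dist_inner a) Ha). fold (s a) in Hsa. lra.
  assert (Harea : forall a, 0 < a < 1 -> sqrt (speed c a ^ 2 * rad c a ^ 2) = speed c a * rad c a).
    intros a Ha. destruct (Hpos a Ha) as [P1 P2]. rewrite <- Rpow_mult_distr. apply sqrt_pow2. nra.
  destruct (Hpos t Ht) as [P1 P2].
  (* Near [t] the quantity under the outer derivative is the flux [(rad / speed) * phi'], which
     equals [- sg * V lam (s a)]. The chain rule brings a second factor [sg], and [sg * sg = 1]. *)
  rewrite (Derive_ext_loc _ (fun a => - sg * V lam (s a))).
  + rewrite (is_derive_unique _ t (- (lam * (rad c t * speed c t * phi t)))).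
      rewrite Harea by exact Ht. field. lra.
    evar_last.
      apply (is_derive_scal (fun a => V lam (s a)) t (- sg)). apply Ds, (fam_V_derive _ _ _ _ _ H).
    unfold pole_rad, pole_speed. rewrite Hst.
    replace (w lam (s t)) with (phi t) by (unfold phi, s; rewrite one_pole_abs; [reflexivity|lra]).
    simpl. transitivity (- (sg * sg) * (lam * (rad c t * speed c t * phi t))); [ring | rewrite Hsg; ring].
  + generalize (Loc t Ht). apply filter_imp. intros a Ha. destruct (Hpos a Ha) as [Q1 Q2].
    rewrite Harea by exact Ha. rewrite (is_derive_unique _ _ _ (Dphi a Ha)).
    rewrite Eg by exact (proj1 (one_pole_dist_inner a) Ha).
    unfold pole_rad, pole_speed. rewrite Hst. field. lra.
Qed.

End OnePole.

(** * The annulus is not a disc *)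

(** The coefficients are arbitrary because affine functions are closed under both partial
    derivatives, which lets the induction on the order go through; likewise for the combinations of
    [cos] and [sin] below. *)
Lemma smooth_affine (a b d x y : R) : smooth_at (fun x y => a + b * x + d * y) x y.
Proof.
intros n; revert a b d x y; induction n as [|n IH]; intros a b d x y;
  (split; [apply continuity_2d_pt_plus; [apply continuity_2d_pt_plus|];
    [apply continuity_2d_pt_const
    | apply continuity_2d_pt_mult; [apply continuity_2d_pt_const | apply continuity_2d_pt_id1]
    | apply continuity_2d_pt_mult; [apply continuity_2d_pt_const | apply continuity_2d_pt_id2]] |]).
  exact I.
split; [now auto_derive|]. split; [now auto_derive|]. split.
- apply (ex_diff_n_ext_loc (fun x y => b + 0 * x + 0 * y)); [|apply IH].
  apply locally_2d_forall. intros u v. symmetry. apply is_derive_unique. auto_derive; [easy|ring].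
- apply (ex_diff_n_ext_loc (fun x y => d + 0 * x + 0 * y)); [|apply IH].
  apply locally_2d_forall. intros u v. symmetry. apply is_derive_unique. auto_derive; [easy|ring].
Qed.

Lemma smooth_trig (a b x y : R) : smooth_at (fun _ y => a * cos y + b * sin y) x y.
Proof.
assert (C : forall a b z, continuous (fun y => a * cos y + b * sin y) z).
  intros a' b' z. apply (ex_derive_continuous (K := R_AbsRing) (V := R_NormedModule)). now auto_derive.
assert (C' : forall a b x y, continuity_2d_pt (fun _ y => a * cos y + b * sin y) x y).
  intros a' b' u v. apply (continuity_1d_2d_pt_comp (fun y => a' * cos y + b' * sin y) (fun _ y => y)).
    apply continuity_pt_filterlim, C.
  apply continuity_2d_pt_id2.
intros n; revert a b x y; induction n as [|n IH]; intros a b x y; (split; [apply C'|]).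
  exact I.
split; [now auto_derive|]. split; [now auto_derive|]. split.
- apply (ex_diff_n_ext_loc (fun _ y => 0 * cos y + 0 * sin y)); [|apply IH].
  apply locally_2d_forall. intros u v. rewrite Derive_const. ring.
- apply (ex_diff_n_ext_loc (fun _ y => b * cos y + (- a) * sin y)); [|apply IH].
  apply locally_2d_forall. intros u v. symmetry. apply is_derive_unique. auto_derive; [easy|ring].
Qed.

Lemma trig_period_Z (x : R) (k : Z) : cos (x + 2 * PI * IZR k) = cos x /\ sin (x + 2 * PI * IZR k) = sin x.
Proof.
destruct (Z_le_gt_dec 0 k) as [Hk|Hk].
- replace (x + 2 * PI * IZR k) with (x + 2 * INR (Z.to_nat k) * PI).
    split; [apply cos_period | apply sin_period].
  rewrite INR_IZR_INZ, Znat.Z2Nat.id by exact Hk. ring.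
- rewrite <- (cos_period (x + 2 * PI * IZR k) (Z.to_nat (- k))), <- (sin_period (x + 2 * PI * IZR k) (Z.to_nat (- k))).
  replace (x + 2 * PI * IZR k + 2 * INR (Z.to_nat (- k)) * PI) with x; [easy|].
  rewrite INR_IZR_INZ, Znat.Z2Nat.id, opp_IZR by lia. ring.
Qed.

Lemma unit_vector_angle (a b : R) : a ^ 2 + b ^ 2 = 1 -> exists phi, cos phi = a /\ sin phi = b.
Proof.
intros H. assert (Ha : -1 <= a <= 1) by nra.
assert (Hs : sqrt (1 - Rsqr a) = Rabs b).
  rewrite <- sqrt_Rsqr_abs. f_equal. unfold Rsqr. lra.
destruct (Rle_or_lt 0 b) as [Hb|Hb].
- exists (acos a). rewrite cos_acos by exact Ha. rewrite sin_acos by exact Ha.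
  split; [reflexivity|]. rewrite Hs. now apply Rabs_pos_eq.
- exists (- acos a). rewrite cos_neg, sin_neg, cos_acos, sin_acos by exact Ha.
  split; [reflexivity|]. rewrite Hs, Rabs_left by exact Hb. ring.
Qed.

Lemma trig_atan_ratio (s d : R) : 0 < d -> s ^ 2 + d ^ 2 = 1 -> cos (atan (s / d)) = d /\ sin (atan (s / d)) = s.
Proof.
intros Hd H. rewrite cos_atan, sin_atan.
replace (sqrt (1 + (s / d)²)) with (/ d).
  split; field; lra.
replace (1 + (s / d)²) with ((/ d)²).
  rewrite sqrt_Rsqr; [reflexivity | left; now apply Rinv_0_lt_compat].
unfold Rsqr. apply (Rmult_eq_reg_r (d ^ 2)); [|apply pow_nonzero; lra].
transitivity (s ^ 2 + d ^ 2); [rewrite H|]; field; lra.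
Qed.

(* The loop is contracted to the center in [N] steps so small that each of them turns
   the unit vector [(F, G)] by an angle that [atan] recovers continuously. *)
Lemma periodic_lift (F G : R -> R -> R) (cx cy : R -> R) :
  (forall x y, continuity_2d_pt F x y) -> (forall x y, continuity_2d_pt G x y) ->
  (forall x y, closed_disc 1 (x, y) -> F x y ^ 2 + G x y ^ 2 = 1) ->
  (forall s, continuous cx s) -> (forall s, continuous cy s) ->
  (forall s, closed_disc 1 (cx s, cy s)) ->
  (forall s, cx (s + 2 * PI) = cx s /\ cy (s + 2 * PI) = cy s) ->
  exists alpha : R -> R, (forall s, continuous alpha s) /\ (forall s, alpha (s + 2 * PI) = alpha s) /\
    forall s, cos (alpha s) = F (cx s) (cy s) /\ sin (alpha s) = G (cx s) (cy s).
Proof.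
intros HF HG Hunit Hcx Hcy Hin Hper.
(* If both coordinates move by less than 1/2, the inner product of the old and the new unit vector,
   [1] minus half the squared distance, stays positive. *)
destruct (uniform_continuity_2d F (-1) 1 (-1) 1 (fun x y _ _ => HF x y) (mkposreal (1 / 2) ltac:(lra))) as [d1 H1].
destruct (uniform_continuity_2d G (-1) 1 (-1) 1 (fun x y _ _ => HG x y) (mkposreal (1 / 2) ltac:(lra))) as [d2 H2].
simpl in H1, H2.
set (d := Rmin d1 d2).
assert (Hd : 0 < d) by (apply Rmin_glb_lt; apply cond_pos).
assert (Hd1 : d <= d1) by apply Rmin_l. assert (Hd2 : d <= d2) by apply Rmin_r.
destruct (archimed_cor1 d Hd) as [N [HN HN0]].
assert (HNp : 0 < INR N) by now apply lt_0_INR.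
(* Stage [k] is the loop scaled by [k / N]: a constant loop with a constant angle at stage 0, the
   given loop at stage [N]. Consecutive stages differ by less than [d] since [/ N < d]. *)
set (q := fun k : nat => INR k / INR N).
assert (Hq : forall k, (k <= N)%nat -> 0 <= q k <= 1).
  intros k Hk. apply le_INR in Hk. assert (0 <= INR k) by apply pos_INR. unfold q. split.
    apply Rmult_le_pos; [lra | left; now apply Rinv_0_lt_compat].
  apply Rmult_le_reg_r with (INR N); [exact HNp|]. unfold Rdiv; rewrite Rmult_assoc, Rinv_l; lra.
assert (Hcoord : forall s, -1 <= cx s <= 1 /\ -1 <= cy s <= 1).
  intros s. apply (closed_disc_coord 1 _ _ ltac:(lra) (Hin s)).
assert (Hscale : forall k s, (k <= N)%nat -> closed_disc 1 (q k * cx s, q k * cy s)).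
  intros k s Hk. assert (Hs := Hin s). unfold closed_disc in *; simpl fst in *; simpl snd in *.
  assert (Hqk := Hq k Hk). replace ((q k * cx s) ^ 2 + (q k * cy s) ^ 2) with (q k ^ 2 * (cx s ^ 2 + cy s ^ 2)) by ring.
  assert (0 <= q k ^ 2 <= 1) by nra. assert (P := sum_sq_nonneg (cx s) (cy s)). nra.
assert (Hcomp : forall (K : R -> R -> R) k s, (forall x y, continuity_2d_pt K x y) ->
    continuous (fun s => K (q k * cx s) (q k * cy s)) s).
  intros K k s HK.
  apply (continuous_comp_2 (fun s => q k * cx s) (fun s => q k * cy s) K).
    apply (continuous_scal_r (q k) cx), Hcx.
    apply (continuous_scal_r (q k) cy), Hcy.
  apply (continuity_2d_pt_filterlim K), HK.
assert (Hind : forall k, (k <= N)%nat -> exists alpha : R -> R,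
    (forall s, continuous alpha s) /\ (forall s, alpha (s + 2 * PI) = alpha s) /\
    forall s, cos (alpha s) = F (q k * cx s) (q k * cy s) /\ sin (alpha s) = G (q k * cx s) (q k * cy s)).
{ induction k as [|k IH]; intros Hk.
  - destruct (unit_vector_angle (F 0 0) (G 0 0)) as [phi [E1 E2]].
      apply Hunit. unfold closed_disc; simpl; lra.
    exists (fun _ => phi). split; [intros s; apply continuous_const|]. split; [easy|].
    intros s. replace (q 0%nat) with 0 by (unfold q; simpl; field; lra). now rewrite !Rmult_0_l.
  - destruct IH as [al [Ca [Pa Ea]]]; [lia|].
    set (a := fun s => F (q k * cx s) (q k * cy s)). set (b := fun s => G (q k * cx s) (q k * cy s)).
    set (a' := fun s => F (q (S k) * cx s) (q (S k) * cy s)). set (b' := fun s => G (q (S k) * cx s) (q (S k) * cy s)).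
    (* [dt] and [cr] are the cosine and the sine of the angle from the old vector to the new one. *)
    set (dt := fun s => a s * a' s + b s * b' s). set (cr := fun s => a s * b' s - b s * a' s).
    assert (U : forall s, a s ^ 2 + b s ^ 2 = 1) by (intros s; apply Hunit, Hscale; lia).
    assert (U' : forall s, a' s ^ 2 + b' s ^ 2 = 1) by (intros s; apply Hunit, Hscale; lia).
    assert (Hclose : forall z, -1 <= z <= 1 -> Rabs (q (S k) * z - q k * z) < d).
      intros z Hz. replace (q (S k) * z - q k * z) with (/ INR N * z) by (unfold q; rewrite S_INR; field; lra).
      rewrite Rabs_mult, Rabs_pos_eq by (left; now apply Rinv_0_lt_compat).
      assert (Rabs z <= 1) by (apply Rabs_le; lra).
      assert (0 < / INR N) by now apply Rinv_0_lt_compat. assert (0 <= Rabs z) by apply Rabs_pos. nra.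
    assert (Hbox : forall j z, (j <= N)%nat -> -1 <= z <= 1 -> -1 <= q j * z <= 1).
      intros j z Hj Hz. assert (Hqj := Hq j Hj). nra.
    assert (Hdt : forall s, 0 < dt s).
      intros s. destruct (Hcoord s) as [Hx Hy].
      assert (A1 : Rabs (a' s - a s) < 1 / 2).
        apply H1; try (apply Hbox; [lia|assumption]); (eapply Rlt_le_trans; [apply Hclose; assumption | lra]).
      assert (A2 : Rabs (b' s - b s) < 1 / 2).
        apply H2; try (apply Hbox; [lia|assumption]); (eapply Rlt_le_trans; [apply Hclose; assumption | lra]).
      apply Rabs_def2 in A1. apply Rabs_def2 in A2.
      assert (B1 : (a' s - a s) ^ 2 < 1 / 2) by nra. assert (B2 : (b' s - b s) ^ 2 < 1 / 2) by nra.
      assert (E1 := U s). assert (E2 := U' s). unfold dt. nra.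
    assert (Hcd : forall s, cr s ^ 2 + dt s ^ 2 = 1).
      intros s. transitivity ((a s ^ 2 + b s ^ 2) * (a' s ^ 2 + b' s ^ 2)); [unfold cr, dt; ring | rewrite U, U'; ring].
    assert (C1 : forall s, continuous a s) by (intros s; now apply Hcomp).
    assert (C2 : forall s, continuous b s) by (intros s; now apply Hcomp).
    assert (C3 : forall s, continuous a' s) by (intros s; now apply Hcomp).
    assert (C4 : forall s, continuous b' s) by (intros s; now apply Hcomp).
    exists (fun s => al s + atan (cr s / dt s)). split; [|split].
    + intros s. apply (continuous_plus al); [apply Ca|].
      apply (continuous_comp (fun s => cr s / dt s) atan).
        apply (continuous_mult cr (fun s => / dt s)).
          apply (continuous_minus (fun s => a s * b' s) (fun s => b s * a' s)).
            now apply (continuous_mult a b').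
          now apply (continuous_mult b a').
        apply continuous_Rinv_comp; [|assert (H := Hdt s); lra].
        apply (continuous_plus (fun s => a s * a' s) (fun s => b s * b' s)).
          now apply (continuous_mult a a').
        now apply (continuous_mult b b').
      apply continuity_pt_filterlim, derivable_continuous_pt, derivable_pt_atan.
    (* The increment depends only on the point of the loop, so the new angle inherits
       periodicity. *)
    + intros s. rewrite Pa. unfold cr, dt, a, b, a', b'.
      destruct (Hper s) as [-> ->]. reflexivity.
    + intros s. destruct (trig_atan_ratio (cr s) (dt s) (Hdt s) (Hcd s)) as [T1 T2].
      destruct (Ea s) as [E1 E2]. fold (a s) in E1. fold (b s) in E2.
      rewrite cos_plus, sin_plus, T1, T2, E1, E2. fold (a' s) (b' s). unfold cr, dt.
      split; [transitivity (a' s * (a s ^ 2 + b s ^ 2)) | transitivity (b' s * (a s ^ 2 + b s ^ 2))];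
        try ring; rewrite U; ring. }
destruct (Hind N (le_n N)) as [al [Ca [Pa Ea]]]. exists al. split; [exact Ca|]. split; [exact Pa|].
intros s. assert (E := Ea s). replace (q N) with 1 in E by (unfold q; field; lra).
now rewrite !Rmult_1_l in E.
Qed.

(** [alpha s - s] always has cosine 1, yet it drops by [2 * PI] over a period. In between it takes
    the value [D 0 - PI], whose cosine is -1. *)
Lemma no_periodic_angle (alpha : R -> R) :
  (forall s, continuous alpha s) -> (forall s, alpha (s + 2 * PI) = alpha s) ->
  (forall s, cos (alpha s) = cos s /\ sin (alpha s) = sin s) -> False.
Proof.
intros Hc Hp H. assert (HPI := PI_RGT_0).
set (D := fun s => alpha s - s).
assert (CD : continuity D).
  intros s. apply continuity_pt_filterlim.
  apply (continuous_minus alpha (fun s => s)); [apply Hc | apply continuous_id].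
assert (E : D (2 * PI) = D 0 - 2 * PI).
  unfold D. rewrite <- (Rplus_0_l (2 * PI)) at 1. rewrite Hp. ring.
assert (H1 : forall s, cos (D s) = 1).
  intros s. unfold D. rewrite cos_minus. destruct (H s) as [-> ->].
  rewrite <- (sin2_cos2 s). unfold Rsqr. ring.
destruct (IVT_gen D 0 (2 * PI) (D 0 - PI) CD) as [x [_ Hx]].
  rewrite E, Rmin_right, Rmax_left; lra.
assert (H2 := H1 x). rewrite Hx, cos_minus, cos_PI, sin_PI, (H1 0) in H2. lra.
Qed.

(* The pull-backs of [cos theta] and [sin theta] to the disc would give the loops around the
   annulus a continuous angle. *)
Lemma annulus_not_disc (c : component) : kind c = Arc Boundary Boundary -> ~ diffeomorphic_to_disc c.
Proof.
intros Hk [Phi [Hin [Hsurj [Hinj Hsm]]]].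
assert (Hdom : forall t, dom c t <-> 0 <= t <= 1) by (intros t; unfold dom; now rewrite Hk).
assert (Hpole : forall t, ~ is_pole c t).
  intros t. unfold is_pole, ends. rewrite Hk. intros [H|[H|[]]]; congruence.
assert (Hsp : forall t theta t' theta', same_point c t theta t' theta' <->
    t' = t /\ exists k, theta' = theta + 2 * PI * IZR k).
  intros t theta t' theta'. unfold same_point. rewrite Hk. split.
    intros [H1 [H2|H2]]; [destruct (Hpole t H2) | split; assumption].
  intros [H1 H2]. split; [exact H1 | now right].
assert (Hreg : forall reg u, regular_at_poles reg c u) by (intros reg u t0 Ht0; destruct (Hpole t0 Ht0)).
(* [inv] chooses parameters of the preimage. Its angle is arbitrary up to multiples of [2 * PI],
   which [cos] and [sin] do not see. *)
destruct (functional_choice (fun p z : R * R => closed_disc 1 p -> dom c (fst z) /\ Phi (fst z) (snd z) = p))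
  as [inv Hinv].
  intros p. destruct (classic (closed_disc 1 p)) as [Hp|Hp].
    destruct (Hsurj p Hp) as [t [theta Ht]]. now exists (t, theta).
  now exists (0, 0).
assert (Hang : forall t theta, dom c t ->
    cos (snd (inv (Phi t theta))) = cos theta /\ sin (snd (inv (Phi t theta))) = sin theta).
  intros t theta Ht. destruct (Hinv (Phi t theta) (Hin t theta Ht)) as [H1 H2].
  apply Hinj in H2; [|exact H1|exact Ht]. apply Hsp in H2. destruct H2 as [_ [k Hk']].
  destruct (trig_period_Z (snd (inv (Phi t theta))) k) as [E1 E2]. rewrite <- Hk' in E1, E2.
  split; symmetry; assumption.
(* Functions smooth on the annulus are smooth on the disc, so [cos theta] and [sin theta] become
   functions continuous on the whole plane. *)
assert (Hpull : forall h : R -> R, (h = cos \/ h = sin) -> exists K : R -> R -> R,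
    (forall x y, continuity_2d_pt K x y) /\
    forall x y, closed_disc 1 (x, y) -> K x y = h (snd (inv (x, y)))).
{ intros h Hh.
  assert (Hs : smooth_on_closed_disc 1 (fun x y => h (snd (inv (x, y))))).
  { apply Hsm. split; [|split; [apply Hreg|]].
    - intros t theta t' theta' Ht Ht' H. apply (Hinj t theta t' theta' Ht Ht') in H. now rewrite H.
    - exists (fun _ theta => h theta). split.
        intros t theta n. destruct Hh as [->| ->].
          apply (ex_diff_n_ext_loc (fun _ y => 1 * cos y + 0 * sin y)); [|apply smooth_trig].
          apply locally_2d_forall; intros; ring.
        apply (ex_diff_n_ext_loc (fun _ y => 0 * cos y + 1 * sin y)); [|apply smooth_trig].
        apply locally_2d_forall; intros; ring.
      intros t theta Ht. rewrite <- surjective_pairing. destruct (Hang t theta Ht) as [E1 E2].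
      now destruct Hh as [->| ->]. }
  destruct Hs as [K [HK EK]]. exists K. split; [|exact EK].
  intros x y. exact (proj1 (HK x y 0%nat)). }
(* Conversely, the coordinates of the disc are smooth on the annulus, so the middle circle
   [t = 1 / 2] maps to a continuous loop. *)
assert (Hcoord : forall a b, exists u : R -> R, (forall s, continuous u s) /\
    forall theta, u theta = 0 + a * fst (Phi (1 / 2) theta) + b * snd (Phi (1 / 2) theta)).
{ intros a b.
  assert (Hs : smooth_on_closed_disc 1 (fun x y => 0 + a * x + b * y)).
    exists (fun x y => 0 + a * x + b * y). split; [|easy]. intros x y; apply smooth_affine.
  apply Hsm in Hs. destruct Hs as [_ [_ [v [Hv Ev]]]]. exists (fun theta => v (1 / 2) theta). split.
    intros s. apply (continuity_2d_line (fun x y => v y x)), (continuity_2d_pt_swap v). exact (proj1 (Hv (1 / 2) s 0%nat)).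
  intros theta. rewrite Ev; [reflexivity | apply Hdom; lra]. }
destruct (Hpull cos (or_introl eq_refl)) as [F [HF EF]].
destruct (Hpull sin (or_intror eq_refl)) as [G [HG EG]].
destruct (Hcoord 1 0) as [cx [Hcx Ecx]]. destruct (Hcoord 0 1) as [cy [Hcy Ecy]].
assert (Hhalf : dom c (1 / 2)) by (apply Hdom; lra).
assert (Ec : forall s, (cx s, cy s) = Phi (1 / 2) s).
  intros s. rewrite Ecx, Ecy, (surjective_pairing (Phi (1 / 2) s)); simpl. f_equal; ring.
destruct (periodic_lift F G cx cy HF HG) as [al [Ca [Pa Ea]]].
- intros x y Hxy. rewrite EF, EG by exact Hxy. rewrite <- (sin2_cos2 (snd (inv (x, y)))). unfold Rsqr; ring.
- exact Hcx.
- exact Hcy.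
- intros s. rewrite Ec. now apply Hin.
- intros s. assert (E : Phi (1 / 2) (s + 2 * PI) = Phi (1 / 2) s).
    apply Hinj; [exact Hhalf | exact Hhalf |]. apply Hsp. split; [reflexivity|]. exists (-1)%Z. ring.
  rewrite !Ecx, !Ecy, E. now split.
- apply (no_periodic_angle al Ca Pa). intros s. destruct (Ea s) as [-> ->].
  assert (Hcd : closed_disc 1 (cx s, cy s)) by (rewrite Ec; now apply Hin).
  rewrite EF, EG, Ec by exact Hcd. now apply Hang.
Qed.

(** * Comparison of the eigenvalues *)

Lemma flat_map_length_in (X Y : Type) (f : X -> list Y) (x : X) (s : list X) :
  In x s -> (length (f x) <= length (flat_map f s))%nat.
Proof.
induction s as [|y s IH]; simpl; [easy|]. rewrite length_app. intros [->|H]; [lia|].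
specialize (IH H). lia.
Qed.

(* Two boundary circles are not enough for a component with one circle and another with two. *)
Lemma one_pole_component (P Q K : circle) (Sigma : surface) (c : component) :
  in_S P Q Sigma -> In c Sigma -> length (component_boundary c) = 1%nat -> K = P \/ K = Q ->
  exists c1 t0 sg, In c1 Sigma /\ one_pole c1 t0 sg /\ rad c1 (t0 + sg * 1) = radius K.
Proof.
intros [Hv HS] Hc Hlen HK.
assert (HKin : In K (flat_map component_boundary Sigma)).
  apply (Permutation_in _ (Permutation_sym HS)). destruct HK as [->| ->]; simpl; tauto.
apply in_flat_map in HKin. destruct HKin as [c1 [Hc1 HK1]]. exists c1.
assert (Htot := Permutation_length HS). simpl in Htot.
unfold component_boundary, ends in HK1.
destruct (kind c1) as [[|] [|]|] eqn:Hk; simpl in HK1.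
- easy.
- exists 0, 1. split; [exact Hc1|]. split; [now left|].
  destruct HK1 as [<-|[]]. simpl. f_equal; ring.
- exists 1, (-1). split; [exact Hc1|]. split; [now right|].
  destruct HK1 as [<-|[]]. simpl. f_equal; ring.
- exfalso.
  assert (Hlen1 : length (component_boundary c1) = 2%nat) by (unfold component_boundary, ends; now rewrite Hk).
  destruct (in_split _ _ Hc1) as [l1 [l2 E]]. rewrite E in Htot, Hc.
  rewrite flat_map_app, length_app in Htot. simpl in Htot. rewrite length_app in Htot.
  apply in_app_or in Hc. destruct Hc as [Hc|[Hc|Hc]].
  + apply (flat_map_length_in _ _ component_boundary) in Hc. lia.
  + subst c1. lia.
  + apply (flat_map_length_in _ _ component_boundary) in Hc. lia.
- easy.
Qed.

(** Sphere and torus have no boundary and an arc with one pole has one circle, so only the annulus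
    has to be told apart from a disc. *)
Lemma disc_component_cases (c : component) : diffeomorphic_to_disc c ->
  (forall t, ~ is_boundary c t) \/ length (component_boundary c) = 1%nat.
Proof.
intros H. unfold is_boundary, component_boundary, ends.
destruct (kind c) as [[|] [|]|] eqn:Hk; simpl.
- left. intros t [E|[E|[]]]; congruence.
- now right.
- now right.
- destruct (annulus_not_disc c Hk H).
- left. now intros t.
Qed.

Lemma eigenvalue_below (A : frame) (P Q : circle) (Sigma : surface) (mu mu' : R) :
  orthonormal A -> 0 < radius P -> 0 < radius Q -> in_S P Q Sigma ->
  (exists c, In c Sigma /\ diffeomorphic_to_disc c) ->
  disc_dirichlet_eigenvalue (Rmax (radius P) (radius Q)) mu -> mu < mu' ->
  exists lam, lam <= mu' /\ dirichlet_eigenvalue A Sigma lam.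
Proof.
intros HA HP HQ HS [c [Hc Hdisc]] Hmu Hmu'. assert (Hv := proj1 HS).
set (R0 := Rmax (radius P) (radius Q)) in *.
assert (HR : 0 < R0) by (apply Rlt_le_trans with (1 := HP), Rmax_l).
destruct (radial_family_exists _ _ _ _ _ (disc_profile R0 HR)) as [J [VJ HJ]].
destruct (disc_eigenvalue_zero R0 mu mu' J VJ HR HJ Hmu Hmu') as [x [Hx HJx]].
(* For a parameter at most 0 the solution [J] is at least 1, so its zero makes [mu'] positive. This
   also places the eigenvalue 0 of a closed component below [mu']. *)
assert (Hpos : 0 < mu').
  destruct (Rle_or_lt mu' 0) as [h|h]; [|exact h].
  assert (H1 := fam_nonpos _ _ _ _ _ HJ mu' x h Hx). lra.
destruct (disc_component_cases c Hdisc) as [Hclosed|Hlen].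
- exists 0. split; [lra|].
  apply (eigenvalue_of_component A Sigma c 0 (fun _ _ => 1) HA Hv Hc).
    apply constant_solution; [exact HA | now apply Hv | ring | now right].
  exists 0, 0. split; [unfold dom; destruct (kind c); [lra | exact I] | lra].
(* The circle with the larger radius, chosen by the same test as in [Rmax]. *)
- destruct (one_pole_component P Q (if Rle_dec (radius P) (radius Q) then Q else P) Sigma c HS Hc Hlen)
    as [c1 [t0 [sg [Hc1 [Hone Hrad]]]]].
    destruct Rle_dec; tauto.
  assert (Hrad' : pole_rad c1 t0 sg 1 = R0).
    unfold pole_rad. rewrite Hrad. unfold R0, Rmax. now destruct Rle_dec.
  assert (Hprof := one_pole_profile c1 t0 sg (Hv c1 Hc1) Hone).
  destruct (radial_family_exists _ _ _ _ _ Hprof) as [w [V H]].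
  assert (Hz := disc_comparison 1 R0 (pole_rad c1 t0 sg) (pole_drad c1 t0 sg) (pole_speed c1 t0 sg)
    (pole_dspeed c1 t0 sg) w V J VJ mu' Hprof Hrad' H HJ Hpos (ex_intro _ x (conj Hx HJx))).
  destruct (shooting 1 (pole_rad c1 t0 sg) (pole_speed c1 t0 sg) w V mu') as [lam [Hlam Hw]]; [lra | | exact H | exact Hz |].
    intros t Ht. left. apply Rdiv_lt_0_compat;
      [apply (prof_l_pos _ _ _ _ _ Hprof) | apply (prof_r_pos _ _ _ _ _ Hprof)]; lra.
  exists lam. split; [exact Hlam|].
  apply (eigenvalue_of_component A Sigma c1 lam (fun t _ => w lam (Rabs (t - t0))) HA Hv Hc1).
    exact (one_pole_solution c1 t0 sg (Hv c1 Hc1) Hone A w V lam HA H Hw).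
  exists t0, 0. split.
    apply (one_pole_dom c1 t0 sg Hone). destruct Hone as [[_ [-> _]]|[_ [-> _]]]; lra.
  rewrite Rminus_diag, Rabs_R0, (fam_w_0 _ _ _ _ _ H). lra.
Qed.

Theorem lemma1p1 (A : frame) (P Q : circle) (Sigma : surface)
    (hA : orthonormal A)
    (hP : 0 < radius P) (hQ : 0 < radius Q) (hPQ : P <> Q)
    (hSigma : in_S P Q Sigma)
    (hdisc : exists c : component, In c Sigma /\ diffeomorphic_to_disc c) :
  Rbar_le (lambda1 A Sigma) (lambda1_disc (Rmax (radius P) (radius Q))).
Proof.
unfold lambda1, lambda1_disc.
apply (proj2 (Glb_Rbar_correct (disc_dirichlet_eigenvalue (Rmax (radius P) (radius Q))))).
intros mu Hmu.
assert (Hlb := proj1 (Glb_Rbar_correct (dirichlet_eigenvalue A Sigma))).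
assert (H : forall mu', mu < mu' -> Rbar_le (Glb_Rbar (dirichlet_eigenvalue A Sigma)) mu').
  intros mu' Hmu'.
  destruct (eigenvalue_below A P Q Sigma mu mu' hA hP hQ hSigma hdisc Hmu Hmu') as [lam [Hlam Hev]].
  apply Rbar_le_trans with lam; [now apply Hlb | exact Hlam].
(* A finite bound [x] above [mu] is refuted by the midpoint. [p_infty], the value for an empty
   spectrum, is refuted by an eigenvalue at most [mu + 1]. *)
destruct (Glb_Rbar (dirichlet_eigenvalue A Sigma)) as [x| |].
- simpl in *. apply Rnot_lt_le. intros Hlt.
  assert (H1 := H ((mu + x) / 2) ltac:(lra)). lra.
- exact (H (mu + 1) ltac:(lra)).
- exact I.
Qed.
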